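(* Assume that the coefficients satisfy: for all $i,j\ge 1$, $a_{i,j}=a_{j,i}\ge 0$, $\beta_{i,j}\ge 0$, $B_1=0$, $B_i\ge 0$; $i=\sum_{j=1}^{i-1} j\,\beta_{i,j}$ for all $i\ge 2$; and, for each fixed $i\ge1$, $$\lim_{j\to+\infty}\frac{a_{i,j}}{j}=\lim_{j\to+\infty}\frac{B_{i+j}\,\beta_{i+j,i}}{i+j}=0 .$$ Assume that $0<\inf_i d_i$ and $\sup_i d_i<+\infty$, and that the initial data satisfy $c_i^0\ge 0$ for all $i\geq 1$ and $\sum_{i=1}^\infty i\,c_i^0\in L^2(\Omega)$. Assume also that there is a bounded function $\theta:[0,+\infty)\to(0,+\infty)$ with $\theta(x)\to0$ as $x\to+\infty$ such that $$a_{i,j}\le(i+j)\,\theta(j/i)\qquad\text{for all } j\ge i\ge 1 .$$ Let $c=\{c_i\}_{i\ge1}$ be a constructed global weak solution of the discrete diffusive coagulation-fragmentation system with initial data $\{c_i^0\}$. Then $c$ has a superlinear moment which is bounded on bounded time intervals; that is, there are an increasing function $C=C(T)>0$ and an increasing sequence of positive numbers $\{\psi_i\}_{i\ge1}$ with $\lim_{i\to\infty}\psi_i=+\infty$ such that for all $T>0$, $$\int_\Omega\sum_{i=1}^\infty i\,\psi_i\,c_i(t,x)\,dx\le C(T)\qquad\text{for all }t\in[0,T].$$ As a consequence, every such constructed weak solution conserves mass: with $\rho(t,x):=\sum_{i=1}^\infty i\,c_i(t,x)$ and $\rho_0(x):=\sum_{i=1}^\infty i\,c_i^0(x)$, $$\int_\Omega\rho_0(x)\,dx=\int_\Omega\rho(t,x)\,dx\qquad\text{for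 all }t\ge0 .$$
   Context: $\Omega\subseteq\mathbb{R}^N$ is a bounded open set with regular (smooth) boundary and unit normal $n$ on $\partial\Omega$. The discrete diffusive coagulation-fragmentation system, for unknowns $c_i=c_i(t,x)\ge0$, $i\ge1$, is $$\partial_t c_i-d_i\Delta_x c_i=Q_i+F_i\ \ (x\in\Omega,\ t\ge0),\qquad \nabla_x c_i\cdot n=0\ \ (x\in\partial\Omega,\ t\ge 0),\qquad c_i(0,x)=c_i^0(x)\ \ (x\in\Omega),$$ where $$Q_i=Q_i[c]=\tfrac12\sum_{j=1}^{i-1}a_{i-j,j}c_{i-j}c_j-\sum_{j=1}^\infty a_{i,j}c_ic_j,\qquad F_i=F_i[c]=\sum_{j=1}^\infty B_{i+j}\beta_{i+j,i}c_{i+j}-B_ic_i .$$ A global weak solution is a sequence of functions $c_i:[0,+\infty)\times\Omega\to[0,+\infty)$ such that, for each $T>0$ and $i\ge1$: $c_i\in C([0,T];L^1(\Omega))$; $\sum_{j=1}^\infty a_{i,j}c_ic_j\in L^1([0,T]\times\Omega)$; $\sup_{t\ge0}\int_\Omega\sum_{i=1}^\infty i\,c_i(t,x)\,dx\le\int_\Omega\sum_{i=1}^\infty i\,c_i^0(x)\,dx$; and $$c_i(t)=e^{d_iA_1t}c_i^0+\int_0^te^{d_iA_1(t-s)}\big(Q_i[c(s)]+F_i[c(s)]\big)\,ds,\qquad t\ge0,$$ where $A_1$ is the closure in $L^1(\Omega)$ of the operator $Aw=\Delta w$ on $L^2(\Omega)$ with domain $D(A)=\{w\in H^2(\Omega):\nabla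 w\cdot n=0\text{ on }\partial\Omega\}$, and $e^{d_iA_1t}$ is the $C_0$-semigroup generated by $d_iA_1$ in $L^1(\Omega)$. A constructed global weak solution is one obtained by the truncation procedure of the Laurençot–Mischler existence theorem (which guarantees that, under the stated conditions on the coefficients, $d_i>0$, and nonnegative initial data of finite mass $\int_\Omega\sum_i i\,c_i^0<\infty$, such solutions exist): it is a global weak solution such that, along a subsequence $M\to\infty$, $c_i^M\to c_i$ in $C([0,T];L^1(\Omega))$ for all $i\ge1$, $T>0$, where $(c_i^M)_{1\le i\le M}$ are nonnegative classical solutions of the truncated system $$\partial_tc_i^M-d_i\Delta c_i^M=\tfrac12\sum_{j=1}^{i-1}a_{i-j,j}c_{i-j}^Mc_j^M-\sum_{j=1}^{M-i}a_{i,j}c_i^Mc_j^M+\sum_{j=1}^{M-i}B_{i+j}\beta_{i+j,i}c_{i+j}^M-B_ic_i^M,\quad 1\le i\le M,$$ with homogeneous Neumann boundary conditions and smooth nonnegative initial data $c_i^{0,M}$ satisfying $c_i^{0,M}\to c_i^0$ in $L^1(\Omega)$ for each $i$ and $\sum_{i=1}^M i\,c_i^{0,M}\to\sum_{i=1}^\infty i\,c_i^0$ in $L^2(\Omega)$. *)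

(* Defs.v *)
From HB Require Import structures.
From mathcomp Require Import all_boot all_order all_algebra.
From mathcomp Require Import all_classical all_reals all_analysis.
From mathcomp Require Import measurable_realfun.

Set Implicit Arguments.
Unset Strict Implicit.
Unset Printing Implicit Defensive.

Import Order.TTheory GRing.Theory Num.Theory.
Import numFieldNormedType.Exports.

Local Open Scope classical_set_scope.
Local Open Scope ring_scope.

(* 'rV[T]_n carries the product sigma-algebra. *)
Definition measure_rV_display : measure_display -> measure_display.
Proof. exact. Qed.

Section measurable_rV.
Context {d} {T : measurableType d}.
Variable n : nat.

Let coors : 'I_n -> 'rV[T]_n -> T := fun i x => x ord0 i.

Let rV_set0 : g_sigma_preimage coors set0.
Proof. exact: sigma_algebra0. Qed.

Let rV_setC A : g_sigma_preimage coors A -> g_sigma_preimage coors (~` A).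
Proof. exact: sigma_algebraC. Qed.

Let rV_bigcup (F : (set 'rV[T]_n)^nat) :
  (forall i, g_sigma_preimage coors (F i)) ->
  g_sigma_preimage coors (\bigcup_i (F i)).
Proof. exact: sigma_algebra_bigcup. Qed.

HB.instance Definition _ := @isMeasurable.Build (measure_rV_display d)
  'rV[T]_n (g_sigma_preimage coors) rV_set0 rV_setC rV_bigcup.

End measurable_rV.

Lemma measurable_coord d (T : measurableType d) n (i : 'I_n) :
  measurable_fun [set: 'rV[T]_n] (fun x => x ord0 i).
Proof.
move=> _ Y mY; rewrite setTI; apply: sub_sigma_algebra => /=.
rewrite -bigcup_seq/=; exists i => /=; first by rewrite mem_index_enum.
by exists Y => //; rewrite setTI.
Qed.

Lemma measurable_fun_coordP d1 d2 (T1 : measurableType d1)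
    (T2 : measurableType d2) n (f : T1 -> 'rV[T2]_n) :
  (forall i, measurable_fun [set: T1] (fun x => f x ord0 i)) ->
  measurable_fun [set: T1] f.
Proof.
move=> mf.
suff H : g_sigma_preimage (fun i x => f x ord0 i) `<=` @measurable _ T1.
  move=> _ A mA; apply: H.
  have := @g_sigma_preimage_comp _ T2 n _ (fun i (x : 'rV[T2]_n) => x ord0 i)
    _ f.
  by move=> ->; exists A.
apply: smallest_sub; first exact: sigma_algebra_measurable.
rewrite -bigcup_seq; apply: bigcup_sub => i _ A [B mB <-].
exact: mf.
Qed.

Section lebesgue_rV.
Variable R : realType.
Local Notation mR := (measurableTypeR R).

Definition rV_cons n (p : mR * 'rV[R]_n) : 'rV[R]_n.+1 :=
  \row_i (if unlift ord0 i is Some j then p.2 ord0 j else p.1).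

Definition rV_uncons n (x : 'rV[R]_n.+1) : mR * 'rV[R]_n :=
  (x ord0 ord0, \row_j x ord0 (lift ord0 j)).

Lemma rV_consK n : cancel (@rV_cons n) (@rV_uncons n).
Proof.
case=> r x; rewrite /rV_uncons !mxE unlift_none; congr pair.
by apply/rowP => j; rewrite !mxE liftK.
Qed.

Lemma measurable_rV_cons n : measurable_fun setT (@rV_cons n).
Proof.
apply: measurable_fun_coordP => i.
case: (unliftP ord0 i) => [j ->|->].
  rewrite (_ : (fun _ => _) = (fun x : 'rV[R]_n => x ord0 j) \o snd).
    by apply: measurableT_comp => //; exact: measurable_coord.
  by apply/funext => p; rewrite /rV_cons mxE liftK.
rewrite (_ : (fun _ => _) = (fst : mR * 'rV[R]_n -> mR)).
  exact: (@measurable_fst _ _ mR 'rV[R]_n).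
by apply/funext => p; rewrite /rV_cons mxE unlift_none.
Qed.

Lemma measurable_rV_uncons n : measurable_fun setT (@rV_uncons n).
Proof.
apply/measurable_fun_pairP; split.
  exact: (@measurable_coord _ R n.+1 ord0).
apply: measurable_fun_coordP => j /=.
rewrite (_ : (fun _ => _) = (fun x : 'rV[R]_n.+1 => x ord0 (lift ord0 j))).
  exact: measurable_coord.
by apply/funext => x; rewrite mxE.
Qed.

Section step.
Variables (n : nat) (mu : {sigma_finite_measure set 'rV[R]_n -> \bar R}).

Definition lebesgue_rV_step : set 'rV[R]_n.+1 -> \bar R :=
  pushforward (@lebesgue_measure R \x mu)%E (@rV_cons n).

Let step0 : lebesgue_rV_step set0 = 0%E.
Proof. by rewrite /lebesgue_rV_step /pushforward preimage_set0 measure0. Qed.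

Let step_ge0 A : (0 <= lebesgue_rV_step A)%E.
Proof. exact: integral_ge0. Qed.

Let step_sigma_additive : semi_sigma_additive lebesgue_rV_step.
Proof.
move=> F mF tF mUF; rewrite /lebesgue_rV_step /pushforward preimage_bigcup.
have mcons A : measurable A -> measurable (@rV_cons n @^-1` A).
  by move=> mA; rewrite -[X in measurable X]setTI; exact: measurable_rV_cons.
apply: measure_semi_sigma_additive.
- by move=> k; exact: mcons.
- apply/trivIsetP => /= i j _ _ ij; rewrite -preimage_setI.
  by move/trivIsetP : tF => /(_ _ _ _ _ ij) ->//; rewrite preimage_set0.
- by rewrite -preimage_bigcup; exact: mcons.
Qed.

HB.instance Definition _ := isMeasure.Build _ _ _ lebesgue_rV_step
  step0 step_ge0 step_sigma_additive.

Let step_sigma_finite : sigma_finite setT lebesgue_rV_step.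
Proof.
have /sigma_finiteP[F [TF ndF Foo]] := sigma_finiteT (@lebesgue_measure R).
have /sigma_finiteP[G [TG ndG Goo]] := sigma_finiteT mu.
exists (fun k => @rV_uncons n @^-1` (F k `*` G k)).
  rewrite -preimage_bigcup (_ : \bigcup_i _ = setT) ?preimage_setT //.
  apply/seteqP; split => // -[x y] _.
  have [k _ Fkx] : (\bigcup_i F i) x by rewrite -TF.
  have [l _ Gly] : (\bigcup_i G i) y by rewrite -TG.
  exists (maxn k l) => //; split.
  - by move: x Fkx; exact/subsetPset/ndF/leq_maxl.
  - by move: y Gly; exact/subsetPset/ndG/leq_maxr.
move=> k; have [mF Fkoo] := Foo k; have [mG Gkoo] := Goo k; split.
  rewrite -[X in measurable X]setTI; apply: measurable_rV_uncons => //.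
  exact: measurableX.
rewrite /lebesgue_rV_step /pushforward.
rewrite (_ : _ @^-1` _ = F k `*` G k).
  by rewrite product_measure1E// lte_mul_pinfty// ge0_fin_numE.
rewrite -comp_preimage (_ : _ \o _ = id) //.
by apply/funext => p; exact: rV_consK.
Qed.

HB.instance Definition _ := Measure_isSigmaFinite.Build _ _ _ lebesgue_rV_step
  step_sigma_finite.

End step.

Fixpoint lebesgue_rV n : {sigma_finite_measure set 'rV[R]_n -> \bar R} :=
  match n return {sigma_finite_measure set 'rV[R]_n -> \bar R} with
  | 0 => @dirac _ 'rV[R]_0 (0 : 'rV[R]_0) R
  | m.+1 => lebesgue_rV_step (lebesgue_rV m)
  end.

End lebesgue_rV.

Section calculus.
Variables (R : realType) (N : nat).
Local Notation E := 'rV[R]_N.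
Implicit Types (Om U : set E) (f phi : E -> R).

Definition basis_vec (k : 'I_N) : E := delta_mx ord0 k.

Definition partial (k : 'I_N) f : E -> R := fun x => 'D_(basis_vec k) f x.

Fixpoint Ck_on U (m : nat) f : Prop :=
  match m with
  | 0 => forall x, U x -> {for x, continuous f}
  | m'.+1 => (forall x, U x -> {for x, continuous f}) /\
      forall k, (forall x, U x -> derivable f x (basis_vec k)) /\
        Ck_on U m' (partial k f)
  end.

(* Meaningful for open [U] only. *)
Definition smooth_on U f : Prop := forall m, Ck_on U m f.

Definition bdry Om : set E := closure Om `\` interior Om.

Definition local_defining_function Om U phi : Prop :=
  [/\ open U, smooth_on U phi,
      forall x, U x -> (Om x <-> phi x < 0) &
      forall x, U x -> phi x = 0 -> exists k, partial k phi x != 0].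

Definition smooth_boundary Om : Prop :=
  forall x, bdry Om x -> exists U phi, U x /\ local_defining_function Om U phi.

Definition outward_unit_normal Om (x nu : E) : Prop :=
  exists U phi, [/\ U x, local_defining_function Om U phi &
    nu = \row_k (partial k phi x / Num.sqrt (\sum_l partial l phi x ^+ 2))].

Definition test_function Om phi : Prop :=
  smooth_on setT phi /\
  exists K : set E, [/\ compact K, K `<=` Om & forall x, ~ K x -> phi x = 0].

End calculus.

(* Elements of L^1 and L^2 are represented by
   functions on R^N of which only the values on [Om] matter. *)

Section spaces.
Variables (R : realType) (N : nat) (Om : set 'rV[R]_N).
Local Notation E := 'rV[R]_N.
Local Notation mu := (lebesgue_rV R N).
Implicit Types (f g u v w : E -> R).

Definition inL1 f : Prop := mu.-integrable Om (EFin \o f).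

Definition inL2 f : Prop :=
  measurable_fun Om f /\ (\int[mu]_(x in Om) ((f x ^+ 2)%:E) < +oo)%E.

Definition L1_norm f : \bar R := (\int[mu]_(x in Om) (`|f x|%:E))%E.

Definition L1_dist f g : \bar R := L1_norm (fun x => f x - g x).

Definition L2_dist2 f g : \bar R :=
  (\int[mu]_(x in Om) (((f x - g x) ^+ 2)%:E))%E.

Definition L1_cvg (F : nat -> E -> R) f : Prop :=
  L1_dist (F n) f @[n --> \oo] --> 0%E.

Definition L2_cvg (F : nat -> E -> R) f : Prop :=
  L2_dist2 (F n) f @[n --> \oo] --> 0%E.

Definition ae_eq_on f g : Prop := {ae mu, forall x, Om x -> f x = g x}.

Definition weak_partial (k : 'I_N) w g : Prop :=
  forall phi, test_function Om phi ->
    \int[mu]_(x in Om) (w x * partial k phi x) =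
    - \int[mu]_(x in Om) (g x * phi x).

(* [g] is the gradient and [h] the Hessian of [w] in the sense of
   distributions. *)
Definition inH2 w (g : 'I_N -> E -> R) (h : 'I_N -> 'I_N -> E -> R) : Prop :=
  [/\ inL2 w, forall k, inL2 (g k) /\ weak_partial k w (g k) &
      forall k l, inL2 (h k l) /\ weak_partial l (g k) (h k l)].

(* The closure of the test functions in H^1, i.e. the functions in H^1 whose
   trace on the boundary vanishes. *)
Definition inH10 u : Prop :=
  exists (phi : nat -> E -> R) (g : 'I_N -> E -> R),
    [/\ inL2 u, forall k, inL2 (g k), forall n, test_function Om (phi n),
        L2_cvg phi u & forall k, L2_cvg (fun n => partial k (phi n)) (g k)].

(* For a gradient [g] with components in H^1, [g . n = 0] in the sense of
   traces, [n] being extended to a smooth vector field on R^N. *)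
Definition zero_normal_trace (g : 'I_N -> E -> R) : Prop :=
  exists nu : E -> E,
    [/\ forall k, smooth_on setT (fun x => nu x ord0 k),
        forall x, bdry Om x -> outward_unit_normal Om x (nu x) &
        inH10 (fun x => \sum_k g k x * nu x ord0 k)].

(* The graph of the Neumann Laplacian [A] on L^2. *)
Definition neumann_laplacian w v : Prop :=
  exists (g : 'I_N -> E -> R) (h : 'I_N -> 'I_N -> E -> R),
    [/\ inH2 w g h, zero_normal_trace g &
        forall x, Om x -> v x = \sum_k h k k x].

(* The graph of [A_1], the closure of [A] in L^1. *)
Definition neumann_laplacian_L1 u v : Prop :=
  [/\ inL1 u, inL1 v &
    exists w z : nat -> E -> R,
      [/\ forall n, neumann_laplacian (w n) (z n), L1_cvg w u & L1_cvg z v]].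

Record C0_semigroup (S : R -> (E -> R) -> (E -> R)) : Prop := {
  semigroup_L1 : forall (t : R) f, 0 <= t -> inL1 f -> inL1 (S t f);
  semigroup_linear : forall (t a : R) f g, 0 <= t -> inL1 f -> inL1 g ->
    ae_eq_on (S t (fun x => a * f x + g x)) (fun x => a * S t f x + S t g x);
  semigroup_bounded : forall t : R, 0 <= t -> exists K : R, forall f, inL1 f ->
    (L1_norm (S t f) <= K%:E * L1_norm f)%E;
  semigroup_id : forall f, inL1 f -> ae_eq_on (S 0 f) f;
  semigroup_add : forall (s t : R) f, 0 <= s -> 0 <= t -> inL1 f ->
    ae_eq_on (S (s + t) f) (S s (S t f));
  semigroup_continuous : forall f, inL1 f ->
    L1_dist (S t f) f @[t --> (0 : R)^'+] --> 0%E }.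

Definition generator (S : R -> (E -> R) -> (E -> R)) u v : Prop :=
  [/\ inL1 u, inL1 v &
    L1_dist (fun x => (S t u x - u x) / t) v @[t --> (0 : R)^'+] --> 0%E].

(* [S t] is exp(t d A_1). *)
Definition neumann_heat_semigroup (d : R) (S : R -> (E -> R) -> (E -> R)) :
    Prop :=
  C0_semigroup S /\
  forall u v, generator S u v <->
    exists2 z, neumann_laplacian_L1 u z & v = (fun x => d * z x).

(* [I] is the Bochner integral over [0, T] of [f], a function with values in
   L^1 defined almost everywhere; the simple functions are
   \sum_(k < m n) \1_(A n k) v n k, and the function [eta n] is there because
   the norm of [f s - simple s] need not be Borel measurable in [s]. *)
Definition bochner_integral (T : R) (f : R -> E -> R) (I : E -> R) : Prop :=
  [/\ inL1 I,
      {ae @lebesgue_measure R, forall s, s \in `[0, T] -> inL1 (f s)} &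
    exists (m : nat -> nat) (A : nat -> nat -> set R)
        (v : nat -> nat -> E -> R) (eta : nat -> R -> \bar R),
    [/\ forall n k, [/\ measurable (A n k), A n k `<=` `[0, T] &
                        inL1 (v n k)],
        forall n, measurable_fun `[0, T] (eta n) /\
          {ae @lebesgue_measure R, forall s, s \in `[0, T] ->
            (L1_dist (f s)
               (fun x => (\sum_(k < m n) \1_(A n k) s * v n k x)%R) <= eta n s)%E},
        (\int[@lebesgue_measure R]_(s in `[0%R, T]) eta n s)%E
          @[n --> \oo] --> 0%E &
        L1_cvg (fun n x =>
          \sum_(k < m n) fine (@lebesgue_measure R (A n k)) * v n k x) I]].

End spaces.

(* Sequences are indexed by the natural numbers [i >= 1]; their value at [0]
   is irrelevant. *)

Section system.
Variables (R : realType) (N : nat) (Om : set 'rV[R]_N).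
Local Notation E := 'rV[R]_N.
Local Notation mu := (lebesgue_rV R N).
Variables (a beta : nat -> nat -> R) (B d : nat -> R).
Implicit Types (y : nat -> R) (c : nat -> R -> E -> R).

Definition mass y : \bar R := (\sum_(1 <= i <oo) ((i%:R * y i)%:E))%E.

Definition coag_loss y (i : nat) : \bar R :=
  (\sum_(1 <= j <oo) ((a i j * y i * y j)%:E))%E.

Definition coag y (i : nat) : R :=
  2^-1 * (\sum_(1 <= j < i) a (i - j)%N j * y (i - j)%N * y j)
  - fine (coag_loss y i).

Definition frag y (i : nat) : R :=
  fine (\sum_(1 <= j <oo) ((B (i + j)%N * beta (i + j)%N i * y (i + j)%N)%:E))%E
  - B i * y i.

Record global_weak_solution (c0 : nat -> E -> R) c : Prop := {
  weak_ge0 : forall i (t : R) x, (1 <= i)%N -> 0 <= t -> Om x -> 0 <= c i t x;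
  weak_continuous : forall i (T : R), (1 <= i)%N -> 0 < T ->
    (forall t, t \in `[0, T] -> inL1 Om (c i t)) /\
    (forall t, t \in `[0, T] ->
       L1_dist Om (c i s) (c i t) @[s --> within `[0, T] (nbhs t)] --> 0%E);
  weak_loss_integrable : forall i (T : R), (1 <= i)%N -> 0 < T ->
    (@lebesgue_measure R \x mu)%E.-integrable (`[0, T] `*` Om)
      (fun p => coag_loss (fun j => c j p.1 p.2) i);
  weak_mass_le : forall t : R, 0 <= t ->
    (\int[mu]_(x in Om) mass (fun i => c i t x) <=
     \int[mu]_(x in Om) mass (fun i => c0 i x))%E;
  weak_duhamel : forall i, (1 <= i)%N ->
    exists S, neumann_heat_semigroup Om (d i) S /\
      forall t : R, 0 <= t -> exists I,
        bochner_integral Om t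
          (fun s => S (t - s) (fun x =>
             coag (fun j => c j s x) i + frag (fun j => c j s x) i)) I /\
        ae_eq_on Om (c i t) (fun x => S t (c0 i) x + I x) }.

Definition truncated_rhs (M : nat) y (i : nat) : R :=
  2^-1 * (\sum_(1 <= j < i) a (i - j)%N j * y (i - j)%N * y j)
  - \sum_(1 <= j < (M - i).+1) a i j * y i * y j
  + \sum_(1 <= j < (M - i).+1) B (i + j)%N * beta (i + j)%N i * y (i + j)%N
  - B i * y i.

Definition continuous_on_cylinder (I : set R) (f : R -> E -> R) : Prop :=
  {within I `*` closure Om, continuous (fun p : R * E => f p.1 p.2)}.

(* [u] is continuous on [0, +oo[ x closure Om, its derivatives [ut], [g], [h]
   of order one in [t] and of orders one and two in [x] exist on ]0, +oo[ x Om
   and extend continuously to ]0, +oo[ x closure Om. *)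
Definition classical_heat_neumann (D : R) (u f : R -> E -> R) : Prop :=
  exists (ut : R -> E -> R) (g : 'I_N -> R -> E -> R)
      (h : 'I_N -> 'I_N -> R -> E -> R),
  [/\ [/\ continuous_on_cylinder `[0, +oo[ u,
          continuous_on_cylinder `]0, +oo[ ut,
          forall k, continuous_on_cylinder `]0, +oo[ (g k) &
          forall k l, continuous_on_cylinder `]0, +oo[ (h k l)],
      forall (t : R) x, 0 < t -> Om x ->
        [/\ is_derive t 1 (fun s => u s x) (ut t x),
            forall k, is_derive x (basis_vec R k) (u t) (g k t x) &
            forall k l, is_derive x (basis_vec R l) (g k t) (h k l t x)],
      forall (t : R) x, 0 < t -> Om x ->
        ut t x - D * (\sum_k h k k t x) = f t x &
      forall (t : R) x nu, 0 < t -> bdry Om x -> outward_unit_normal Om x nu ->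
        \sum_k g k t x * nu ord0 k = 0].

Record truncated_solution (M : nat) (c0 : nat -> E -> R) c : Prop := {
  trunc_data : forall i, (1 <= i <= M)%N ->
    [/\ exists2 f, smooth_on setT f & forall x, closure Om x -> c0 i x = f x,
        forall x, Om x -> 0 <= c0 i x &
        forall x, closure Om x -> c i 0 x = c0 i x];
  trunc_ge0 : forall i (t : R) x, (1 <= i <= M)%N -> 0 <= t -> Om x -> 0 <= c i t x;
  trunc_eq : forall i, (1 <= i <= M)%N ->
    classical_heat_neumann (d i) (c i)
      (fun t x => truncated_rhs M (fun j => c j t x) i) }.

Definition constructed_weak_solution (c0 : nat -> E -> R) c : Prop :=
  global_weak_solution c0 c /\
  exists (cM : nat -> nat -> R -> E -> R) (c0M : nat -> nat -> E -> R)
      (sigma : nat -> nat),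
  [/\ forall M, truncated_solution M (c0M M) (cM M),
      forall i, (1 <= i)%N -> L1_cvg Om (fun M => c0M M i) (c0 i),
      (\int[mu]_(x in Om)
         (`| (\sum_(1 <= i < M.+1) i%:R * c0M M i x)%:E
             - mass (fun i => c0 i x) | ^+ 2))%E @[M --> \oo] --> 0%E,
      {homo sigma : k l / (k < l)%N} &
      forall i (T : R), (1 <= i)%N -> 0 < T ->
        ereal_sup [set L1_dist Om (cM (sigma k) i t) (c i t) |
                     t in `[0, T]] @[k --> \oo] --> 0%E].

End system.

(* Main.v *)
(* Let rho = sum_i i c_i be the mass density of a truncated solution and put
   P = sum_i i d_i c_i, so that rho_t = Laplacian of P with zero flux and
   delta rho <= P <= D rho. Testing rho(t) - rho(tau) = Laplacian of the integral of
   P over [tau, t] against P(t) bounds rho in L^2 over [tau, T] x Om by its value at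
   time tau, uniformly in the truncation. For nondecreasing psi fragmentation
   decreases the moment sum_i i psi_i c_i, and if a_(i,j) times the increment
   (i + j) psi_(i+j) - i psi_i - j psi_j is at most C i j, then coagulation increases
   it at a rate at most C times the integral of rho^2. With psi_i = H(ln i) and H
   concave and slowly increasing, this increment is of order i H(ln(1 + j/i)) for
   i <= j, which theta(j/i) compensates. Since the data have uniformly integrable
   mass, H can be taken so slow that the initial moments are bounded too. The moment
   bound passes to the limit and prevents any loss of mass at i = +oo. *)

Require Import Defs.
From HB Require Import structures.
From mathcomp Require Import all_boot all_order all_algebra.
From mathcomp Require Import all_classical all_reals all_analysis.
From mathcomp Require Import measurable_realfun.
From mathcomp Require Import ring lra zify.

Set Implicit Arguments.
Unset Strict Implicit.
Unset Printing Implicit Defensive.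

Import Order.TTheory GRing.Theory Num.Theory.
Import numFieldNormedType.Exports.

Local Open Scope classical_set_scope.
Local Open Scope ring_scope.

(** * Lebesgue measure and integration *)

(** Truncated solutions are classical only for positive times, so the estimates start at some
    [tau > 0], chosen close to 0 by continuity; additive constants in the bounds pay for this and
    for the discretization. Time integrals are replaced by Riemann sums on one grid: the bound of
    the squared density and the growth of the moment are written at the same nodes, so they combine
    without any integration in time. The gradient terms form a sum over [l <= k], nonnegative
    because it contains its diagonal. Green's formula is used only for fields without flux, hence no
    surface measure appears: near a boundary point the field is multiplied by a cutoff of the
    defining function, and the flux through the layer disappears because the normal component is
    uniformly small there while the measure of the layer is of the order of its width. A single
    sequence of thresholds determines [H]: it absorbs both the decay of [theta] and the tails of the
    initial masses, which are uniformly small because the total masses converge along with each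
    component. *)

Section lebesgue_rV_lemmas.
Variable R : realType.

(** The topology comes from the sup norm and the sigma-algebra from the coordinates; they are linked
    by the countably many boxes with rational centre and radius contained in [A]. *)
Lemma open_measurable_rV n (A : set 'rV[R]_n) : open A -> measurable A.
Proof.
move=> oA.
pose box (p : 'rV[rat]_n * rat) : set 'rV[R]_n :=
  [set x | forall i, `|x ord0 i - ratr (p.1 ord0 i)| < ratr p.2].
have mbox p : measurable (box p).
  have -> : box p = \bigcap_(i in [set: 'I_n])
      ((fun x : 'rV[R]_n => x ord0 i) @^-1`
         [set y : R | `|y - ratr (p.1 ord0 i)| < ratr p.2]).
    by apply/seteqP; split => [x bx i _|x bx i]; exact: bx.
  apply: fin_bigcap_measurable => // i _; rewrite -[X in measurable X]setTI.
  apply: measurable_coord => //.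
  rewrite (_ : [set y | _] = ball (ratr (p.1 ord0 i) : R) (ratr p.2)).
    exact: measurable_ball.
  by apply/seteqP; split => y; rewrite /ball/= distrC.
have -> : A = \bigcup_(p in [set p | box p `<=` A]) box p.
  apply/seteqP; split => [x Ax|x [p /=]]; last exact.
  have [e /= e0 xeA] : nbhs_ball x A by apply/nbhs_ballP; exact: open_nbhs_nbhs.
  have [q] := @rat_in_itvoo R 0 (e / 2) ltac:(by rewrite divr_gt0).
  rewrite in_itv/= => /andP[q0 qe].
  have r_ i : exists r, `|x ord0 i - ratr r| < ratr q.
    have [r] := @rat_in_itvoo R (x ord0 i - ratr q) (x ord0 i + ratr q) ltac:(lra).
    rewrite in_itv/= => /andP[r1 r2]; exists r.
    by rewrite ltr_norml; apply/andP; split; lra.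
  pose r i := projT1 (cid (r_ i)).
  have rP i : `|x ord0 i - ratr (r i)| < ratr q by exact: (projT2 (cid (r_ i))).
  exists (\row_i r i, q); last by move=> i; rewrite mxE; exact: rP.
  move=> y yb; apply: xeA; split => // i j; rewrite !ord1.
  have := yb j; rewrite mxE /= => yj; have := rP j => xj.
  rewrite /ball/= (_ : _ - _ = (x ord0 j - ratr (r j)) - (y ord0 j - ratr (r j))); last lra.
  by rewrite (le_lt_trans (ler_normB _ _))//; lra.
rewrite bigcup_mkcond; apply: countable_bigcupT_measurable => // i.
by case: ifPn.
Qed.

Lemma continuous_measurable_rV n (A : set 'rV[R]_n) (f : 'rV[R]_n -> R) :
  open A -> (forall x, A x -> {for x, continuous f}) -> measurable_fun A f.
Proof.
move=> oA cf; apply: (measurability _ (@RGenOpens.measurableE R)).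
move=> _ [_ [a [b ->]] <-].
suff : open (A `&` f @^-1` `]a, b[) by move=> /open_measurable_rV.
rewrite openE => x [Ax fx].
apply: (@filterI _ (nbhs x)); first exact: open_nbhs_nbhs.
apply: (cf _ Ax); apply: open_nbhs_nbhs; split => //.
Qed.

Definition cube n (r : R) : set 'rV[R]_n := [set x | forall i, `|x ord0 i| <= r].

Lemma measurable_cube n (r : R) : measurable (@cube n r).
Proof.
have -> : @cube n r = \bigcap_(i in [set: 'I_n])
    ((fun x : 'rV[R]_n => x ord0 i) @^-1` `[- r, r]).
  apply/seteqP; split => [x cx i _|x cx i] /=.
    by rewrite in_itv/= -ler_norml; exact: cx.
  by rewrite ler_norml; have := cx i I; rewrite /= in_itv.
apply: fin_bigcap_measurable => // i _; rewrite -[X in measurable X]setTI.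
by apply: measurable_coord => //; exact: measurable_itv.
Qed.

Lemma cube_lty n (r : R) : (lebesgue_rV R n (cube r) < +oo)%E.
Proof.
elim: n => [|n IH] /=; first by rewrite /dirac/= indicE; case: (_ \in _); rewrite ltry.
rewrite /lebesgue_rV_step/pushforward.
rewrite (_ : _ @^-1` _ = `[- r, r] `*` @cube n r); last first.
  apply/seteqP; split => [[t x] /= c|[t x] /= [t_r c] i]; last first.
    rewrite mxE; case: (unliftP ord0 i) => [j _ /=|_]; first exact: c.
    by move: t_r; rewrite in_itv/= -ler_norml.
  split; first by have := c ord0; rewrite mxE unlift_none/= in_itv/= -ler_norml.
  by move=> i; have := c (lift ord0 i); rewrite mxE liftK.
rewrite product_measure1E//=; [|exact: measurable_cube].
rewrite lte_mul_pinfty//; first by rewrite lebesgue_measure_itv/=; case: ifP.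
Qed.

Lemma compact_cube n (r : R) : compact (@cube n r).
Proof.
have -> : @cube n r = [set x : 'rV[R]_n | forall i, [set` `[- r, r]] (x ord0 i)].
  apply/seteqP; split => x c i; move: (c i); by rewrite /= in_itv/= ler_norml.
exact: (@rV_compact R n (fun=> [set` `[- r, r]]) (fun=> @segment_compact R _ _)).
Qed.

Lemma integrable_continuous_supp n (f : 'rV[R]_n -> R) (r : R) : continuous f ->
  (forall x, f x != 0 -> cube r x) ->
  (lebesgue_rV R n).-integrable setT (EFin \o f).
Proof.
move=> cf fr.
have mf : measurable_fun setT f.
  by apply: continuous_measurable_rV => [|x _]; [exact: openT|exact: cf].
have : bounded_set (f @` cube r).
  apply: compact_bounded; apply: continuous_compact; last exact: compact_cube.
  exact: continuous_subspaceT.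
move=> [M [_ /(_ (M + 1))]]; rewrite ltrDl ltr01 => /(_ isT) Mf.
rewrite (_ : f = f \_ (cube r)); last first.
  apply/funext => x; rewrite patchE; case: ifPn => // /negP; rewrite inE => xr.
  by have [//|/fr] := eqVneq (f x) 0.
rewrite -restrict_EFin; apply/integrable_restrict => //; first exact: measurable_cube.
rewrite setTI; apply: (@measurable_bounded_integrable _ _ _ _ f).
- exact: measurable_cube.
- exact: cube_lty.
- exact: measurable_funTS.
- exists (M + 1); split; first by rewrite num_real.
  move=> y My x cx; apply: le_trans (ltW My); apply: Mf; by exists x.
Qed.

(** For [j] a slice [rV_cons (t, _)] or [rV_cons (_, x)], this lets partial derivatives be computed
    inside the slice. *)
Lemma is_derive_affine (U V : normedModType R) (j : U -> V) (f : V -> R) x v w df :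
  (forall h : R, j (h *: v + x) = h *: w + j x) ->
  is_derive (j x) w f df -> is_derive x v (f \o j) df.
Proof.
move=> jh [fd fE].
have e : (fun h : R => h^-1 *: (((f \o j) \o shift x) (h *: v) - (f \o j) x)) =
   (fun h : R => h^-1 *: ((f \o shift (j x)) (h *: w) - f (j x))).
  by apply/funext => h /=; rewrite jh.
by split; [rewrite /derivable e|rewrite /derive e].
Qed.

Lemma integral_derivative_eq0 (G g : R -> R) (r : R) : (forall t : R, is_derive t 1 G (g t)) ->
  continuous g -> (forall t, G t != 0 -> `|t| <= r) ->
  (forall t, g t != 0 -> `|t| <= r) ->
  (\int[@lebesgue_measure R]_t (g t)%:E = 0)%E.
Proof.
move=> dG cg Gr gr.
pose s : R := `|r| + 1.
have rs : r < s by rewrite (le_lt_trans (ler_norm r))// ltrDl.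
have s0 : 0 < s by rewrite ltr_wpDl.
have out (f : R -> R) t : (forall t, f t != 0 -> `|t| <= r) -> s <= `|t| -> f t = 0.
  by move=> fr st; have [//|/fr] := eqVneq (f t) 0; lra.
transitivity (\int[@lebesgue_measure R]_(t in `[(- s)%R, s]) (g t)%:E)%E.
  rewrite [RHS]integral_mkcond; apply: eq_integral => t _; rewrite patchE.
  case: ifPn => // /negP; rewrite inE/= in_itv/= -ler_norml => /negP.
  by rewrite -ltNge => /ltW /(out g _ gr) ->.
have cG : continuous G.
  move=> t; apply: differentiable_continuous; apply/derivable1_diffP.
  exact: (@ex_derive _ _ _ _ _ _ _ (dG t)).
rewrite (@continuous_FTC2 _ _ G) //; last 4 first.
- lra.
- exact: continuous_subspaceT.
- split; first by move=> t _; exact: (@ex_derive _ _ _ _ _ _ _ (dG t)).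
  + exact: (cvg_at_right_filter (cG _)).
  + exact: (cvg_at_left_filter (cG _)).
- by move=> t _; rewrite derive1E; exact: (@derive_val _ _ _ _ _ _ _ (dG t)).
by rewrite (out G s) ?(out G (- s)) ?normrN ?(ger0_norm (ltW s0))// sube0.
Qed.

Lemma rV_cons_scale n (t s : R) (x y : 'rV[R]_n) (h : R) :
  rV_cons (h * s + t, h *: y + x) = h *: rV_cons (s, y) + rV_cons (t, x).
Proof.
by apply/rowP => i; rewrite !mxE; case: (unlift ord0 i) => [j|]; rewrite ?mxE.
Qed.

Lemma basis_vec0 n : basis_vec R (ord0 : 'I_n.+1) = rV_cons (1, 0).
Proof.
apply/rowP => i; rewrite !mxE; case: (unliftP ord0 i) => [j ->|->] /=.
  by rewrite !mxE.
by [].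
Qed.

Lemma basis_vec_lift n (k : 'I_n) :
  basis_vec R (lift ord0 k) = rV_cons (0, basis_vec R k).
Proof.
apply/rowP => i; rewrite !mxE; case: (unliftP ord0 i) => [j ->|->] /=.
  by rewrite !mxE (inj_eq lift_inj).
by [].
Qed.

Lemma rV_cons_continuousr n t : continuous (fun x : 'rV[R]_n => rV_cons (t, x)).
Proof.
move=> x A /nbhs_ballP[e /= e0 eA]; apply/nbhs_ballP; exists e => //= y [_ xy].
apply: eA; split => // i j; rewrite !mxE.
by case: (unlift ord0 j) => [l|]; [exact: xy|exact: ballxx].
Qed.

Lemma rV_cons_continuousl n (x : 'rV[R]_n) : continuous (fun t : R => rV_cons (t, x)).
Proof.
move=> t A /nbhs_ballP[e /= e0 eA]; apply/nbhs_ballP; exists e => //= s ts.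
apply: eA; split => // i j; rewrite !mxE.
by case: (unlift ord0 j) => [l|]; [exact: ballxx|].
Qed.

Lemma cube_cons n (r t : R) (x : 'rV[R]_n) :
  cube r (rV_cons (t, x)) <-> `|t| <= r /\ cube r x.
Proof.
split=> [c|[tr c] i]; last by rewrite mxE; case: (unlift ord0 i).
split; first by have := c ord0; rewrite mxE unlift_none.
by move=> i; have := c (lift ord0 i); rewrite mxE liftK.
Qed.

(** The measure in dimension [n.+1] is the image of a product, so Fubini separates the first
    coordinate. If [k] is that coordinate, the inner integral vanishes by the fundamental theorem of
    calculus; otherwise it vanishes by induction on the slices. *)
Lemma integral_partial_eq0 n (k : 'I_n) (g g' : 'rV[R]_n -> R) (r : R) :
  (forall x, is_derive x (basis_vec R k) g (g' x)) -> continuous g' ->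
  (forall x, g x != 0 -> cube r x) -> (forall x, g' x != 0 -> cube r x) ->
  (\int[lebesgue_rV R n]_x (g' x)%:E = 0)%E.
Proof.
elim: n => [|n IH] in k g g' *; first by case: k.
move=> dg cg' gr g'r.
have mg' : measurable_fun setT (EFin \o g').
  apply/measurable_EFinP.
  by apply: continuous_measurable_rV => [|x _]; [exact: openT|exact: cg'].
have mcons : measurable_fun setT (@rV_cons R n) := @measurable_rV_cons R n.
have ig : ((@lebesgue_measure R) \x (lebesgue_rV R n))%E.-integrable setT
     ((EFin \o g') \o @rV_cons R n).
  have /integrableP[_ +] := integrable_continuous_supp cg' g'r.
  rewrite /= /lebesgue_rV_step ge0_integral_pushforward//=; last first.
    exact: (measurableT_comp (@abse_measurable _ _) mg').
  by rewrite preimage_setT => ioo; apply/integrableP; split => //; exact: measurableT_comp.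
have -> : (\int[lebesgue_rV R n.+1]_x (g' x)%:E =
   \int[(@lebesgue_measure R) \x (lebesgue_rV R n)]_p (g' (rV_cons p))%:E)%E.
  by rewrite /= /lebesgue_rV_step integral_pushforward.
case: (unliftP ord0 k) => [j kE|kE].
  rewrite -(integral12_prod_meas1 ig)/= integral0_eq// => t _.
  apply: (IH j (g \o (fun x => rV_cons (t, x))) (g' \o (fun x => rV_cons (t, x)))).
  - move=> x; apply: (is_derive_affine _ (dg _)) => h.
    by rewrite kE basis_vec_lift -rV_cons_scale mulr0 add0r.
  - by move=> x; apply: continuous_comp; [exact: rV_cons_continuousr|exact: cg'].
  - by move=> x /gr /cube_cons[].
  - by move=> x /g'r /cube_cons[].
rewrite -(integral21_prod_meas1 ig)/= integral0_eq// => x _.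
apply: (@integral_derivative_eq0 (g \o (fun t => rV_cons (t, x)))
   (g' \o (fun t => rV_cons (t, x))) r).
- move=> t; apply: (is_derive_affine _ (dg _)) => h.
  by rewrite kE basis_vec0 -rV_cons_scale scaler0 add0r.
- by move=> t; apply: continuous_comp; [exact: rV_cons_continuousl|exact: cg'].
- by move=> t /gr /cube_cons[].
- by move=> t /g'r /cube_cons[].
Qed.

End lebesgue_rV_lemmas.

Section bounded_measurable.
Context d (T : measurableType d) (R : realType) (mu : {measure set T -> \bar R}).
Variables (A : set T) (mA : measurable A) (Afin : (mu A < +oo)%E).
Implicit Types f g : T -> R.

(** On a set of finite measure this class lies in [L^1], and unlike [L^1] it is closed under
    products; integrability of every polynomial expression below follows from its closure
    properties. *)
Definition bounded_measurable f :=
  measurable_fun A f /\ exists M : R, forall x, A x -> `|f x| <= M.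

Lemma bounded_measurable_cst (r : R) : bounded_measurable (fun=> r).
Proof. by split; [exact: measurable_cst|exists `|r|]. Qed.

Lemma bounded_measurableD f g : bounded_measurable f -> bounded_measurable g ->
  bounded_measurable (fun x => f x + g x).
Proof.
move=> [mf [M fM]] [mg [M' gM]]; split; first exact: measurable_funD.
exists (M + M') => x Ax; rewrite (le_trans (ler_normD _ _))//.
by rewrite lerD ?fM ?gM.
Qed.

Lemma bounded_measurableM f g : bounded_measurable f -> bounded_measurable g ->
  bounded_measurable (fun x => f x * g x).
Proof.
move=> [mf [M fM]] [mg [M' gM]]; split; first exact: measurable_funM.
by exists (M * M') => x Ax; rewrite normrM ler_pM ?fM ?gM.
Qed.

Lemma bounded_measurableN f : bounded_measurable f ->
  bounded_measurable (fun x => - f x).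
Proof.
move=> [mf [M fM]]; split; first by apply: measurableT_comp.
by exists M => x Ax; rewrite normrN fM.
Qed.

Lemma bounded_measurableB f g : bounded_measurable f -> bounded_measurable g ->
  bounded_measurable (fun x => f x - g x).
Proof. by move=> ? ?; apply/bounded_measurableD/bounded_measurableN. Qed.

Lemma bounded_measurable_norm f : bounded_measurable f ->
  bounded_measurable (fun x => `|f x|).
Proof.
move=> [mf [M fM]]; split; first by apply: measurableT_comp.
by exists M => x Ax; rewrite normr_id fM.
Qed.

Lemma bounded_measurableX f n : bounded_measurable f ->
  bounded_measurable (fun x => f x ^+ n).
Proof.
move=> bf; elim: n => [|n IH].
  by under eq_fun do rewrite expr0; exact: bounded_measurable_cst.
by under eq_fun do rewrite exprS; exact: bounded_measurableM.
Qed.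

Lemma bounded_measurable_sum (I : eqType) (s : seq I) (F : I -> T -> R) :
  {in s, forall i, bounded_measurable (F i)} ->
  bounded_measurable (fun x => \sum_(i <- s) F i x).
Proof.
elim: s => [|i s IH] bF.
  by under eq_fun do rewrite big_nil; exact: bounded_measurable_cst.
under eq_fun do rewrite big_cons.
apply: bounded_measurableD; first by apply: bF; rewrite mem_head.
by apply: IH => j js; apply: bF; rewrite inE js orbT.
Qed.

Lemma eq_bounded_measurable f g : (forall x, A x -> f x = g x) ->
  bounded_measurable f -> bounded_measurable g.
Proof.
move=> fg [mf [M fM]]; split; last by exists M => x Ax; rewrite -fg// fM.
by apply: eq_measurable_fun mf => x /set_mem; exact: fg.
Qed.

Lemma bounded_measurable_integrable f : bounded_measurable f ->
  mu.-integrable A (EFin \o f).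
Proof.
move=> [mf [M fM]]; apply: measurable_bounded_integrable => //.
exists M; split; first by rewrite num_real.
by move=> y My x Ax; apply: le_trans (fM _ Ax) (ltW My).
Qed.

Lemma Rintegral_sum (I : eqType) (s : seq I) (F : I -> T -> R) :
  {in s, forall i, mu.-integrable A (EFin \o F i)} ->
  \int[mu]_(x in A) (\sum_(i <- s) F i x) =
  \sum_(i <- s) \int[mu]_(x in A) F i x.
Proof.
elim: s => [|i s IH] iF.
  by under eq_Rintegral do rewrite big_nil; rewrite Rintegral_cst// mul0r big_nil.
rewrite big_cons -IH => [|j js]; last by apply: iF; rewrite inE js orbT.
under eq_Rintegral do rewrite big_cons.
rewrite RintegralD//; first by apply: iF; rewrite mem_head.
rewrite (_ : _ \o _ = fun x => (\sum_(i <- s) (F i x)%:E)%E); last first.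
  by apply/funext => x /=; rewrite sumEFin.
under eq_fun do rewrite big_seq.
by apply: integrable_sum => // j js; apply: iF; rewrite inE js orbT.
Qed.

End bounded_measurable.

(** * Directional derivatives, cutoffs and bumps *)

Section directional_calculus.
Variables (R : realType).

(** Passing to the restriction to a line gives the chain rule for functions that have a derivative
    along [v] but possibly no differential. *)
Lemma is_derive_lineP (V : normedModType R) (f : V -> R) x v df :
  is_derive x v f df <->
  is_derive (0 : R) 1 (f \o (fun h : R => h *: v + x)) df.
Proof.
have e : (fun h : R => h^-1 *: ((f \o shift x) (h *: v) - f x)) =
  (fun h : R => h^-1 *: (((f \o (fun h : R => h *: v + x)) \o shift 0) (h *: 1)
                         - (f \o (fun h : R => h *: v + x)) 0)).
  by apply/funext => h /=; rewrite addr0 scale0r add0r [h%:A]mulr1.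
split=> -[fd fE]; split; move: fd fE; rewrite /derivable /derive e//.
Qed.

Lemma is_derive_comp (V : normedModType R) (f : R -> R) (g : V -> R) x v a b :
  is_derive (g x) 1 f a -> is_derive x v g b -> is_derive x v (f \o g) (a * b).
Proof.
move=> fa /is_derive_lineP gb; apply/is_derive_lineP.
by apply: (@is_derive1_comp _ f (g \o (fun h : R => h *: v + x))) => //=;
  rewrite scale0r add0r.
Qed.

Lemma is_derive_unique (V : normedModType R) (f : V -> R) x v a b :
  is_derive x v f a -> is_derive x v f b -> a = b.
Proof. by move=> [_ <-] [_ <-]. Qed.

Lemma is_derive_near0 (V : normedModType R) (f : V -> R) x v :
  (\forall y \near x, f y = 0) -> is_derive x v f 0.
Proof.
move=> f0; have : is_derive x v (cst 0 : V -> R) 0 by exact: is_derive_cst.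
by apply: near_eq_is_derive; near=> y; rewrite (near f0 y).
Unshelve. all: by end_near. Qed.

Lemma is_deriveMfun (V : normedModType R) (f g : V -> R) x v a b :
  is_derive x v f a -> is_derive x v g b ->
  is_derive x v (fun y => f y * g y) (a * g x + f x * b).
Proof.
move=> fa gb; have := is_deriveM fa gb.
by rewrite [f x *: b + _]addrC [g x *: a]mulrC.
Qed.

(** The squared positive part is [C^1] and vanishes on a half-line. All cutoffs are built from it,
    as only first derivatives of cutoffs occur. *)
Definition sqp (s : R) := Num.max 0 s ^+ 2.
Definition dsqp (s : R) := 2 * Num.max 0 s.

Lemma maxr0_continuous : continuous (fun s : R => Num.max 0 s).
Proof. by move=> s; apply: continuous_max => //; exact: cvg_cst. Qed.

Lemma dsqp_continuous : continuous dsqp.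
Proof. by move=> s; apply: cvgM; [exact: cvg_cst|exact: maxr0_continuous]. Qed.

Lemma sqp_continuous : continuous sqp.
Proof.
move=> s; rewrite /sqp; under eq_fun do rewrite expr2.
by apply: cvgM; exact: maxr0_continuous.
Qed.

Lemma is_derive_sqp (s : R) : is_derive s 1 sqp (dsqp s).
Proof.
rewrite /dsqp; have [s0|s0|->] := ltgtP s 0.
- rewrite mulr0; apply: is_derive_near0.
  near=> t; rewrite /sqp max_l ?expr0n//; apply: ltW; near: t.
  exact: lt_nbhsl.
- have : is_derive s 1 (id ^+ 2 : R -> R) ((2%:R * s ^+ 1) *: 1).
    exact: is_deriveX.
  rewrite expr1 [_ *: 1]mulr1; apply: near_eq_is_derive.
  near=> t; rewrite /sqp max_r//; apply: ltW; near: t.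
  exact: lt_nbhsr.
- rewrite mulr0; suff c : h^-1 *: ((sqp \o shift 0) (h *: 1) - sqp 0) @[h --> (0 : R)^'] --> (0 : R).
    by split; [apply/cvg_ex; exists 0|exact: cvg_lim].
  apply/cvgr0Pnorm_lt => e e0; near=> h.
  have h0 : h != 0 by near: h; exact: nbhs_dnbhs_neq.
  rewrite /sqp /= addr0 [h%:A]mulr1 [Num.max 0 0]max_l// expr0n/= subr0.
  rewrite normrM normfV normrX.
  rewrite mulrC ltr_pdivrMr ?normr_gt0//.
  have he : `|h| < e by near: h; apply: dnbhs0_lt.
  apply: (@le_lt_trans _ _ (`|h| ^+ 2)).
    rewrite lerXn2r ?nnegrE//; have [h1|h1] := leP 0 h => //.
    by rewrite normr0.
  by rewrite expr2 ltr_pM2r ?normr_gt0.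
Unshelve. all: by end_near. Qed.

(* A [C^1] function equal to 0 on ]-oo, 0] and to 1 on [1, +oo[. *)
Definition step (s : R) := 1 - sqp (1 - sqp s).
Definition dstep (s : R) := dsqp (1 - sqp s) * dsqp s.

Lemma step_continuous : continuous step.
Proof.
move=> s; apply: cvgB; first exact: cvg_cst.
apply: (@continuous_comp _ _ _ (fun s => 1 - sqp s) sqp); last exact: sqp_continuous.
by apply: cvgB; [exact: cvg_cst|exact: sqp_continuous].
Qed.

Lemma dstep_continuous : continuous dstep.
Proof.
move=> s; apply: cvgM; last exact: dsqp_continuous.
apply: (@continuous_comp _ _ _ (fun s => 1 - sqp s) dsqp); last exact: dsqp_continuous.
by apply: cvgB; [exact: cvg_cst|exact: sqp_continuous].
Qed.

Lemma is_derive_subl (V : normedModType R) (f : V -> R) x v (a c : R) :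
  is_derive x v f a -> is_derive x v (fun y => c - f y) (- a).
Proof.
move=> fa; rewrite -[- a]add0r.
exact: (@is_deriveD _ _ _ (cst c) (- f) x v 0 (- a)).
Qed.

Lemma is_derive_step (s : R) : is_derive s 1 step (dstep s).
Proof.
rewrite -[dstep s]opprK; apply: is_derive_subl.
rewrite /dstep -mulrN; apply: (@is_derive_comp _ sqp (fun s => 1 - sqp s)).
  exact: is_derive_sqp.
by apply: is_derive_subl; exact: is_derive_sqp.
Qed.

Lemma step_le0 s : s <= 0 -> step s = 0.
Proof.
by move=> s0; rewrite /step /sqp (max_l s0) expr0n subr0 max_r// expr1n subrr.
Qed.

Lemma dstep_le0 s : s <= 0 -> dstep s = 0.
Proof. by move=> s0; rewrite /dstep {2}/dsqp (max_l s0) !mulr0. Qed.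

Lemma step_ge1 s : 1 <= s -> step s = 1.
Proof.
move=> s1; rewrite /step {1}/sqp max_l ?expr0n ?subr0//.
by rewrite subr_le0 /sqp max_r ?exprn_ege1//; lra.
Qed.

Lemma dstep_ge1 s : 1 <= s -> dstep s = 0.
Proof.
move=> s1; rewrite /dstep {1}/dsqp max_l ?mulr0 ?mul0r//.
by rewrite subr_le0 /sqp max_r ?exprn_ege1//; lra.
Qed.

Lemma step_itv s : 0 <= step s <= 1.
Proof.
have q0 t : 0 <= sqp t by rewrite sqr_ge0.
rewrite /step subr_ge0 gerBl q0 andbT.
rewrite /sqp expr_le1 ?le_max ?lexx// ge_max ler01/=.
by have := q0 s; rewrite /sqp; lra.
Qed.

Lemma dstep_ge0 s : 0 <= dstep s.
Proof. by rewrite /dstep /dsqp !mulr_ge0// le_max lexx. Qed.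

Lemma dstep_le4 s : dstep s <= 4.
Proof.
have [s1|s1] := leP 1 s; first by rewrite dstep_ge1.
rewrite (_ : 4 = 2 * 2)//; last lra.
rewrite /dstep /dsqp ler_pM ?mulr_ge0 ?le_max ?lexx//.
  rewrite ler_piMr// ge_max ler01/=.
  by rewrite gerBl sqr_ge0.
by rewrite ler_piMr// ge_max ler01/= ltW.
Qed.

End directional_calculus.

Arguments step {R} s.
Arguments dstep {R} s.

Lemma comp_continuous (T U V : topologicalType) (f : T -> U) (g : U -> V) :
  continuous f -> continuous g -> continuous (fun x => g (f x)).
Proof. by move=> cf cg x; apply: (continuous_comp (cf x) (cg (f x))). Qed.

Lemma mul_continuous (R : realType) (T : topologicalType) (f g : T -> R) :
  continuous f -> continuous g -> continuous (fun x => f x * g x).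
Proof. by move=> cf cg x; apply: (cvgM (cf x) (cg x)). Qed.

Section bump.
Variables (R : realType) (n : nat).
Local Notation E := 'rV[R]_n.
Variables (x0 : E) (rho : R).
Hypothesis rho0 : 0 < rho.

(** Equal to 1 for [|t| <= rho] and to 0 once [(t / rho) ^+ 2 >= 2], in particular for
    [|t| >= 3 / 2 * rho]. The square avoids the singularity of the absolute value at 0. *)
Let b (t : R) : R := step (2 - (t / rho) ^+ 2).
Let b' (t : R) : R := dstep (2 - (t / rho) ^+ 2) * - (2 * t / rho ^+ 2).

Let cq : continuous (fun t : R => 2 - (t / rho) ^+ 2).
Proof.
move=> t; apply: cvgB; first exact: cvg_cst.
by under eq_fun do rewrite expr2; apply: cvgM; apply: cvgM => //; exact: cvg_cst.
Qed.

Let cb : continuous b.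
Proof.
exact: (comp_continuous cq (@step_continuous R)).
Qed.

Let cb' : continuous b'.
Proof.
move=> t; apply: cvgM; last first.
  by apply: cvgN; apply: cvgM; [apply: cvgM => //|]; exact: cvg_cst.
exact: (comp_continuous cq (@dstep_continuous R)).
Qed.

Let db (t : R) : is_derive t 1 b (b' t).
Proof.
have dq : is_derive t 1 (fun t => 2 - (t / rho) ^+ 2) (- (2 * t / rho ^+ 2)); last first.
  exact: (@is_derive_comp _ _ step _ t 1 _ _ (is_derive_step _) dq).
apply: is_derive_subl.
have H : is_derive t (1 : R) (fun t => t * rho^-1) rho^-1.
  have := is_deriveMfun (is_derive_id t 1) (is_derive_cst (rho^-1) t 1).
  by rewrite /= mul1r mulr0 addr0.
under eq_fun do rewrite expr2.
have := is_deriveMfun H H; congr is_derive.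
by field; rewrite gt_eqF.
Qed.

Let coord_cts (i : 'I_n) : continuous (fun x : E => x ord0 i - x0 ord0 i).
Proof. move=> x; have cx := @coord_continuous R 1 n ord0 i x.
by apply: (@cvgB _ _ _ _ _ (fun y : E => y ord0 i) (cst (x0 ord0 i)) _ _ cx); exact: cvg_cst. Qed.

Let prod_cts (P : pred 'I_n) : continuous
  (fun x : E => \prod_(i | P i) b (x ord0 i - x0 ord0 i)).
Proof.
elim: (index_enum _) => [|i s IH].
  rewrite (_ : (fun _ => _) = cst (1 : R)); first exact: cst_continuous.
  by apply/funext => x; rewrite big_nil.
have [Pi|/negPf Pi] := boolP (P i); last first.
  by rewrite (_ : (fun _ => _) = fun x : E =>
    \prod_(i <- s | P i) b (x ord0 i - x0 ord0 i))//;
    apply/funext => x; rewrite big_cons Pi.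
rewrite (_ : (fun _ => _) = fun x : E => b (x ord0 i - x0 ord0 i) *
  \prod_(i <- s | P i) b (x ord0 i - x0 ord0 i)); last first.
  by apply/funext => x; rewrite big_cons Pi.
exact: (mul_continuous (comp_continuous (@coord_cts i) cb) IH).
Qed.

(** Balls for the sup norm are cubes, so a product of one-dimensional bumps does. *)
Lemma bump_function : exists (chi : E -> R) (dchi : 'I_n -> E -> R),
  [/\ forall k x, is_derive x (basis_vec R k) chi (dchi k x),
      continuous chi /\ forall k, continuous (dchi k),
      forall x, ball x0 rho x -> chi x = 1,
      forall x, ~ ball x0 (3 / 2 * rho) x -> chi x = 0 &
      forall x, 0 <= chi x].
Proof.
exists (fun x => \prod_i b (x ord0 i - x0 ord0 i)).
exists (fun k x => b' (x ord0 k - x0 ord0 k) *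
   \prod_(i | i != k) b (x ord0 i - x0 ord0 i)).
split => [k x||x [_ xb]|x xb|x].
- apply/is_derive_lineP; set C := \prod_(i | _) _.
  rewrite (_ : _ \o _ = (fun h => b (h + (x ord0 k - x0 ord0 k)) * C)); last first.
    apply/funext => h /=; rewrite (bigD1 k)//=; congr (_ * _).
      by rewrite !mxE !eqxx mulr1 addrA.
    apply: eq_bigr => i /negPf ik; rewrite !mxE ik andbF mulr0 add0r//.
  have H : is_derive (0 : R) 1 (fun h => b (h + (x ord0 k - x0 ord0 k)))
      (b' (x ord0 k - x0 ord0 k)).
    have H0 : is_derive (0 : R) 1 (fun h : R => h + (x ord0 k - x0 ord0 k)) 1.
      rewrite -[X in is_derive _ _ _ X]addr0.
      exact: (@is_deriveD _ _ _ id (cst (x ord0 k - x0 ord0 k))).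
    have := db (0 + (x ord0 k - x0 ord0 k)); rewrite {2}add0r => db0.
    have := @is_derive_comp _ _ b (fun h : R => h + (x ord0 k - x0 ord0 k)) _ _ _ _ db0 H0.
    by rewrite mulr1.
  have := is_deriveMfun H (is_derive_cst C (0 : R) (1 : R)).
  by rewrite /= mulr0 addr0.
- split=> [|k]; first exact: (@prod_cts xpredT).
  exact: (mul_continuous (comp_continuous (@coord_cts k) cb') (@prod_cts _)).
- rewrite big1// => i _; rewrite /b step_ge1//.
  have := xb ord0 i; rewrite /ball/= distrC => xi.
  have : ((x ord0 i - x0 ord0 i) / rho) ^+ 2 <= 1.
    rewrite -real_normK ?num_real// expr_le1// normrM normfV (gtr0_norm rho0).
    by rewrite ler_pdivrMr// mul1r ltW.
  lra.
- have [i xi] : exists i, 3 / 2 * rho <= `|x ord0 i - x0 ord0 i|.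
    apply/not_existsP => H; apply: xb; split=> [|i j]; first by rewrite mulr_gt0//; lra.
    by rewrite !ord1 /ball/= distrC ltNge; apply/negP; exact: H.
  rewrite (bigD1 i)//= /b step_le0 ?mul0r//.
  suff : 9 / 4 <= ((x ord0 i - x0 ord0 i) / rho) ^+ 2 by lra.
  rewrite -real_normK ?num_real// normrM normfV (gtr0_norm rho0).
  have : 3 / 2 <= `|x ord0 i - x0 ord0 i| / rho by rewrite ler_pdivlMr.
  move: (_ / rho) => t t32; rewrite (_ : 9 / 4 = (3 / 2) ^+ 2); last by field.
  by rewrite lerXn2r// nnegrE; lra.
- by apply: prodr_ge0 => i _; have /andP[] := step_itv (2 - ((x ord0 i - x0 ord0 i) / rho) ^+ 2).
Qed.

End bump.

(** * The divergence theorem for fields with zero flux *)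

Section domain.
Variables (R : realType) (n : nat).
Local Notation E := 'rV[R]_n.
Local Notation mu := (lebesgue_rV R n).
Implicit Types (Om W : set E) (f g : E -> R).

Lemma bounded_sub_cube Om : bounded_set Om -> exists M : R, Om `<=` cube M.
Proof.
move=> [M [_ /(_ (M + 1))]]; rewrite ltrDl ltr01 => /(_ isT) OM.
exists (M + 1) => x Omx i; apply: le_trans (OM _ Omx).
rewrite [`|x|]mx_normrE; exact: (@le_bigmax _ _ _ 0 (fun j => `|x j.1 j.2|) (ord0, i)).
Qed.

Lemma compact_closure_bounded Om : bounded_set Om -> compact (closure Om).
Proof.
move=> /bounded_sub_cube[M OM].
apply: (subclosed_compact _ (@compact_cube R n M)); first exact: closed_closure.
rewrite closureE => x; apply; split => //.
by apply: compact_closed; [exact: norm_hausdorff|exact: compact_cube].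
Qed.

Lemma open_bounded_lty Om : open Om -> bounded_set Om -> (mu Om < +oo)%E.
Proof.
move=> oO /bounded_sub_cube[M OM].
apply: le_lt_trans (cube_lty n M); apply: le_measure => //; rewrite inE.
  exact: open_measurable_rV.
exact: measurable_cube.
Qed.

Lemma within_closure_continuous Om f x : open Om ->
  {within closure Om, continuous f} -> Om x -> {for x, continuous f}.
Proof.
move=> oO cf Ox.
have := @continuous_subspaceW _ _ _ _ f (@subset_closure _ Om) cf.
by rewrite continuous_open_subspace// => /(_ x); rewrite inE; apply.
Qed.

Lemma within_closure_bounded_measurable Om f : open Om -> bounded_set Om ->
  {within closure Om, continuous f} -> bounded_measurable Om f.
Proof.
move=> oO bO cf; split.
  by apply: continuous_measurable_rV => // x; exact: within_closure_continuous.
have /compact_bounded[M [_ /(_ (M + 1))]] :=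
  continuous_compact cf (compact_closure_bounded bO).
rewrite ltrDl ltr01 => /(_ isT) fM; exists (M + 1) => x Ox.
by apply: fM; exists x => //; exact: subset_closure.
Qed.

(* [g] extended by zero outside [W] is a compactly supported [C^1] function. *)
Lemma integral_local_partial_eq0 (k : 'I_n) W g g' (r : R) : open W ->
  W `<=` cube r ->
  (forall x, W x -> is_derive x (basis_vec R k) g (g' x)) ->
  (forall x, W x -> {for x, continuous g'}) ->
  (forall x, ~ W x -> \forall y \near x, W y -> g y = 0 /\ g' y = 0) ->
  (\int[mu]_(x in W) (g' x)%:E = 0)%E.
Proof.
move=> oW Wr dg cg' g0.
rewrite integral_mkcond restrict_EFin.
have out (h : E -> R) x : (h \_ W) x != 0 -> cube r x.
  by rewrite patchE; case: ifPn => [/set_mem/Wr//|_]; rewrite eqxx.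
have near_in x (h : E -> R) : W x -> \forall y \near x, h y = (h \_ W) y.
  move=> Wx; near=> y; rewrite patchE mem_set//.
  by near: y; exact: open_nbhs_nbhs.
apply: (@integral_partial_eq0 _ _ k (g \_ W) (g' \_ W) r).
- move=> x; have [Wx|Wx] := pselect (W x).
    rewrite patchE mem_set//; apply: (@near_eq_is_derive _ _ _ g); last exact: dg.
    exact: near_in.
  rewrite patchE memNset//; apply: is_derive_near0.
  have := g0 _ Wx; apply: filterS => y gy; rewrite patchE.
  by case: ifPn => // /set_mem/gy[].
- move=> x; have [Wx|Wx] := pselect (W x).
    rewrite /continuous_at patchE mem_set//.
    apply: (cvg_trans _ (cg' _ Wx)).
    exact: (@near_eq_cvg _ _ (nbhs x) _ _ _ (near_in x g' Wx)).
  rewrite /continuous_at patchE memNset//.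
  apply: (@cvg_trans _ ((fun=> 0 : R) @ nbhs x)); last first.
    exact: (@cvg_cst _ (0 : R) _ (nbhs x) _).
  apply: (@near_eq_cvg _ _ (nbhs x)); have := g0 _ Wx; apply: filterS => y gy.
  by rewrite patchE; case: ifPn => // /set_mem/gy[].
- exact: out.
- exact: out.
Unshelve. all: by end_near. Qed.

End domain.

Section boundary_layer.
Variables (R : realType) (n : nat).
Local Notation E := 'rV[R]_n.
Local Notation mu := (lebesgue_rV R n).

(** Composed with a defining function [phi], it is 1 where [phi <= - (2 * e)] and 0 where
    [- e <= phi]: the transition takes place strictly inside the domain. [dcutoff] is minus the
    derivative, hence nonnegative. *)
Definition cutoff (e s : R) : R := step (- 1 - s / e).
Definition dcutoff (e s : R) : R := dstep (- 1 - s / e) / e.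

Lemma cutoff_itv (e s : R) : 0 <= cutoff e s <= 1.
Proof. exact: step_itv. Qed.

Lemma dcutoff_ge0 (e s : R) : 0 < e -> 0 <= dcutoff e s.
Proof. by move=> e0; rewrite divr_ge0 ?(ltW e0)// dstep_ge0. Qed.

Lemma dcutoff_le (e s : R) : 0 < e -> dcutoff e s <= 4 / e.
Proof. by move=> e0; rewrite ler_pM2r ?invr_gt0// dstep_le4. Qed.

Lemma cutoff_eq0 (e s : R) : 0 < e -> - e <= s -> cutoff e s = 0 /\ dcutoff e s = 0.
Proof.
move=> e0 es; have h : - 1 - s / e <= 0.
  have : - 1 <= s / e by rewrite ler_pdivlMr// mulN1r.
  lra.
by rewrite /cutoff /dcutoff step_le0// dstep_le0// mul0r.
Qed.

Lemma cutoff_eq1 (e s : R) : 0 < e -> s <= - (2 * e) -> cutoff e s = 1 /\ dcutoff e s = 0.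
Proof.
move=> e0 es; have h : 1 <= - 1 - s / e.
  have : s / e <= - 2 by rewrite ler_pdivrMr// mulNr.
  lra.
by rewrite /cutoff /dcutoff step_ge1// dstep_ge1// mul0r.
Qed.

Let affine_cts (e : R) : continuous (fun s : R => - 1 - s / e).
Proof.
move=> s; apply: cvgB; first exact: cvg_cst.
by apply: cvgM => //; exact: cvg_cst.
Qed.

Lemma cutoff_continuous e : continuous (cutoff e).
Proof. exact: (comp_continuous (@affine_cts e) (@step_continuous R)). Qed.

Lemma dcutoff_continuous e : continuous (dcutoff e).
Proof.
have c := comp_continuous (@affine_cts e) (@dstep_continuous R).
by move=> s; apply: (cvgM (c s)); exact: cvg_cst.
Qed.

Lemma is_derive_cutoff (e s : R) : is_derive s 1 (cutoff e) (- dcutoff e s).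
Proof.
rewrite /dcutoff -mulrN.
have H : is_derive s 1 (fun t : R => - 1 - t / e) (- e^-1).
  apply: is_derive_subl.
  have := is_deriveMfun (is_derive_id s 1) (is_derive_cst (e^-1) s 1).
  by rewrite /= mul1r mulr0 addr0.
exact: (@is_derive_comp _ _ step _ s 1 _ _ (is_derive_step _) H).
Qed.

Variables (Om : set E) (x0 : E) (rho : R) (phi : E -> R).
Hypotheses (oO : open Om) (rho0 : 0 < rho).
Hypothesis Ophi : forall x, ball x0 rho x -> (Om x <-> phi x < 0).
Hypothesis cphi : forall x, ball x0 rho x -> {for x, continuous phi}.
Hypothesis dphi : forall x k, ball x0 rho x -> derivable phi x (basis_vec R k).
Hypothesis cdphi : forall x k, ball x0 rho x -> {for x, continuous (partial k phi)}.

Local Notation W := (Om `&` ball x0 rho).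

Lemma boundary_patch_open : open W.
Proof. by apply: openI => //; exact: ball_open. Qed.

Lemma ball_sub_cube : exists r : R, ball x0 rho `<=` cube r.
Proof.
exists (`|x0| + rho) => x [_ xb] i.
have := xb ord0 i; rewrite /ball/= => xi.
rewrite (_ : x ord0 i = x0 ord0 i - (x0 ord0 i - x ord0 i)); last lra.
rewrite (le_trans (ler_normB _ _))// lerD// ?(ltW xi)//.
by rewrite [`|x0|]mx_normrE; exact: (@le_bigmax _ _ _ 0 (fun j => `|x0 j.1 j.2|) (ord0, i)).
Qed.

Lemma boundary_patch_lty : (mu W < +oo)%E.
Proof.
have [r xr] := ball_sub_cube.
apply: le_lt_trans (cube_lty n r); apply: le_measure; rewrite ?inE.
- by apply: open_measurable_rV; exact: boundary_patch_open.
- exact: measurable_cube.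
- by move=> x [_ /xr].
Qed.

(** The product of [q] with the cutoff is zero near every point outside [W]: at points of the ball
    outside [Om] one has [phi >= 0], so the cutoff vanishes nearby; at points outside the ball the
    last hypothesis applies. *)
Lemma integral_cutoff_eq0 (e : R) k (q q' : E -> R) : 0 < e ->
  (forall x, W x -> is_derive x (basis_vec R k) q (q' x)) ->
  (forall x, W x -> {for x, continuous q}) ->
  (forall x, W x -> {for x, continuous q'}) ->
  (forall x, ~ ball x0 rho x -> \forall y \near x, W y -> q y = 0 /\ q' y = 0) ->
  (\int[mu]_(x in W) (q' x * cutoff e (phi x)
     - q x * (dcutoff e (phi x) * partial k phi x))%:E = 0)%E.
Proof.
move=> e0 dq cq cq' q0; have [r xr] := ball_sub_cube.
apply: (@integral_local_partial_eq0 _ _ k W (fun x => q x * cutoff e (phi x)) _ r).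
- exact: boundary_patch_open.
- by move=> x [_ /xr].
- move=> x Wx; have [_ xb] := Wx.
  have Dphi : is_derive x (basis_vec R k) phi (partial k phi x).
    exact/derivableP/dphi.
  have := is_deriveMfun (dq x Wx) (is_derive_comp (is_derive_cutoff e _) Dphi).
  by rewrite mulNr mulrN.
- move=> x Wx; have [_ xb] := Wx.
  have c1 : {for x, continuous (cutoff e \o phi)}.
    by apply: continuous_comp; [exact: cphi|exact: cutoff_continuous].
  have c2 : {for x, continuous (dcutoff e \o phi)}.
    by apply: continuous_comp; [exact: cphi|exact: dcutoff_continuous].
  have c3 := continuousM (cq' x Wx) c1.
  have c4 := continuousM (cq x Wx) (continuousM c2 (@cdphi x k xb)).
  exact: (continuousB c3 c4).
- move=> x Wx; have [xb|xb] := pselect (ball x0 rho x); last first.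
    by have := q0 x xb; apply: filterS => y qy Wy; have [-> ->] := qy Wy; rewrite !mul0r subr0.
  have phix : - e < phi x.
    rewrite (@lt_le_trans _ _ 0) ?oppr_lt0// leNgt; apply/negP => h; apply: Wx.
    by split => //; apply/Ophi.
  have : \forall y \near x, - e < phi y.
    by have := cphi xb; move=> /(_ _ (lt_nbhsr phix)) /=.
  apply: filterS => y ey Wy; have [-> ->] := cutoff_eq0 e0 (ltW ey).
  by rewrite !(mulr0, mul0r) subr0.
Qed.

End boundary_layer.

Lemma bounded_measurableS d (T : measurableType d) (R : realType)
  (A B : set T) (f : T -> R) : measurable B -> A `<=` B ->
  bounded_measurable B f -> bounded_measurable A f.
Proof.
move=> mB AB [mf [M fM]]; split; first exact: measurable_funS mf.
by exists M => x /AB; exact: fM.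
Qed.

Section zero_flux.
Variables (R : realType) (n : nat).
Local Notation E := 'rV[R]_n.
Local Notation mu := (lebesgue_rV R n).

(** Only the derivatives that enter the divergence are recorded, which is enough when integrating
    one coordinate at a time. *)
Record zero_flux_field (Om : set E) (F D : 'I_n -> E -> R) : Prop := {
  flux_continuous : forall k, {within closure Om, continuous (F k)};
  flux_derive : forall k x, Om x -> is_derive x (basis_vec R k) (F k) (D k x);
  flux_dcontinuous : forall k, {within closure Om, continuous (D k)};
  flux_normal : forall x nu, bdry Om x -> outward_unit_normal Om x nu ->
    \sum_k F k x * nu ord0 k = 0 }.

Arguments flux_continuous {Om F D} _ k.
Arguments flux_dcontinuous {Om F D} _ k.
Arguments flux_derive {Om F D} _ k [x].

Lemma near_notin_ball (x0 x : E) (a b : R) : a < b -> ~ ball x0 b x ->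
  \forall y \near x, ~ ball x0 a y.
Proof.
move=> ab xb; have ba : 0 < b - a by rewrite subr_gt0.
apply/nbhs_ballP; exists (b - a) => //= y xy ya; apply: xb.
by rewrite -[b](subrK a) addrC; apply: ball_triangle ya _; exact: ball_sym.
Qed.

Lemma closure_ball_sub (x0 : E) (a b : R) : a < b -> closure (ball x0 a) `<=` ball x0 b.
Proof.
move=> ab x cx; apply: contrapT => xb.
by have [y []] := cx _ (near_notin_ball ab xb).
Qed.

Variables (Om : set E) (F D : 'I_n -> E -> R).
Hypotheses (oO : open Om) (bO : bounded_set Om) (FD : zero_flux_field Om F D).

Lemma flux_near0 x : Om x -> (\forall y \near x, Om y -> forall k, F k y = 0) ->
  forall k, F k x = 0 /\ D k x = 0.
Proof.
move=> Ox Fx k.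
have F0 : \forall y \near x, F k y = 0.
  near=> y; apply: (near Fx y) => //.
  by near: y; exact: open_nbhs_nbhs.
split; first exact: nbhs_singleton F0.
exact: is_derive_unique (flux_derive FD k Ox) (is_derive_near0 _ F0).
Unshelve. all: by end_near. Qed.

Let bmF k : bounded_measurable Om (F k).
Proof. exact/within_closure_bounded_measurable/(flux_continuous FD). Qed.

Let bmD k : bounded_measurable Om (D k).
Proof. exact/within_closure_bounded_measurable/(flux_dcontinuous FD). Qed.

Lemma flux_restrict (V : set E) : measurable V ->
  (forall x, Om x -> ~ V x -> forall k, D k x = 0) ->
  \int[mu]_(x in Om) (\sum_k D k x) = \int[mu]_(x in Om `&` V) (\sum_k D k x).
Proof.
move=> mV D0; rewrite Rintegral_mkcondr; apply: eq_Rintegral => x /set_mem Ox.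
rewrite patchE; case: ifPn => // /negP; rewrite inE => Vx.
by rewrite big1// => k _; exact: D0.
Qed.

Lemma zero_flux_interior (x0 : E) (rho : R) : 0 < rho -> ball x0 rho `<=` Om ->
  (forall x, Om x -> ~ ball x0 (rho / 2) x -> forall k, F k x = 0) ->
  \int[mu]_(x in Om) (\sum_k D k x) = 0.
Proof.
move=> rho0 xO F0; have rho2 : rho / 2 < rho by lra.
have FD0 x : ~ ball x0 rho x -> \forall y \near x, Om y -> forall k, F k y = 0 /\ D k y = 0.
  move=> xb; have := nbhs_interior (near_notin_ball rho2 xb).
  apply: filterS => y yb Oy; apply: flux_near0 => //.
  by apply: filterS yb => z zb Oz; exact: F0.
rewrite (@flux_restrict (ball x0 rho)); last first.
- by move=> x Ox /FD0 /nbhs_singleton /(_ Ox) h k; have [] := h k.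
- by apply: open_measurable_rV; exact: ball_open.
have -> : Om `&` ball x0 rho = ball x0 rho.
  by apply/seteqP; split => [x []//|x xb]; split => //; exact: xO.
have mb : measurable (ball x0 rho) by apply: open_measurable_rV; exact: ball_open.
have bfin : (mu (ball x0 rho) < +oo)%E.
  have := boundary_patch_lty x0 rho oO.
  by rewrite (_ : _ `&` _ = ball x0 rho)//; apply/seteqP; split => [x []//|x xb]; split => //; exact: xO.
have iD k : mu.-integrable (ball x0 rho) (EFin \o D k).
  apply: bounded_measurable_integrable => //.
  by apply: bounded_measurableS (bmD k) => //; exact: open_measurable_rV.
rewrite Rintegral_sum// big1// => k _; rewrite /Rintegral.
have [r xr] := ball_sub_cube x0 rho.
suff -> : (\int[mu]_(x in ball x0 rho) (D k x)%:E = 0)%E by [].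
apply: (@integral_local_partial_eq0 _ _ k (ball x0 rho) (F k) (D k) r) => //.
- exact: ball_open.
- by move=> x /xO; exact: flux_derive.
- move=> x /xO; apply: within_closure_continuous => //; exact: flux_dcontinuous FD k.
- by move=> x /FD0; apply: filterS => y yy /xO/yy.
Qed.

End zero_flux.

Arguments flux_continuous {R n Om F D} _ k.
Arguments flux_dcontinuous {R n Om F D} _ k.
Arguments flux_derive {R n Om F D} _ k [x].

Lemma within_cvg (R : realType) (T : topologicalType) (f : T -> R) (K : set T) x :
  f y @[y --> nbhs x] --> f x -> f y @[y --> within K (nbhs x)] --> f x.
Proof. exact: (@cvg_within_filter _ _ f (nbhs x) _ (nbhs (f x)) K). Qed.

Section zero_flux_boundary.
Variables (R : realType) (n : nat).
Local Notation E := 'rV[R]_n.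
Local Notation mu := (lebesgue_rV R n).
Variables (Om : set E) (F D : 'I_n -> E -> R).
Hypotheses (oO : open Om) (bO : bounded_set Om) (FD : zero_flux_field Om F D).
Variables (x0 : E) (rho : R) (phi : E -> R).
Hypothesis rho0 : 0 < rho.
Hypothesis Ophi : forall x, ball x0 rho x -> (Om x <-> phi x < 0).
Hypothesis cphi : forall x, ball x0 rho x -> {for x, continuous phi}.
Hypothesis dphi : forall x k, ball x0 rho x -> derivable phi x (basis_vec R k).
Hypothesis cdphi : forall x k, ball x0 rho x -> {for x, continuous (partial k phi)}.
Variables (M delta s : R) (k0 : 'I_n).
Hypothesis dphiM : forall x k, ball x0 rho x -> `|partial k phi x| <= M.
Hypothesis (delta0 : 0 < delta) (s1 : `|s| = 1).
Hypothesis dphi_delta : forall x, ball x0 rho x -> delta <= s * partial k0 phi x.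
Hypothesis normal : forall x, ball x0 rho x -> bdry Om x ->
  \sum_k F k x * partial k phi x = 0.
Hypothesis F0 : forall x, Om x -> ~ ball x0 (rho / 2) x -> forall k, F k x = 0.

Local Notation W := (Om `&` ball x0 rho).
(** Up to the length of the gradient of [phi], the normal component of the field, extended to the
    interior along the level sets of [phi]. *)
Let A x := \sum_k F k x * partial k phi x.

Let oW : open W.
Proof. exact: boundary_patch_open. Qed.

Let mW : measurable W.
Proof. exact: open_measurable_rV. Qed.

Let Wfin : (mu W < +oo)%E.
Proof. exact: boundary_patch_lty. Qed.

Let bmF k : bounded_measurable W (F k).
Proof.
apply: (@bounded_measurableS _ _ _ _ Om); [exact: open_measurable_rV|by move=> x []|].
exact/within_closure_bounded_measurable/(flux_continuous FD).
Qed.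

Let bmD k : bounded_measurable W (D k).
Proof.
apply: (@bounded_measurableS _ _ _ _ Om); [exact: open_measurable_rV|by move=> x []|].
exact/within_closure_bounded_measurable/(flux_dcontinuous FD).
Qed.

Let bmphi k : bounded_measurable W (partial k phi).
Proof.
split; last by exists M => x [_ /dphiM].
by apply: continuous_measurable_rV => // x [_ xb]; exact: cdphi.
Qed.

Let bmA : bounded_measurable W A.
Proof.
apply: bounded_measurable_sum => k _; apply: bounded_measurableM; first exact: bmF.
exact: bmphi.
Qed.

Let bmcut e : bounded_measurable W (fun x => cutoff e (phi x)).
Proof.
split; last first.
  by exists 1 => x _; have /andP[c0 c1] := cutoff_itv e (phi x); rewrite ger0_norm.
apply: continuous_measurable_rV => // x [_ xb].
by apply: (@continuous_comp _ _ _ phi (cutoff e)); [exact: cphi|exact: cutoff_continuous].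
Qed.

Let bmdcut (e : R) : 0 < e -> bounded_measurable W (fun x => dcutoff e (phi x)).
Proof.
move=> e0; split; last first.
  by exists (4 / e) => x _; rewrite ger0_norm ?dcutoff_ge0 ?dcutoff_le.
apply: continuous_measurable_rV => // x [_ xb].
by apply: (@continuous_comp _ _ _ phi (dcutoff e)); [exact: cphi|exact: dcutoff_continuous].
Qed.

Let bmcts (f : E -> R) : continuous f -> bounded_measurable W f.
Proof.
move=> cf; split; first by apply: continuous_measurable_rV => // x _; exact: cf.
have [r xr] := ball_sub_cube x0 rho.
have : bounded_set (f @` cube r).
  apply: compact_bounded; apply: continuous_compact; last exact: compact_cube.
  exact: continuous_subspaceT.
move=> [C [_ /(_ (C + 1))]]; rewrite ltrDl ltr01 => /(_ isT) fC.
by exists (C + 1) => x [_ /xr xc]; apply: fC; exists x.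
Qed.

Let int f : bounded_measurable W f -> mu.-integrable W (EFin \o f).
Proof. exact: bounded_measurable_integrable. Qed.

(* Since [partial k0 phi] is bounded away from zero, the measure of the layer
   where the cutoff varies is proportional to its width; the divergence
   identity for the bump times the cutoff gives this in integrated form. *)
Let layer_bound : exists (chi : E -> R) (C : R),
  [/\ bounded_measurable W chi, forall x, 0 <= chi x,
      forall x, ball x0 (rho / 2) x -> chi x = 1 &
      forall e : R, 0 < e -> \int[mu]_(x in W) (chi x * dcutoff e (phi x)) <= C].
Proof.
have rho2 : 0 < rho / 2 by rewrite divr_gt0.
have [chi [dchi [chid [cchi cdchi] chi1 chi0 chi_ge0]]] := @bump_function R n x0 (rho / 2) rho2.
have bchi := bmcts cchi; have bdchi := bmcts (cdchi k0).
exists chi, (delta^-1 * \int[mu]_(x in W) `|dchi k0 x|); split => // e e0.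
have r34 : 3 / 2 * (rho / 2) < rho by move: rho0; lra.
have near0 x : ~ ball x0 rho x ->
    \forall y \near x, W y -> chi y = 0 /\ dchi k0 y = 0.
  move=> xb; have := nbhs_interior (near_notin_ball r34 xb).
  apply: filterS => y yb _.
  have c0 : \forall z \near y, chi z = 0 by apply: filterS yb => z; exact: chi0.
  split; first exact: nbhs_singleton c0.
  exact: is_derive_unique (chid k0 y) (is_derive_near0 _ c0).
have I0 := @integral_cutoff_eq0 _ _ _ _ _ _ oO Ophi cphi dphi cdphi e k0 chi (dchi k0) e0
  (fun x _ => chid k0 x) (fun x _ => cchi x) (fun x _ => cdchi k0 x) near0.
have bd := bmdcut e0; have bc := bmcut e.
have b1 := bounded_measurableM bdchi bc.
have b2 := bounded_measurableM bchi (bounded_measurableM bd (bmphi k0)).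
have IE : \int[mu]_(x in W) (chi x * (dcutoff e (phi x) * partial k0 phi x)) =
          \int[mu]_(x in W) (dchi k0 x * cutoff e (phi x)).
  apply/esym/eqP; rewrite -subr_eq0 -RintegralB//; [|exact: int|exact: int].
  by rewrite /Rintegral I0.
rewrite ler_pdivlMl// -RintegralZl//; last exact/int/bounded_measurableM.
apply: (@le_trans _ _ (s * \int[mu]_(x in W) (dchi k0 x * cutoff e (phi x)))).
  rewrite -IE -RintegralZl//; last exact: int.
  apply: le_Rintegral => //.
  - apply/int/bounded_measurableM; first exact: bounded_measurable_cst.
    exact: bounded_measurableM.
  - by apply/int/bounded_measurableM => //; exact: bounded_measurable_cst.
  - move=> x [_ xb]; rewrite [delta * _]mulrC.
    rewrite (_ : s * _ = (chi x * dcutoff e (phi x)) * (s * partial k0 phi x)); last ring.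
    by apply: ler_wpM2l; [rewrite mulr_ge0 ?dcutoff_ge0|exact: dphi_delta].
apply: le_trans (ler_norm _) _; rewrite normrM s1 mul1r.
apply: le_trans (le_normr_Rintegral _ (int b1)) _ => //.
apply: le_Rintegral => //.
- exact/int/bounded_measurable_norm.
- exact/int/bounded_measurable_norm.
- move=> x _; rewrite normrM ler_piMr//.
  by have /andP[c0 c1] := cutoff_itv e (phi x); rewrite ger0_norm.
Qed.

(** Summing [integral_cutoff_eq0] over the components [F k] turns the cut-off divergence into the
    flux through the layer. *)
Let flux_cutoff (e : R) : 0 < e ->
  \int[mu]_(x in W) ((\sum_k D k x) * cutoff e (phi x)) =
  \int[mu]_(x in W) (A x * dcutoff e (phi x)).
Proof.
move=> e0; have bd := bmdcut e0; have bc := bmcut e.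
have rho2 : rho / 2 < rho by move: rho0; lra.
have FD0 k x : ~ ball x0 rho x -> \forall y \near x, W y -> F k y = 0 /\ D k y = 0.
  move=> xb; have := nbhs_interior (near_notin_ball rho2 xb).
  apply: filterS => y yb [Oy _]; apply: (flux_near0 oO FD) => //.
  by apply: filterS yb => z zb Oz; exact: F0.
have I0 k := @integral_cutoff_eq0 _ _ _ _ _ _ oO Ophi cphi dphi cdphi e k (F k) (D k) e0
  (fun x Wx => flux_derive FD k Wx.1)
  (fun x Wx => within_closure_continuous oO (flux_continuous FD k) Wx.1)
  (fun x Wx => within_closure_continuous oO (flux_dcontinuous FD k) Wx.1) (@FD0 k).
have bD : bounded_measurable W (fun x => \sum_k D k x).
  by apply: bounded_measurable_sum => k _; exact: bmD.
apply/eqP; rewrite -subr_eq0 -RintegralB//; last 2 first.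
- exact/int/bounded_measurableM.
- by apply/int/bounded_measurableM => //; exact: bmA.
apply/eqP; transitivity (\int[mu]_(x in W) (\sum_k (D k x * cutoff e (phi x)
     - F k x * (dcutoff e (phi x) * partial k phi x)))).
  apply: eq_Rintegral => x _; rewrite sumrB -mulr_suml; congr (_ - _).
  by rewrite /A mulr_suml; apply: eq_bigr => k _; ring.
rewrite Rintegral_sum//.
  by rewrite big1// => k _; rewrite /Rintegral I0.
move=> k _; apply: int; apply: bounded_measurableB.
  exact: bounded_measurableM.
by apply: bounded_measurableM => //; exact: bounded_measurableM.
Qed.

(** [A] is continuous up to the boundary and zero on it; compactness makes the smallness uniform. A
    point with [phi x < 0] needs no smallness, since a neighbourhood of it leaves the layer when [e]
    is small. *)
Let small_normal_component (kappa : R) : 0 < kappa ->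
  \forall e \near (0 : R)^'+, forall x, Om x -> ball x0 (rho / 2) x ->
     - (2 * e) < phi x -> `|A x| <= kappa.
Proof.
move=> kappa0; have rho2 : rho / 2 < rho by move: rho0; lra.
pose K := closure (Om `&` ball x0 (rho / 2)).
have cK : compact K.
  apply: (subclosed_compact _ (compact_closure_bounded bO)).
    exact: closed_closure.
  by apply: closure_subset => x [].
have Kb : K `<=` ball x0 rho.
  move=> x Kx; apply: (closure_ball_sub rho2).
  by apply: closure_subset Kx => y [].
have KO : K `<=` closure Om by apply: closure_subset => y [].
move/compact_near_coveringP : cK => /(_ R (0 : R)^'+
  (fun e x => Om x -> ball x0 (rho / 2) x -> - (2 * e) < phi x -> `|A x| <= kappa)).
move=> H; have {H} := H _ _; case.
- move=> x Kx; have xb := Kb x Kx.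
  have [phix|phix] := ltP (phi x) 0.
    exists ([set y | phi y < phi x / 2], [set e : R | e < - (phi x / 4)]) => /=.
      split.
        have h : phi x < phi x / 2 by lra.
        exact: (@cphi x xb _ (lt_nbhsl h)).
      by apply: nbhs_right_lt; lra.
    by move=> [y e] /= [ye ee] _ _; lra.
  have bx : bdry Om x.
    split; first exact: KO.
    by move=> /interior_subset /(Ophi xb); rewrite ltNge phix.
  have cA : A y @[y --> within (closure Om) (nbhs x)] --> A x.
    rewrite /A; apply: cvg_big => [|k _]; first exact: add_continuous.
    apply: cvgM.
      by have /subspace_continuousP/(_ x (KO x Kx)) := flux_continuous FD k.
    have ck : partial k phi y @[y --> nbhs x] --> partial k phi x := @cdphi x k xb.
    exact: (within_cvg (closure Om) ck).
  have : \forall y \near within (closure Om) (nbhs x), `|A y| <= kappa.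
    move: cA; rewrite /A normal// => /cvgr0_norm_le /(_ _ kappa0).
    exact.
  rewrite near_withinE => Ay.
  exists ([set y | closure Om y -> `|A y| <= kappa], setT) => /=.
    by split => //; exact: filterT.
  by move=> [y e] /= [Ay' _] Oy _ _; apply/Ay'/subset_closure.
- move=> e0 /= e0_gt0 He; exists e0 => //= e ee e_gt0 x Ox xb.
  by apply: (He e ee e_gt0) => //; apply: subset_closure.
Qed.

(** The cut-off integral [I e] tends to the full one by dominated convergence. It also equals the
    flux through the layer, at most [kappa * C] for every [kappa > 0] once [e] is small, because [C]
    does not depend on [e]. *)
Lemma zero_flux_boundary : \int[mu]_(x in Om) (\sum_k D k x) = 0.
Proof.
have rho2 : rho / 2 < rho by move: rho0; lra.
have bD : bounded_measurable W (fun x => \sum_k D k x).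
  by apply: bounded_measurable_sum => k _; exact: bmD.
rewrite (@flux_restrict _ _ Om D (ball x0 rho)); last 2 first.
- by apply: open_measurable_rV; exact: ball_open.
- move=> x Ox xb k; have := near_notin_ball rho2 xb => xn.
  have [] // := @flux_near0 _ _ Om F D oO FD x Ox _ k.
  by apply: filterS xn => y yb Oy; exact: F0.
have [chi [C [bchi chi_ge0 chi1 layer]]] := layer_bound.
pose I (e : R) := \int[mu]_(x in W) ((\sum_k D k x) * cutoff e (phi x)).
have I_small kappa : 0 < kappa -> \forall e \near (0 : R)^'+, `|I e| <= kappa * C.
  move=> kappa0; near=> e.
  have e0 : 0 < e by near: e; exact: nbhs_right_gt.
  have bd := bmdcut e0.
  rewrite /I flux_cutoff//.
  apply: le_trans (le_normr_Rintegral _ (int (bounded_measurableM bmA bd))) _ => //.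
  apply: (@le_trans _ _ (kappa * \int[mu]_(x in W) (chi x * dcutoff e (phi x)))).
    rewrite -RintegralZl//; last exact/int/bounded_measurableM.
    apply: le_Rintegral => //.
    - exact/int/bounded_measurable_norm/bounded_measurableM.
    - apply/int/bounded_measurableM; first exact: bounded_measurable_cst.
      exact: bounded_measurableM.
    (* Outside the half ball the field, hence [A], is zero. Inside it [chi] is 1, and [x] is either
       close enough to the boundary for [|A x| <= kappa] or so deep that [dcutoff] vanishes. *)
    move=> x [Ox xb]; rewrite normrM (ger0_norm (dcutoff_ge0 _ e0)) mulrA.
    have [xr|xr] := pselect (ball x0 (rho / 2) x); last first.
      rewrite /A big1 => [|k _]; last by rewrite F0// mul0r.
      rewrite normr0 mul0r; apply: mulr_ge0; last exact: dcutoff_ge0.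
      by apply: mulr_ge0; [exact: ltW|exact: chi_ge0].
    rewrite chi1// mulr1; have [phix|phix] := ltP (- (2 * e)) (phi x).
      rewrite ler_wpM2r ?dcutoff_ge0//; move: x Ox xr phix {xb}.
      near: e; exact: small_normal_component.
    by have [_ ->] := cutoff_eq1 e0 phix; rewrite !mulr0.
  by rewrite ler_wpM2l ?(ltW kappa0)// layer.
have I_cvg : I (m.+1%:R^-1) @[m --> \oo] --> \int[mu]_(x in W) (\sum_k D k x).
  have [] := @dominated_convergence _ _ R mu W mW
    (fun m x => ((\sum_k D k x) * cutoff (m.+1%:R^-1) (phi x))%:E)
    (fun x => (\sum_k D k x)%:E) (fun x => `|\sum_k D k x|%:E).
  - by move=> m; apply/measurable_EFinP; have [] := bounded_measurableM bD (bmcut m.+1%:R^-1).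
  - by apply/measurable_EFinP; have [] := bD.
  - apply: aeW => x [Ox xb]; apply: cvg_EFin; first by near=> m.
    rewrite -[X in _ --> X]mulr1; apply: cvgM; first exact: cvg_cst.
    apply: cvg_near_cst; near=> m.
    have phix : phi x < 0 by apply/Ophi.
    suff [->] : cutoff (m.+1%:R^-1 : R) (phi x) = 1 /\ dcutoff (m.+1%:R^-1 : R) (phi x) = 0 by [].
    apply: cutoff_eq1 => //.
    have : (m.+1%:R^-1 : R) < - phi x / 2.
      near: m; have h : 0 < - phi x / 2 by rewrite divr_gt0// oppr_gt0; apply/Ophi.
      exact: (near_infty_natSinv_lt (PosNum h)).
    by rewrite ltr_pdivlMr// mulrC => /ltW; rewrite lerNr.
  - exact/int/bounded_measurable_norm.
  - apply: aeW => x m _; rewrite /= lee_fin normrM ler_piMr//.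
    by have /andP[c0 c1] := cutoff_itv (m.+1%:R^-1 : R) (phi x); rewrite ger0_norm.
  move=> _ _; rewrite -[X in _ --> X](fineK (integrable_fin_num mW (int bD))).
  exact: fine_cvg.
apply/eqP; rewrite -normr_le0; apply/ler_addgt0Pl => eta eta0.
rewrite addr0.
have C0 : 0 < `|C| + 1 by rewrite ltr_wpDl.
have cI : `|I (m.+1%:R^-1)| @[m --> \oo] --> `|\int[mu]_(x in W) (\sum_k D k x)|.
  exact: cvg_norm.
have kappa0 : 0 < eta / (`|C| + 1) by rewrite divr_gt0.
have : \forall m \near \oo, `|I (m.+1%:R^-1)| <= eta.
  have : \forall m \near \oo, `|I (m.+1%:R^-1)| <= eta / (`|C| + 1) * C.
    have [e0 /= e0_gt0 h] := I_small _ kappa0.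
    have := near_infty_natSinv_lt (PosNum e0_gt0); apply: filterS => m me.
    by apply: h; rewrite /ball_ /= ?sub0r ?normrN ?ger0_norm.
  apply: filterS => m /le_trans; apply.
  rewrite -mulrA ger_pMr// mulrC ler_pdivrMr// mul1r.
  by rewrite (le_trans (ler_norm _))// lerDl.
exact: cvgr_to_le cI.
Unshelve. all: by end_near. Qed.

End zero_flux_boundary.

Section green.
Variables (R : realType) (n : nat).
Local Notation E := 'rV[R]_n.
Local Notation mu := (lebesgue_rV R n).
Implicit Types (F D : 'I_n -> E -> R).

Lemma continuous_near_ball (f : E -> R) (x : E) (P : R -> Prop) :
  {for x, continuous f} -> (\forall t \near f x, P t) -> \forall y \near x, P (f y).
Proof. by move=> cf Pf; exact: cf. Qed.

Definition zero_flux_near (Om : set E) (x0 : E) (rho : R) : Prop :=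
  forall F D, zero_flux_field Om F D ->
    (forall x, Om x -> ~ ball x0 (rho / 2) x -> forall k, F k x = 0) ->
    \int[mu]_(x in Om) (\sum_k D k x) = 0.

Lemma smooth_boundary_zero_flux_near (Om : set E) (x0 : E) :
  open Om -> bounded_set Om -> smooth_boundary Om -> closure Om x0 ->
  exists2 rho, 0 < rho & zero_flux_near Om x0 rho.
Proof.
move=> oO bO sO cx0.
have [Ox0|nOx0] := pselect (Om x0).
  have /nbhs_ballP[rho /= rho0 xO] : nbhs x0 Om by exact: open_nbhs_nbhs.
  by exists rho => // F D FD F0; apply: (zero_flux_interior oO bO FD rho0 xO F0).
have bx0 : bdry Om x0 by split => // /interior_subset.
have [U [phi [Ux0 loc]]] := sO _ bx0.
have [oU smooth sgn_phi grad_phi] := loc.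
have [cphi C1phi] := smooth 1%N.
have cdphi k : forall x, U x -> {for x, continuous (partial k phi)} := (C1phi k).2.
(* [x0] is not in the open set [Om], so [phi x0 >= 0]; a positive value would persist nearby and
   keep [x0] out of the closure. *)
have phi0 : phi x0 = 0.
  apply/eqP; rewrite eq_le; apply/andP; split; last first.
    by rewrite leNgt; apply/negP => /(sgn_phi _ Ux0).
  rewrite leNgt; apply/negP => phi_gt0.
  have n1 : \forall y \near x0, 0 < phi y.
    exact: (continuous_near_ball (cphi _ Ux0) (lt_nbhsr phi_gt0)).
  have n2 : nbhs x0 U by exact: open_nbhs_nbhs.
  have [y [Oy [/= y1 y2]]] := cx0 _ (filterI n1 n2).
  by move/(sgn_phi _ y2) : Oy; rewrite ltNge ltW.
have [k0 k0n] := grad_phi _ Ux0 phi0.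
(* On a small ball the partial derivative [k0] keeps its sign [s] and at least half of its absolute
   value at [x0]. *)
pose s : R := Num.sg (partial k0 phi x0).
pose delta : R := `|partial k0 phi x0| / 2.
pose M : R := \sum_k `|partial k phi x0| + 1.
have delta0 : 0 < delta by rewrite divr_gt0 ?normr_gt0.
have near_delta : \forall y \near x0, delta <= s * partial k0 phi y.
  apply: (continuous_near_ball (P := fun t => delta <= s * t) (cdphi k0 _ Ux0)).
  have c : s * t @[t --> partial k0 phi x0] --> s * partial k0 phi x0.
    by apply: cvgM => //; exact: cvg_cst.
  have h : delta < s * partial k0 phi x0.
    by rewrite /s /delta -normrEsg ltr_pdivrMr// mulr_natr mulr2n ltrDl normr_gt0.
  exact: (cvgr_ge _ c _ h).
have near_M : \forall y \near x0, forall k, `|partial k phi y| <= M.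
  apply: (@filter_forall _ 'I_n (fun k y => `|partial k phi y| <= M) (nbhs x0) _) => k.
  apply: (continuous_near_ball (P := fun t => `|t| <= M) (cdphi k _ Ux0)).
  have h : `|partial k phi x0| < M.
    rewrite /M (bigD1 k)//= ltr_pwDr// lerDl.
    exact: sumr_ge0.
  have c := @norm_continuous _ _ (partial k phi x0).
  exact: (cvgr_le _ c _ h).
have near_U : \forall y \near x0, U y by exact: open_nbhs_nbhs.
have : nbhs x0 (fun y => U y /\ delta <= s * partial k0 phi y /\
    forall k, `|partial k phi y| <= M).
  by apply: filterI => //; exact: filterI.
move=> /nbhs_ballP[rho /= rho0 H].
have bU x : ball x0 rho x -> U x by move=> /H[].
exists rho => // F D FD F0.
apply: (@zero_flux_boundary _ _ _ F D oO bO FD x0 rho phi rho0 _ _ _ _ M delta s k0) => //.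
- by move=> x /bU; exact: sgn_phi.
- by move=> x /bU; exact: cphi.
- by move=> x k /bU; exact: (C1phi k).1.
- by move=> x k /bU; exact: cdphi.
- by move=> x k /H[_ [_]].
- by rewrite normr_sg k0n.
- by move=> x /H[_ []].
(* The zero-flux condition is stated with the unit normal; the normalizing factor is nonzero because
   the partial derivative [k0] is, and can be cancelled. *)
- move=> x xb bx; set q := \sum_l partial l phi x ^+ 2.
  have q0 : 0 < q.
    have d0 : partial k0 phi x != 0.
      apply/eqP => d0; have [_ [+ _]] := H _ xb.
      by rewrite d0 mulr0 leNgt delta0.
    rewrite /q (bigD1 k0)//= ltr_pwDl ?exprn_even_gt0//.
    by apply: sumr_ge0 => l _; exact: sqr_ge0.
  have nu_out : outward_unit_normal Om x (\row_k (partial k phi x / Num.sqrt q)).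
    by exists U, phi; split => //; exact: bU.
  have := flux_normal FD bx nu_out.
  under eq_bigr do rewrite mxE mulrA.
  rewrite -mulr_suml => /eqP; rewrite mulf_eq0 invr_eq0 sqrtr_eq0 leNgt q0 orbF.
  by move=> /eqP.
Qed.

Lemma zero_flux_fieldM (Om : set E) F D (chi : E -> R) (dchi : 'I_n -> E -> R) :
  (forall k x, is_derive x (basis_vec R k) chi (dchi k x)) ->
  continuous chi -> (forall k, continuous (dchi k)) ->
  zero_flux_field Om F D ->
  zero_flux_field Om (fun k x => chi x * F k x)
    (fun k x => dchi k x * F k x + chi x * D k x).
Proof.
move=> dchiP cchi cdchi FD.
have wc (f : E -> R) : continuous f -> {within closure Om, continuous f}.
  by move=> cf; exact: continuous_subspaceT.
split.
- by move=> k x; apply: cvgM; [exact: wc|exact: (flux_continuous FD k)].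
- by move=> k x Ox; exact: (is_deriveMfun (dchiP k x) (flux_derive FD k Ox)).
- move=> k x; apply: cvgD; apply: cvgM; [exact: wc|exact: (flux_continuous FD k)
    |exact: wc|exact: (flux_dcontinuous FD k)].
- move=> x nu bx /(flux_normal FD bx) Fnu.
  by under eq_bigr do rewrite -mulrA; rewrite -mulr_sumr Fnu mulr0.
Qed.

Lemma flux_bounded_measurable (Om : set E) F D : open Om -> bounded_set Om ->
  zero_flux_field Om F D -> bounded_measurable Om (fun x => \sum_k D k x).
Proof.
move=> oO bO FD; apply: bounded_measurable_sum => k _.
exact/within_closure_bounded_measurable/(flux_dcontinuous FD).
Qed.

(* Smooth partition of unity [chi + (1 - chi)], one ball of the cover at a time. *)
Lemma zero_flux_cover (Om : set E) (s : seq (E * R)) F D :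
  open Om -> bounded_set Om ->
  (forall p, p \in s -> 0 < p.2 /\ zero_flux_near Om p.1 p.2) ->
  zero_flux_field Om F D ->
  (forall x, Om x -> (forall p, p \in s -> ~ ball p.1 (p.2 / 4) x) ->
     forall k, F k x = 0) ->
  \int[mu]_(x in Om) (\sum_k D k x) = 0.
Proof.
move=> oO bO; elim: s => [|[x0 rho] s IH] in F D *.
  move=> _ FD F0; rewrite [LHS](_ : _ = \int[mu]_(x in Om) 0).
    by rewrite Rintegral_cst ?mul0r//; exact: open_measurable_rV.
  apply: eq_Rintegral => x /set_mem Ox; rewrite big1// => k _.
  have [] // := @flux_near0 _ _ Om F D oO FD x Ox _ k.
  by apply: filterE => y Oy; exact: F0.
move=> sP FD F0.
have [/= rho0 loc] := sP _ (mem_head _ _).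
have rho4 : 0 < rho / 4 by rewrite divr_gt0.
(* [chi] is 1 on the ball of radius [rho / 4] and 0 outside radius [3 / 8 * rho < rho / 2]: [chi]
   times the field is in the scope of [zero_flux_near], and [1 - chi] times the field vanishes on
   the ball removed from the cover. *)
have [chi [dchi [chid [cchi cdchi] chi1 chi0 chi_ge0]]] := bump_function x0 rho4.
have FD1 := zero_flux_fieldM chid cchi cdchi FD.
have chid' k x : is_derive x (basis_vec R k) (fun y => 1 - chi y) (- dchi k x).
  exact: is_derive_subl.
have cchi' : continuous (fun y => 1 - chi y).
  have c1 : continuous (fun t : R => 1 - t).
    by move=> t; apply: cvgB; [exact: cvg_cst|exact: cvg_id].
  exact: (comp_continuous cchi c1).
have cdchi' k : continuous (fun y => - dchi k y).
  have c1 : continuous (fun t : R => - t) by move=> t; apply: cvgN; exact: cvg_id.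
  exact: (comp_continuous (@cdchi k) c1).
have FD2 := zero_flux_fieldM chid' cchi' cdchi' FD.
have I1 : \int[mu]_(x in Om) (\sum_k (dchi k x * F k x + chi x * D k x)) = 0.
  apply: (loc _ _ FD1) => x Ox xb k; rewrite chi0 ?mul0r// => xb'.
  apply: xb; apply: le_ball xb'; lra.
have I2 : \int[mu]_(x in Om) (\sum_k (- dchi k x * F k x + (1 - chi x) * D k x)) = 0.
  apply: (IH _ _ _ FD2).
    by move=> p ps; apply: sP; rewrite inE ps orbT.
  move=> x Ox xs k; have [xb|xb] := pselect (ball x0 (rho / 4) x).
    by rewrite chi1// subrr mul0r.
  rewrite F0 ?mulr0// => p; rewrite inE => /predU1P[->//|]; exact: xs.
have mO : measurable Om by exact: open_measurable_rV.
have Ofin := open_bounded_lty oO bO.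
transitivity (\int[mu]_(x in Om) ((\sum_k (dchi k x * F k x + chi x * D k x))
   + (\sum_k (- dchi k x * F k x + (1 - chi x) * D k x)))).
  apply: eq_Rintegral => x _; rewrite -big_split/=; apply: eq_bigr => k _; ring.
rewrite RintegralD ?I1 ?I2 ?addr0//; apply: bounded_measurable_integrable => //.
  exact: flux_bounded_measurable FD1.
exact: flux_bounded_measurable FD2.
Qed.

Lemma zero_flux_integral (Om : set E) F D :
  open Om -> bounded_set Om -> smooth_boundary Om -> zero_flux_field Om F D ->
  \int[mu]_(x in Om) (\sum_k D k x) = 0.
Proof.
move=> oO bO sO FD.
have := compact_closure_bounded bO; rewrite compact_cover.
move=> /(_ (E * R)%type [set p | 0 < p.2 /\ zero_flux_near Om p.1 p.2]
  (fun p => ball p.1 (p.2 / 4))) [].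
- by move=> p _; exact: ball_open.
- move=> x /(smooth_boundary_zero_flux_near oO bO sO)[rho rho0 loc].
  by exists (x, rho) => //=; apply: ballxx; rewrite divr_gt0.
move=> s sP cov; apply: (@zero_flux_cover Om (finmap.enum_fset s) F D) => //.
  by move=> p /sP /set_mem.
move=> x Ox xs; have [p /= ps] := cov x (subset_closure Ox).
by move=> /(xs p ps).
Qed.

End green.

(** * Uniform continuity and Riemann sums in time *)

Section cylinder.
Variables (R : realType) (N : nat) (Om : set 'rV[R]_N).
Local Notation E := 'rV[R]_N.
Hypothesis bO : bounded_set Om.

Lemma cylinder_slice (I : set R) (f : R -> E -> R) t :
  continuous_on_cylinder Om I f -> I t -> {within closure Om, continuous (f t)}.
Proof.
move=> /subspace_continuousP cf It; apply/subspace_continuousP => x cx.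
have c : f p.1 p.2 @[p --> within (I `*` closure Om) (nbhs (t, x))] --> f t x.
  exact: (cf (t, x)).
move=> P /c; rewrite /nbhs/= /within/= => -[[A B] /= [At Bx] AB].
apply: filterS Bx => y By cy; apply: (AB (t, y)) => //=.
by split => //; exact: nbhs_singleton.
Qed.

Lemma cylinder_near (I : set R) (f : R -> E -> R) (t : R) x (e : R) : 0 < e ->
  continuous_on_cylinder Om I f -> I t -> closure Om x ->
  exists2 r : R, 0 < r & forall s y, I s -> closure Om y -> `|s - t| < r ->
    ball x r y -> `|f s y - f t x| <= e.
Proof.
move=> e0 /subspace_continuousP cf It cx.
have c : f p.1 p.2 @[p --> within (I `*` closure Om) (nbhs (t, x))] --> f t x.
  exact: (cf (t, x)).
have := c _ (nbhsx_ballx (f t x) e e0).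
rewrite /nbhs/= /within/= => -[[A B] /= [At Bx] AB].
have /nbhs_ballP[r1 /= r10 tA] := At; have /nbhs_ballP[r2 /= r20 xB] := Bx.
exists (Num.min r1 r2); first by rewrite lt_min r10 r20.
move=> s y Is cy; rewrite lt_min => /andP[sr1 _] yr.
rewrite distrC; apply: ltW; apply: (AB (s, y)) => //=; split; last first.
  by apply: xB; apply: le_ball yr; rewrite ge_min lexx orbT.
by apply: tA; rewrite /ball/= distrC.
Qed.

(** Compactness is applied to one variable at a time: first to [closure Om] at a fixed time, then to
    the time interval. Each passage costs one triangle inequality, whence the two halvings of
    [e]. *)
Lemma cylinder_time_unif (I : set R) (f : R -> E -> R) (a b e : R) : 0 < e ->
  [set` `[a, b]] `<=` I -> continuous_on_cylinder Om I f ->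
  \forall r \near (0 : R)^'+, forall t, t \in `[a, b] -> forall s x, s \in `[a, b] ->
    `|s - t| < r -> closure Om x -> `|f s x - f t x| <= e.
Proof.
move=> e0 abI cf; have e2 : 0 < e / 2 by rewrite divr_gt0.
have e4 : 0 < e / 2 / 2 by rewrite divr_gt0.
have step1 t : t \in `[a, b] -> exists2 r : R, 0 < r & forall x, closure Om x ->
    forall s, s \in `[a, b] -> `|s - t| < r -> `|f s x - f t x| <= e / 2.
  move=> tab.
  pose P (r : R) (x : E) := closure Om x -> forall s, s \in `[a, b] -> `|s - t| < r ->
    `|f s x - f t x| <= e / 2.
  have /compact_near_coveringP/(_ R (0 : R)^'+ P _) H := compact_closure_bounded bO.
  have {}H : \forall r \near (0 : R)^'+, closure Om `<=` P r.
    apply: H => x cx.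
    have [r r0 fr] := cylinder_near e4 cf (abI _ tab) cx.
    exists (ball x r, [set r' : R | r' < r]) => /=.
      by split; [exact: nbhsx_ballx|exact: nbhs_right_lt].
    move=> [y r'] /= [yr r'r] cy s sab st.
    have h1 := fr s y (abI _ sab) cy (lt_trans st r'r) yr.
    have h2 := fr t y (abI _ tab) cy _ yr.
    rewrite subrr normr0 in h2; have {}h2 := h2 r0.
    rewrite (_ : f s y - f t y = (f s y - f t x) - (f t y - f t x)); last by ring.
    by rewrite (le_trans (ler_normB _ _))// [e / 2]splitr lerD.
  have [r0 /= r0_gt0 Hr] := H.
  exists (r0 / 2); first by rewrite divr_gt0.
  move=> x cx; apply: (Hr (r0 / 2)) => //=; last by rewrite divr_gt0.
  by rewrite /ball_/= sub0r normrN gtr0_norm ?divr_gt0// ltr_pdivrMr// mulr_natr mulr2n ltrDl.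
have /compact_near_coveringP/(_ R (0 : R)^'+ (fun r t => t \in `[a, b] ->
    forall s x, s \in `[a, b] -> `|s - t| < r -> closure Om x ->
    `|f s x - f t x| <= e) _) H := @segment_compact R a b.
have {}H := H _; have {}H : \forall r \near (0 : R)^'+, [set` `[a, b]] `<=`
  (fun t => t \in `[a, b] -> forall s x, s \in `[a, b] -> `|s - t| < r ->
    closure Om x -> `|f s x - f t x| <= e).
  apply: H => t /= tab; have [r r0 fr] := step1 t tab.
  have r2 : 0 < r / 2 by rewrite divr_gt0.
  exists (ball t (r / 2), [set r' : R | r' < r / 2]) => /=.
    by split; [exact: nbhsx_ballx|exact: nbhs_right_lt].
  move=> [t' r'] /= [tt' r'r] t'ab s x sab st' cx.
  have tt2 : `|t' - t| < r / 2 by rewrite distrC.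
  have h1 : `|f s x - f t x| <= e / 2.
    apply: fr => //; rewrite (_ : s - t = (s - t') + (t' - t)); last by ring.
    rewrite (le_lt_trans (ler_normD _ _))// [r]splitr ltrD//.
    exact: lt_trans st' r'r.
  have h2 : `|f t' x - f t x| <= e / 2.
    by apply: fr => //; apply: lt_trans tt2 _; rewrite ltr_pdivrMr// mulr_natr mulr2n ltrDl.
  rewrite (_ : f s x - f t' x = (f s x - f t x) - (f t' x - f t x)); last by ring.
  by rewrite (le_trans (ler_normB _ _))// [e]splitr lerD.
by apply: filterS H => r Hr t tab; apply: (Hr t).
Qed.

Section riemann.
Variables (tau T : R) (tauT : tau < T) (tau0 : 0 < tau).

(** There are [n.+1] steps, so the grid is never empty; the nodes run from index 0, at [tau], to
    index [n.+1], at [T]. *)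
Definition time_step (n : nat) : R := (T - tau) / n.+1%:R.
Definition time_node n k : R := tau + time_step n * k%:R.

Lemma time_step_gt0 n : 0 < time_step n.
Proof. by rewrite divr_gt0// subr_gt0. Qed.

Lemma time_node0 n : time_node n 0 = tau.
Proof. by rewrite /time_node mulr0 addr0. Qed.

Lemma time_node_last n : time_node n n.+1 = T.
Proof. by rewrite /time_node /time_step divfK// addrC subrK. Qed.

Lemma time_nodeS n k : time_node n k.+1 = time_node n k + time_step n.
Proof. by rewrite /time_node -natr1; ring. Qed.

Lemma time_node_itv n k : (k <= n.+1)%N -> time_node n k \in `[tau, T].
Proof.
move=> kn; rewrite in_itv/= -(time_node_last n) /time_node lerDl.
rewrite mulr_ge0 ?(ltW (time_step_gt0 n))//= lerD2l.
by rewrite ler_pM2l ?time_step_gt0// ler_nat.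
Qed.

Lemma time_node_gt0 n k : 0 < time_node n k.
Proof. by rewrite ltr_wpDr// mulr_ge0 ?(ltW (time_step_gt0 n)). Qed.

(** Mean value theorem on each step, then uniform continuity of [ut]. Right endpoints matter:
    testing at node [k] then produces a sum over [l <= k], diagonal included, and not over
    [l < k]. *)
Lemma time_riemann (u ut : R -> E -> R) (e : R) : 0 < e ->
  continuous_on_cylinder Om `]0, +oo[ ut ->
  (forall (t : R) x, 0 < t -> Om x -> is_derive t 1 (fun s => u s x) (ut t x)) ->
  \forall n \near \oo, forall k x, (k <= n.+1)%N -> Om x ->
    `|u (time_node n k) x - u tau x
      - time_step n * \sum_(1 <= l < k.+1) ut (time_node n l) x| <= e.
Proof.
move=> e0 cut du.
have eT : 0 < e / (T - tau) by rewrite divr_gt0// subr_gt0.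
have sub : [set` `[tau, T]] `<=` [set` `]0%R, +oo[].
  by move=> t /=; rewrite !in_itv/= => /andP[t1 _]; rewrite andbT (lt_le_trans tau0).
have [r0 /= r0_gt0 Hr] := cylinder_time_unif eT sub cut.
have r2 : 0 < r0 / 2 by rewrite divr_gt0.
have d0 : 0 < r0 / 2 / (T - tau) by rewrite divr_gt0// subr_gt0.
have := near_infty_natSinv_lt (PosNum d0); apply: filterS => n /= nr.
have hr : time_step n < r0 / 2.
  by rewrite /time_step mulrC -ltr_pdivlMr// subr_gt0.
have one k x : (k <= n)%N -> Om x ->
    `|u (time_node n k.+1) x - u (time_node n k) x
      - time_step n * ut (time_node n k.+1) x| <= e / (T - tau) * time_step n.
  move=> kn Ox.
  have lt_t : time_node n k < time_node n k.+1 by rewrite time_nodeS ltrDl time_step_gt0.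
  have t0 : 0 < time_node n k := time_node_gt0 n k.
  have [||c cI ->] := @MVT R (fun s => u s x) (fun s => ut s x) _ _ lt_t.
  - by move=> s; rewrite in_itv/= => /andP[s1 _]; apply: du => //; exact: lt_trans s1.
  - apply: derivable_within_continuous => s; rewrite in_itv/= => /andP[s1 _].
    by have := du s x (lt_le_trans t0 s1) Ox => -[].
  have hE : time_node n k.+1 - time_node n k = time_step n.
    by rewrite time_nodeS addrC addKr.
  rewrite hE mulrC -mulrBr normrM (gtr0_norm (time_step_gt0 n)) mulrC.
  rewrite ler_pM2r ?time_step_gt0//.
  move: cI; rewrite in_itv/= => /andP[c1 c2].
  have := time_node_itv (n := n) (k := k.+1) kn.
  have := time_node_itv (n := n) (k := k) (leqW kn).
  rewrite !in_itv/= => /andP[k1 k2] /andP[k3 k4].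
  apply: (Hr (r0 / 2)) => //=.
  - by rewrite /ball_/= sub0r normrN gtr0_norm// ltr_pdivrMr// mulr_natr mulr2n ltrDl.
  - by rewrite in_itv/= k3 k4.
  - by rewrite in_itv/= (le_trans k1 (ltW c1)) (le_trans (ltW c2) k4).
  - rewrite distrC gtr0_norm ?subr_gt0//; apply: le_lt_trans hr.
    by rewrite -hE lerD2l lerN2 ltW.
  - exact: subset_closure.
suff H k x : (k <= n.+1)%N -> Om x ->
    `|u (time_node n k) x - u tau x
      - time_step n * \sum_(1 <= l < k.+1) ut (time_node n l) x|
       <= e / (T - tau) * time_step n * k%:R.
  move=> k x kn Ox; apply: le_trans (H k x kn Ox) _.
  rewrite /time_step mulrA divfK ?gt_eqF ?subr_gt0// -mulrA ger_pMr//.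
  by rewrite mulrC ler_pdivrMr// mul1r ler_nat.
elim: k => [_ _|k IH kn Ox].
  by rewrite big_geq// mulr0 subr0 time_node0 subrr normr0 mulr0.
rewrite big_nat_recr//= -natr1 [leRHS]mulrDr mulr1 addrC.
rewrite (_ : _ - _ = (u (time_node n k.+1) x - u (time_node n k) x
      - time_step n * ut (time_node n k.+1) x) + (u (time_node n k) x - u tau x
      - time_step n * \sum_(1 <= l < k.+1) ut (time_node n l) x)); last by ring.
rewrite [leRHS]addrC; apply: le_trans (ler_normD _ _) _; apply: lerD.
  exact: one.
by apply: IH => //; exact: ltnW.
Qed.

End riemann.
End cylinder.

(** The triangular sum is half of the square of the sum plus half of the sum of the squares. *)
Lemma sum_triangle_ge0 (R : realDomainType) (q : nat -> R) n :
  0 <= \sum_(1 <= k < n.+1) \sum_(1 <= l < k.+1) q l * q k.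
Proof.
suff H : (\sum_(1 <= l < n.+1) q l) ^+ 2
    <= 2 * \sum_(1 <= k < n.+1) \sum_(1 <= l < k.+1) q l * q k.
  have := le_trans (sqr_ge0 _) H; lra.
elim: n => [|n IH]; first by rewrite !big_geq// expr0n mulr0.
rewrite big_nat_recr//= [in leRHS]big_nat_recr//=.
rewrite -mulr_suml [\sum_(1 <= l < n.+2) _]big_nat_recr//=.
have := sqr_ge0 (q n.+1); move: IH.
move: (\sum_(1 <= l < n.+1) q l) (\sum_(1 <= k < n.+1) _) (q n.+1) => S Q x; nra.
Qed.

(** * Estimates on the truncated systems *)

Section energy.
Variables (R : realType) (N : nat) (Om : set 'rV[R]_N).
Local Notation E := 'rV[R]_N.
Local Notation mu := (lebesgue_rV R N).
Hypotheses (oO : open Om) (bO : bounded_set Om) (sO : smooth_boundary Om).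

Let mO : measurable Om.
Proof. exact: open_measurable_rV. Qed.

Let Ofin : (mu Om < +oo)%E.
Proof. exact: open_bounded_lty. Qed.

Let int f : bounded_measurable Om f -> mu.-integrable Om (EFin \o f).
Proof. exact: bounded_measurable_integrable. Qed.

(** The inequality on the time derivative, integrated from [tau] to [T] with the right-hand side
    left as a Riemann sum, so that no regularity of [Y] comes in. *)
Lemma integral_increment (U Ut : R -> E -> R) (Y : R -> R) (tau T e : R) :
  0 < tau -> tau < T -> 0 < e ->
  (forall t, 0 < t -> {within closure Om, continuous (U t)}) ->
  continuous_on_cylinder Om `]0, +oo[ Ut ->
  (forall (t : R) x, 0 < t -> Om x -> is_derive t 1 (fun s => U s x) (Ut t x)) ->
  (forall t, 0 < t -> \int[mu]_(x in Om) Ut t x <= Y t) ->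
  \forall n \near \oo, \int[mu]_(x in Om) U T x <= \int[mu]_(x in Om) U tau x +
     time_step tau T n * \sum_(1 <= k < n.+2) Y (time_node tau T n k) + e.
Proof.
move=> tau0 tauT e0 cU cUt dU UtY.
set m := fine (mu Om); have m0 : 0 <= m by exact: fine_ge0.
have e1 : 0 < e / (m + 1) by rewrite divr_gt0// ltr_wpDl.
have := time_riemann bO tauT tau0 e1 cUt dU; apply: filterS => n Hn.
pose t k := time_node tau T n k.
have t0 k : 0 < t k by exact: time_node_gt0.
pose h := time_step tau T n; have h0 : 0 < h by exact: time_step_gt0.
have bU s : 0 < s -> bounded_measurable Om (U s).
  by move=> s0; apply: within_closure_bounded_measurable => //; exact: cU.
have bUt k : bounded_measurable Om (Ut (t k)).
  apply: within_closure_bounded_measurable => //; apply: (cylinder_slice cUt).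
  by rewrite /= in_itv/= t0.
have T0 : 0 < T by exact: lt_trans tauT.
have bS : bounded_measurable Om (fun x => \sum_(1 <= k < n.+2) Ut (t k) x).
  by apply: bounded_measurable_sum => k _.
have bhS : bounded_measurable Om (fun x => h * \sum_(1 <= k < n.+2) Ut (t k) x).
  by apply: bounded_measurableM => //; exact: bounded_measurable_cst.
have b1 := bounded_measurableD (bU _ tau0) bhS.
have bc : bounded_measurable Om (fun=> e / (m + 1)) by exact: bounded_measurable_cst.
apply: (@le_trans _ _ (\int[mu]_(x in Om)
   (U tau x + h * (\sum_(1 <= k < n.+2) Ut (t k) x) + e / (m + 1)))).
  apply: le_Rintegral => //; [exact/int/bU|exact/int/bounded_measurableD|].
  move=> x Ox; have := Hn n.+1 x (leqnn _) Ox.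
  rewrite time_node_last// ler_norml => /andP[_].
  by rewrite -/h; lra.
rewrite RintegralD//; [|exact: int|exact: int].
rewrite RintegralD//; [|exact/int/bU|exact: int].
rewrite RintegralZl//; last exact: int.
rewrite Rintegral_sum// => [|k _]; last exact: int.
rewrite Rintegral_cst// -/m; apply: lerD; first rewrite lerD2l.
  rewrite ler_pM2l//; apply: ler_sum => k _; exact: UtY.
by rewrite mulrAC ler_pdivrMr ?ltr_wpDl// ler_pM2l// lerDl.
Qed.

Variables (rho L P : R -> E -> R) (G H : 'I_N -> R -> E -> R) (delta D : R).
Hypothesis drho : forall (t : R) x, 0 < t -> Om x -> is_derive t 1 (fun s => rho s x) (L t x).
Hypothesis cL : continuous_on_cylinder Om `]0, +oo[ L.
Hypothesis crho : forall t, 0 < t -> {within closure Om, continuous (rho t)}.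
Hypothesis cP : forall t, 0 < t -> {within closure Om, continuous (P t)}.
Hypothesis cG : forall k t, 0 < t -> {within closure Om, continuous (G k t)}.
Hypothesis cH : forall k t, 0 < t -> {within closure Om, continuous (H k t)}.
Hypothesis LE : forall t x, 0 < t -> Om x -> L t x = \sum_k H k t x.
Hypothesis dP : forall t x k, 0 < t -> Om x -> is_derive x (basis_vec R k) (P t) (G k t x).
Hypothesis dG : forall t x k, 0 < t -> Om x -> is_derive x (basis_vec R k) (G k t) (H k t x).
Hypothesis nG : forall t x nu, 0 < t -> bdry Om x -> outward_unit_normal Om x nu ->
  \sum_k G k t x * nu ord0 k = 0.
Hypothesis delta0 : 0 < delta.
Hypothesis rho_ge0 : forall t x, 0 < t -> Om x -> 0 <= rho t x.
Hypothesis rho_P : forall t x, 0 < t -> Om x -> delta * rho t x <= P t x <= D * rho t x.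

(** Green's formula between two different times: the field is [P t] times the gradient of [P s], and
    its divergence contains [P t] times the Laplacian of [P s], which is the time derivative of
    [rho] at time [s]. *)
Lemma green_flux (s t : R) : 0 < s -> 0 < t -> zero_flux_field Om
  (fun k x => P t x * G k s x) (fun k x => G k t x * G k s x + P t x * H k s x).
Proof.
move=> s0 t0; split.
- by move=> k x; apply: cvgM; [exact: cP|exact: cG].
- by move=> k x Ox; exact: (is_deriveMfun (dP k t0 Ox) (dG k s0 Ox)).
- move=> k x; apply: cvgD; apply: cvgM; [exact: cG|exact: cG|exact: cP|exact: cH].
- move=> x nu bx /(nG s0 bx) Gn.
  by under eq_bigr do rewrite -mulrA; rewrite -mulr_sumr Gn mulr0.
Qed.

Let bm (f : R -> E -> R) t : (forall t, 0 < t -> {within closure Om, continuous (f t)}) ->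
  0 < t -> bounded_measurable Om (f t).
Proof. by move=> cf t0; apply: within_closure_bounded_measurable => //; exact: cf. Qed.

(* Discrete version of testing [rho(t) - rho(tau) = Laplacian of the integral of P]
   against [P(t)]: the double sum of the gradient terms is nonnegative. *)
Lemma energy_estimate (tau T : R) : 0 < tau -> tau < T ->
  \forall n \near \oo, time_step tau T n *
    \sum_(1 <= k < n.+2) \int[mu]_(x in Om) (rho (time_node tau T n k) x ^+ 2)
  <= (T - tau) * ((D / delta) ^+ 2 * \int[mu]_(x in Om) ((rho tau x + 1) ^+ 2)).
Proof.
move=> tau0 tauT.
(* A Riemann error of 1 is affordable; it is the 1 added to [rho tau x] in the bound. *)
have := time_riemann bO tauT tau0 ltr01 cL drho; apply: filterS => n Hn.
pose t k := time_node tau T n k.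
have t0 k : 0 < t k by exact: time_node_gt0.
pose h := time_step tau T n; have h0 : 0 < h by exact: time_step_gt0.
pose q k l x := \sum_m (G m (t k) x * G m (t l) x + P (t k) x * H m (t l) x).
pose Q x := \sum_(1 <= k < n.+2) \sum_(1 <= l < k.+1) q k l x.
have bq k l : bounded_measurable Om (q k l).
  exact: (flux_bounded_measurable oO bO (green_flux (t0 l) (t0 k))).
have bQ : bounded_measurable Om Q.
  by apply: bounded_measurable_sum => k _; apply: bounded_measurable_sum => l _.
have Q0 : \int[mu]_(x in Om) Q x = 0.
  rewrite /Q Rintegral_sum// => [|k _]; last first.
    by apply/int/bounded_measurable_sum => l _.
  rewrite big1// => k _; rewrite Rintegral_sum// => [|l _]; last exact: int.
  by rewrite big1// => l _; exact: (zero_flux_integral oO bO sO (green_flux (t0 l) (t0 k))).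
have brho2 k : bounded_measurable Om (fun x => rho (t k) x ^+ 2).
  exact/bounded_measurableX/bm.
have brho1 : bounded_measurable Om (fun x => (rho tau x + 1) ^+ 2).
  apply/bounded_measurableX/bounded_measurableD; first exact: bm.
  exact: bounded_measurable_cst.
(* [Q] is the triangular sum of the gradient products, nonnegative by [sum_triangle_ge0] in each
   direction [m], plus the triangular sum of [P (t k) x * L (t l) x]. The latter is therefore at
   most [Q], and [Q] has integral zero. *)
have key x : Om x -> delta / 2 * \sum_(1 <= k < n.+2) rho (t k) x ^+ 2 <=
    n.+1%:R * (D ^+ 2 / (2 * delta)) * (rho tau x + 1) ^+ 2 + h * Q x.
  move=> Ox.
  have one k : (1 <= k < n.+2)%N -> delta / 2 * rho (t k) x ^+ 2 <=
      D ^+ 2 / (2 * delta) * (rho tau x + 1) ^+ 2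
      + h * \sum_(1 <= l < k.+1) P (t k) x * L (t l) x.
    move=> /andP[k1 kn]; have := Hn k x kn Ox.
    rewrite -mulr_sumr -/h -/(t k); set S := \sum_(1 <= l < k.+1) _.
    rewrite ler_norml => /andP[_ r1].
    have r0 := rho_ge0 (t0 k) Ox; have rt := rho_ge0 tau0 Ox.
    have /andP[p1 p2] := rho_P (t0 k) Ox.
    move: (rho (t k) x) (P (t k) x) (rho tau x) r0 rt p1 p2 r1 => r p r' r0 rt p1 p2 r1.
    have p0 : 0 <= p by apply: le_trans p1; rewrite mulr_ge0// ltW.
    have a1 : r * p <= (r' + 1) * p + h * (p * S).
      have : r * p <= (r' + 1 + h * S) * p by rewrite ler_wpM2r//; lra.
      by rewrite [h * (p * S)]mulrCA mulrDl [h * S * p]mulrC.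
    have a2 : delta * r ^+ 2 <= r * p by rewrite expr2 mulrCA ler_wpM2l.
    have a3 : (r' + 1) * p <= (r' + 1) * (D * r) by rewrite ler_wpM2l//; lra.
    (* Young's inequality, weighted so that half of [delta * r ^+ 2] is absorbed by the left-hand
       side. *)
    have a4 : (r' + 1) * (D * r) <= delta / 2 * r ^+ 2 + D ^+ 2 / (2 * delta) * (r' + 1) ^+ 2.
      rewrite -subr_ge0 (_ : _ - _ = (delta * r - D * (r' + 1)) ^+ 2 / (2 * delta)).
        by rewrite divr_ge0 ?sqr_ge0// mulr_ge0// ltW.
      by field; rewrite gt_eqF.
    lra.
  rewrite mulr_sumr.
  have gsum : 0 <= \sum_(1 <= k < n.+2) \sum_(1 <= l < k.+1)
      \sum_m G m (t k) x * G m (t l) x.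
    rewrite (_ : \sum_(1 <= k < n.+2) _ = \sum_m \sum_(1 <= k < n.+2)
        \sum_(1 <= l < k.+1) G m (t l) x * G m (t k) x).
      by apply: sumr_ge0 => m _; exact: sum_triangle_ge0.
    rewrite exchange_big/=; apply: eq_bigr => k _.
    rewrite exchange_big/=; apply: eq_bigr => l _.
    by apply: eq_bigr => m _; rewrite mulrC.
  have QE : Q x = \sum_(1 <= k < n.+2) \sum_(1 <= l < k.+1) \sum_m G m (t k) x * G m (t l) x
     + \sum_(1 <= k < n.+2) \sum_(1 <= l < k.+1) P (t k) x * L (t l) x.
    rewrite -big_split/=; apply: eq_bigr => k _; rewrite -big_split/=.
    apply: eq_bigr => l _; rewrite /q big_split/= -mulr_sumr LE//.
  apply: (@le_trans _ _ (\sum_(1 <= k < n.+2) (D ^+ 2 / (2 * delta) * (rho tau x + 1) ^+ 2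
      + h * \sum_(1 <= l < k.+1) P (t k) x * L (t l) x))).
    by rewrite big_nat [leRHS]big_nat; apply: ler_sum => k; exact: one.
  rewrite big_split/= sumr_const_nat subSS subn0 -[_ *+ _]mulr_natl mulrA -mulr_sumr.
  by apply: lerD => //; apply: ler_wpM2l; rewrite ?(ltW h0)// QE lerDr.
have IH : delta / 2 * \sum_(1 <= k < n.+2) \int[mu]_(x in Om) (rho (t k) x ^+ 2)
   <= n.+1%:R * (D ^+ 2 / (2 * delta)) * \int[mu]_(x in Om) ((rho tau x + 1) ^+ 2).
  rewrite -Rintegral_sum// => [|k _]; last exact: int.
  have bs : bounded_measurable Om (fun x => \sum_(1 <= k < n.+2) rho (t k) x ^+ 2).
    exact: bounded_measurable_sum.
  have bc (r : R) f : bounded_measurable Om f -> bounded_measurable Om (fun x => r * f x).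
    by move=> bf; apply: bounded_measurableM => //; exact: bounded_measurable_cst.
  rewrite -RintegralZl//; last exact: int.
  apply: le_trans (le_Rintegral mO (int _) (int _) key) _; first exact: bc.
    by apply: bounded_measurableD; exact: bc.
  rewrite RintegralD//; [|exact/int/bc|exact/int/bc].
  by rewrite RintegralZl ?RintegralZl ?Q0 ?mulr0 ?addr0//; exact: int.
have hn : h * n.+1%:R = T - tau by rewrite /h /time_step divfK.
rewrite -/h; move: IH.
move: (\sum_(1 <= k < n.+2) _) (\int[mu]_(x in Om) _) => S I.
rewrite -hn -ler_pdivlMl ?divr_gt0// => /(ler_wpM2l (ltW h0)) /le_trans; apply.
rewrite le_eqVlt; apply/orP; left; apply/eqP; field.
by rewrite gt_eqF.
Qed.

End energy.

(** * Moments of the truncated reaction terms *)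

Section weak_form.
Variable R : realType.

Lemma sum_diagonal (f : nat -> nat -> R) M :
  \sum_(1 <= i < M.+1) \sum_(1 <= j < (M - i).+1) f i j =
  \sum_(1 <= k < M.+1) \sum_(1 <= i < k) f i (k - i)%N.
Proof.
elim: M => [|M IH]; first by rewrite !big_geq.
rewrite [RHS]big_nat_recr//= -IH [LHS]big_nat_recr//= subnn.
rewrite [X in _ + X = _]big_geq// addr0 -big_split/=.
rewrite big_nat [RHS]big_nat; apply: eq_bigr => i /andP[i1 iM].
by rewrite subSn// big_nat_recr.
Qed.

Lemma sum_triangle_sym (f : nat -> nat -> R) M :
  \sum_(1 <= i < M.+1) \sum_(1 <= j < (M - i).+1) f i j =
  \sum_(1 <= i < M.+1) \sum_(1 <= j < (M - i).+1) f j i.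
Proof.
have E (g : nat -> nat -> R) :
    \sum_(1 <= i < M.+1) \sum_(1 <= j < (M - i).+1) g i j =
    \sum_(1 <= i < M.+1) \sum_(1 <= j < M.+1 | (i + j <= M)%N) g i j.
  rewrite big_nat [RHS]big_nat; apply: eq_bigr => i /andP[i1 iM].
  rewrite (@big_nat_widen _ _ _ _ _ M.+1) ?ltnS ?leq_subr//=.
  by apply: eq_bigl => j; rewrite ltnS leq_subRL.
rewrite !E (exchange_big_dep xpredT)//=; apply: eq_bigr => i _.
by apply: eq_bigl => j; rewrite addnC.
Qed.

Variables (a beta : nat -> nat -> R) (B : nat -> R).
Hypothesis aP : forall i j, (1 <= i)%N -> (1 <= j)%N ->
  [/\ a i j = a j i, 0 <= a i j & 0 <= beta i j].
Hypothesis B1 : B 1%N = 0.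

(** The truncation keeps the pairs with [i + j <= M] in the loss as well as in the gain, so both run
    over the same triangle; the symmetry of [a] splits the loss evenly between [phi i] and [phi j].
    Fragmentation starts at size 2 since [B 1 = 0]. With [phi i = i] both brackets vanish. *)
Lemma truncated_weak_form (M : nat) (y phi : nat -> R) :
  \sum_(1 <= i < M.+1) phi i * truncated_rhs a beta B M y i =
  2^-1 * (\sum_(1 <= i < M.+1) \sum_(1 <= j < (M - i).+1)
     a i j * y i * y j * (phi (i + j)%N - phi i - phi j))
  + \sum_(2 <= i < M.+1) B i * y i * (\sum_(1 <= j < i) beta i j * phi j - phi i).
Proof.
have gain : \sum_(1 <= i < M.+1) phi i * (2^-1 *
      \sum_(1 <= j < i) a (i - j)%N j * y (i - j)%N * y j) =
    2^-1 * \sum_(1 <= i < M.+1) \sum_(1 <= j < (M - i).+1) a i j * y i * y j * phi (i + j)%N.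
  rewrite sum_triangle_sym sum_diagonal mulr_sumr; apply: eq_bigr => i _.
  rewrite mulrCA; congr (_ * _); rewrite mulr_sumr big_nat [RHS]big_nat.
  by apply: eq_bigr => j /andP[j1 ji]; rewrite subnK 1?ltnW// mulrC.
have loss : \sum_(1 <= i < M.+1) phi i * \sum_(1 <= j < (M - i).+1) a i j * y i * y j =
   2^-1 * \sum_(1 <= i < M.+1) \sum_(1 <= j < (M - i).+1) a i j * y i * y j * (phi i + phi j).
  rewrite (_ : \sum_(1 <= i < M.+1) \sum_(1 <= j < (M - i).+1) _ =
    \sum_(1 <= i < M.+1) \sum_(1 <= j < (M - i).+1) a i j * y i * y j * phi i +
    \sum_(1 <= i < M.+1) \sum_(1 <= j < (M - i).+1) a i j * y i * y j * phi j); last first.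
    rewrite -big_split/=; apply: eq_bigr => i _; rewrite -big_split/=.
    by apply: eq_bigr => j _; rewrite mulrDr.
  rewrite [X in _ = _ * (_ + X)](sum_triangle_sym (fun i j => a i j * y i * y j * phi j)).
  rewrite [X in _ = _ * (_ + X)](_ : _ =
    \sum_(1 <= i < M.+1) \sum_(1 <= j < (M - i).+1) a i j * y i * y j * phi i); last first.
    rewrite big_nat [RHS]big_nat; apply: eq_bigr => i /andP[i1 _].
    rewrite big_nat [RHS]big_nat; apply: eq_bigr => j /andP[j1 _].
    by have [-> _ _] := aP i1 j1; ring.
  rewrite [RHS](_ : forall s : R, 2^-1 * (s + s) = s); last by move=> s; field.
  by apply: eq_bigr => i _; rewrite mulr_sumr; apply: eq_bigr => j _; rewrite mulrC.
have frag_gain : \sum_(1 <= i < M.+1) phi i *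
     \sum_(1 <= j < (M - i).+1) B (i + j)%N * beta (i + j)%N i * y (i + j)%N =
   \sum_(2 <= i < M.+1) B i * y i * \sum_(1 <= j < i) beta i j * phi j.
  transitivity (\sum_(1 <= i < M.+1) \sum_(1 <= j < (M - i).+1)
     phi i * (B (i + j)%N * beta (i + j)%N i * y (i + j)%N)).
    by apply: eq_bigr => i _; rewrite mulr_sumr.
  rewrite sum_diagonal; case: M {gain loss} => [|M]; first by rewrite !big_geq.
  rewrite big_ltn// [X in X + _]big_geq// add0r big_nat [RHS]big_nat.
  apply: eq_bigr => i _.
  rewrite mulr_sumr big_nat [RHS]big_nat; apply: eq_bigr => j /andP[j1 ji].
  by rewrite subnKC 1?ltnW//; ring.
have frag_loss : \sum_(1 <= i < M.+1) phi i * (B i * y i) =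
   \sum_(2 <= i < M.+1) B i * y i * phi i.
  case: M {gain loss frag_gain} => [|M]; first by rewrite !big_geq.
  rewrite big_ltn// B1 mul0r mulr0 add0r; apply: eq_bigr => i _; exact: mulrC.
rewrite (_ : \sum_(1 <= i < M.+1) phi i * truncated_rhs a beta B M y i =
  \sum_(1 <= i < M.+1) phi i * (2^-1 *
      \sum_(1 <= j < i) a (i - j)%N j * y (i - j)%N * y j)
  - \sum_(1 <= i < M.+1) phi i * \sum_(1 <= j < (M - i).+1) a i j * y i * y j
  + \sum_(1 <= i < M.+1) phi i *
     \sum_(1 <= j < (M - i).+1) B (i + j)%N * beta (i + j)%N i * y (i + j)%N
  - \sum_(1 <= i < M.+1) phi i * (B i * y i)); last first.
  by rewrite -sumrB -big_split -sumrB/=; apply: eq_bigr => i _; rewrite /truncated_rhs; ring.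
rewrite gain loss frag_gain frag_loss -mulrBr -addrA -sumrB.
congr (_ * _ + _); last first.
  by rewrite -sumrB; apply: eq_bigr => i _; rewrite mulrBr.
by apply: eq_bigr => i _; rewrite -sumrB; apply: eq_bigr => j _; ring.
Qed.

Hypothesis B_ge0 : forall i, (1 <= i)%N -> 0 <= B i.
Hypothesis beta_mass : forall i, (2 <= i)%N ->
  i%:R = \sum_(1 <= j < i) j%:R * beta i j.

Lemma truncated_mass (M : nat) (y : nat -> R) :
  \sum_(1 <= i < M.+1) i%:R * truncated_rhs a beta B M y i = 0.
Proof.
rewrite truncated_weak_form big1 ?mulr0 ?add0r => [|i _].
  rewrite big_nat big1// => i /andP[i2 _].
  rewrite [X in _ * (_ - X)]beta_mass//
    [X in _ * (X - _)](_ : _ = \sum_(1 <= j < i) j%:R * beta i j).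
    by rewrite subrr mulr0.
  by apply: eq_bigr => j _; rewrite mulrC.
by rewrite big1// => j _; rewrite natrD; ring.
Qed.

Lemma truncated_moment_le (M : nat) (y psi : nat -> R) (C : R) :
  0 <= C -> (forall i, (1 <= i <= M)%N -> 0 <= y i) ->
  (forall i j, (1 <= i <= j)%N -> psi i <= psi j) ->
  (forall i j, (1 <= i)%N -> (1 <= j)%N ->
    a i j * ((i + j)%:R * psi (i + j)%N - i%:R * psi i - j%:R * psi j)
      <= C * (i%:R * j%:R)) ->
  \sum_(1 <= i < M.+1) (i%:R * psi i) * truncated_rhs a beta B M y i
    <= C * (\sum_(1 <= i < M.+1) i%:R * y i) ^+ 2.
Proof.
move=> C0 y0 psi_le aC.
rewrite (@truncated_weak_form M y (fun i => i%:R * psi i)).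
rewrite -[leRHS]addr0; apply: lerD; last first.
  rewrite big_nat; apply: sumr_le0 => i /andP[i2 iM].
  have i1 : (1 <= i)%N by exact: ltnW.
  apply: mulr_ge0_le0; first by rewrite mulr_ge0 ?B_ge0 ?y0// i1 -ltnS.
  rewrite subr_le0 [leRHS]mulrC (beta_mass i2) mulr_sumr.
  rewrite big_nat [leRHS]big_nat; apply: ler_sum => j /andP[j1 ji].
  have [_ _ b0] := aP i1 j1.
  rewrite [leRHS](_ : _ = beta i j * (j%:R * psi i)); last by ring.
  by rewrite !ler_wpM2l// psi_le// j1 ltnW.
rewrite ler_pdivrMl ?ltr0n//.
(* The factor one half is given up, and below the triangle [i + j <= M] is enlarged to the square
   [i, j <= M], where the double sum is the square of the mass. *)
apply: (@le_trans _ _ (C * (\sum_(1 <= i < M.+1) i%:R * y i) ^+ 2)); last first.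
  have : 0 <= C * (\sum_(1 <= i < M.+1) i%:R * y i) ^+ 2 by rewrite mulr_ge0 ?sqr_ge0.
  lra.
rewrite expr2 mulrCA mulr_suml big_nat [leRHS]big_nat.
apply: ler_sum => i /andP[i1 iM].
have yi : 0 <= y i by rewrite y0// i1.
apply: (@le_trans _ _ (\sum_(1 <= j < (M - i).+1) C * (i%:R * y i) * (j%:R * y j))).
  rewrite big_nat [leRHS]big_nat; apply: ler_sum => j /andP[j1 jM].
  have yj : 0 <= y j by rewrite y0// j1 -ltnS (leq_trans jM)// ltnS leq_subr.
  rewrite [leLHS](_ : _ = y i * y j * (a i j * ((i + j)%:R * psi (i + j)%N - i%:R * psi i
    - j%:R * psi j))); last by ring.
  rewrite [leRHS](_ : _ = y i * y j * (C * (i%:R * j%:R))); last by ring.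
  by rewrite ler_wpM2l ?mulr_ge0// aC.
rewrite -mulr_sumr [leRHS]mulrCA [leRHS]mulrA ler_wpM2l ?mulr_ge0//.
rewrite (@big_cat_nat _ _ _ (M - i).+1 _ M.+1)//= ?ltnS ?leq_subr// lerDl.
rewrite big_nat; apply: sumr_ge0 => j /andP[j1 jM].
by rewrite mulr_ge0// y0// (leq_trans _ j1).
Qed.

End weak_form.

(** * Mass and superlinear moments of truncated solutions *)

Section truncated.
Variables (R : realType) (N : nat) (Om : set 'rV[R]_N).
Local Notation E := 'rV[R]_N.
Local Notation mu := (lebesgue_rV R N).
Hypotheses (oO : open Om) (bO : bounded_set Om) (sO : smooth_boundary Om).

Let mO : measurable Om.
Proof. exact: open_measurable_rV. Qed.

Let Ofin : (mu Om < +oo)%E.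
Proof. exact: open_bounded_lty. Qed.

Let int f : bounded_measurable Om f -> mu.-integrable Om (EFin \o f).
Proof. exact: bounded_measurable_integrable. Qed.

Lemma within_continuousM (T : topologicalType) (K : set T) (f g : T -> R) :
  {within K, continuous f} -> {within K, continuous g} ->
  {within K, continuous (fun x => f x * g x)}.
Proof. by move=> cf cg x; apply: cvgM; [exact: cf|exact: cg]. Qed.

Lemma within_continuousD (T : topologicalType) (K : set T) (f g : T -> R) :
  {within K, continuous f} -> {within K, continuous g} ->
  {within K, continuous (fun x => f x + g x)}.
Proof. by move=> cf cg x; apply: cvgD; [exact: cf|exact: cg]. Qed.

Lemma within_continuous_cst (T : topologicalType) (K : set T) (r : R) :
  {within K, continuous (fun _ : T => r)}.
Proof. by apply: continuous_subspaceT => x; exact: cvg_cst. Qed.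

Lemma within_continuous_sum (T : topologicalType) (K : set T) (s : seq nat)
    (w : nat -> R) (F : nat -> T -> R) :
  {in s, forall i, {within K, continuous (F i)}} ->
  {within K, continuous (fun x => \sum_(i <- s) w i * F i x)}.
Proof.
elim: s => [|i s IH] cF.
  rewrite (_ : (fun _ => _) = fun=> 0); first exact: within_continuous_cst.
  by apply/funext => x; rewrite big_nil.
rewrite (_ : (fun _ => _) = fun x => w i * F i x + \sum_(i <- s) w i * F i x).
  apply: within_continuousD.
    apply: within_continuousM; first exact: within_continuous_cst.
    by apply: cF; rewrite mem_head.
  by apply: IH => j js; apply: cF; rewrite inE js orbT.
by apply/funext => x; rewrite big_cons.
Qed.

Lemma is_derive_weighted_sum (V : normedModType R) (s : seq nat) (w : nat -> R)
    (F : nat -> V -> R) (x v : V) (dF : nat -> R) :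
  {in s, forall i, is_derive x v (F i) (dF i)} ->
  is_derive x v (fun y => \sum_(i <- s) w i * F i y) (\sum_(i <- s) w i * dF i).
Proof.
elim: s => [|i s IH] dFP.
  rewrite big_nil (_ : (fun _ => _) = cst 0); first exact: is_derive_cst.
  by apply/funext => y; rewrite big_nil.
rewrite big_cons (_ : (fun _ => _) =
  (w i \*: F i) + (fun y => \sum_(i <- s) w i * F i y)).
  apply: is_deriveD; last by apply: IH => j js; apply: dFP; rewrite inE js orbT.
  by apply: is_deriveZ; apply: dFP; rewrite mem_head.
by apply/funext => y; rewrite big_cons.
Qed.

(** The solution, unlike its derivatives, is continuous down to time 0; this returns estimates
    started at [tau > 0] to the initial data. *)
Lemma cylinder_integral_right0 (f : R -> E -> R) (e : R) : 0 < e ->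
  continuous_on_cylinder Om `[0, +oo[ f ->
  \forall t \near (0 : R)^'+,
    `|\int[mu]_(x in Om) f t x - \int[mu]_(x in Om) f 0 x| <= e.
Proof.
move=> e0 cf.
set m := fine (mu Om); have m0 : 0 <= m by exact: fine_ge0.
have e1 : 0 < e / (m + 1) by rewrite divr_gt0// ltr_wpDl.
have sub : [set` `[0, 1 : R]] `<=` [set` `[0%R, +oo[].
  by move=> t /=; rewrite !in_itv/= => /andP[-> _].
have [r /= r0 Hr] := cylinder_time_unif bO e1 sub cf.
have bf t : 0 <= t -> bounded_measurable Om (f t).
  move=> t0; apply: within_closure_bounded_measurable => //.
  by apply: (cylinder_slice cf); rewrite /= in_itv/= t0.
have r2 : 0 < r / 2 by rewrite divr_gt0.
near=> t.
have t0 : 0 < t by near: t; exact: nbhs_right_gt.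
have b := bounded_measurableB (bf _ (ltW t0)) (bf 0 (lexx _)).
rewrite -RintegralB//; [|exact/int/bf/ltW|exact/int/bf].
apply: le_trans (le_normr_Rintegral mO (int b)) _.
apply: (@le_trans _ _ (\int[mu]_(x in Om) (e / (m + 1)))).
  apply: le_Rintegral => //; first exact/int/bounded_measurable_norm.
    exact/int/bounded_measurable_cst.
  move=> x Ox; apply: (Hr (r / 2)) => //=.
  - by rewrite /ball_/= sub0r normrN gtr0_norm// ltr_pdivrMr// mulr_natr mulr2n ltrDl.
  - by rewrite in_itv/= lexx ler01.
  - rewrite in_itv/= (ltW t0)/=; apply: ltW; near: t; exact: nbhs_right_lt.
  - rewrite subr0 gtr0_norm//; near: t; exact: nbhs_right_lt.
  - exact: subset_closure.
rewrite Rintegral_cst// -/m mulrAC ler_pdivrMr ?ltr_wpDl// ler_pM2l// lerDl//.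
Unshelve. all: by end_near. Qed.

Variables (a beta : nat -> nat -> R) (B d : nat -> R).
Hypothesis aP : forall i j, (1 <= i)%N -> (1 <= j)%N ->
  [/\ a i j = a j i, 0 <= a i j & 0 <= beta i j].
Hypothesis B1 : B 1%N = 0.
Hypothesis B_ge0 : forall i, (1 <= i)%N -> 0 <= B i.
Hypothesis beta_mass : forall i, (2 <= i)%N ->
  i%:R = \sum_(1 <= j < i) j%:R * beta i j.
Variables (delta D : R) (delta0 : 0 < delta).
Hypothesis dP : forall i, (1 <= i)%N -> delta <= d i <= D.
Variables (M : nat) (c0 : nat -> E -> R) (c : nat -> R -> E -> R).
Hypothesis cP : truncated_solution Om a beta B d M c0 c.

Let U (w : nat -> R) t x := \sum_(1 <= i < M.+1) w i * c i t x.

Let inM i : i \in index_iota 1 M.+1 -> (1 <= i <= M)%N.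
Proof. by rewrite mem_index_iota ltnS. Qed.

Let cU w : continuous_on_cylinder Om `[0, +oo[ (U w).
Proof.
apply: (@within_continuous_sum _ _ _ w (fun i p => c i p.1 p.2)) => i /inM iM.
by have [ut [g [h [[? _ _ _] _ _ _]]]] := trunc_eq cP iM.
Qed.

Let bU w t : 0 <= t -> bounded_measurable Om (U w t).
Proof.
move=> t0; apply: within_closure_bounded_measurable => //.
by apply: (cylinder_slice (@cU w)); rewrite /= in_itv/= t0.
Qed.

Let U0 w x : closure Om x -> U w 0 x = \sum_(1 <= i < M.+1) w i * c0 i x.
Proof.
move=> Ox; rewrite /U big_nat [RHS]big_nat; apply: eq_bigr => i iM.
by have [_ _ ->] := trunc_data cP iM.
Qed.

Let I0 w : \int[mu]_(x in Om) U w 0 x =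
  \int[mu]_(x in Om) (\sum_(1 <= i < M.+1) w i * c0 i x).
Proof. by apply: eq_Rintegral => x /set_mem Ox; apply/U0/subset_closure. Qed.

(** One choice of derivatives serves all weights, because the equation couples two of them: the
    diffusion part for the weight [w] is the Laplacian of the sum with weight [w i * d i]. *)
Lemma truncated_weighted_data : exists (Ut : (nat -> R) -> R -> E -> R)
    (G H : (nat -> R) -> 'I_N -> R -> E -> R),
  [/\ forall w, continuous_on_cylinder Om `]0, +oo[ (Ut w) /\
        forall (t : R) x, 0 < t -> Om x -> is_derive t 1 (fun s => U w s x) (Ut w t x),
      forall w k t, 0 < t ->
        {within closure Om, continuous (G w k t)} /\ {within closure Om, continuous (H w k t)},
      forall w k t x, 0 < t -> Om x -> is_derive x (basis_vec R k) (U w t) (G w k t x) /\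
        is_derive x (basis_vec R k) (G w k t) (H w k t x),
      forall w t x nu, 0 < t -> bdry Om x -> outward_unit_normal Om x nu ->
        \sum_k G w k t x * nu ord0 k = 0 &
      forall w t x, 0 < t -> Om x -> Ut w t x =
        \sum_k H (fun i => w i * d i) k t x +
        \sum_(1 <= i < M.+1) w i * truncated_rhs a beta B M (fun j => c j t x) i].
Proof.
pose Q i (p : (R -> E -> R) * ('I_N -> R -> E -> R) * ('I_N -> R -> E -> R)) :=
  (1 <= i <= M)%N ->
  [/\ [/\ continuous_on_cylinder Om `]0, +oo[ p.1.1,
          forall k, continuous_on_cylinder Om `]0, +oo[ (p.1.2 k) &
          forall k, continuous_on_cylinder Om `]0, +oo[ (p.2 k)],
      forall (t : R) x, 0 < t -> Om x ->
        [/\ is_derive t 1 (fun s => c i s x) (p.1.1 t x),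
            forall k, is_derive x (basis_vec R k) (c i t) (p.1.2 k t x) &
            forall k, is_derive x (basis_vec R k) (p.1.2 k t) (p.2 k t x)],
      forall (t : R) x, 0 < t -> Om x ->
        p.1.1 t x - d i * (\sum_k p.2 k t x) =
        truncated_rhs a beta B M (fun j => c j t x) i &
      forall (t : R) x nu, 0 < t -> bdry Om x -> outward_unit_normal Om x nu ->
        \sum_k p.1.2 k t x * nu ord0 k = 0].
(* [Q i] is vacuous outside [1 <= i <= M], where zero functions are taken. *)
have /choice[p pP] : forall i, exists p, Q i p.
  move=> i; have [iM|iM] := boolP (1 <= i <= M)%N; last first.
    by exists ((fun _ _ => 0), (fun _ _ _ => 0), (fun _ _ _ => 0)) => /(negP iM).
  have [ut [g [h [[_ c1 c2 c3] h1 h2 h3]]]] := trunc_eq cP iM.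
  exists (ut, g, fun k => h k k) => _ /=; split => //.
  by move=> t x t0 Ox; have [? ? ?] := h1 t x t0 Ox; split.
have pM i : i \in index_iota 1 M.+1 -> _ := fun im => pP i (inM im).
exists (fun w t x => \sum_(1 <= i < M.+1) w i * (p i).1.1 t x).
exists (fun w k t x => \sum_(1 <= i < M.+1) w i * (p i).1.2 k t x).
exists (fun w k t x => \sum_(1 <= i < M.+1) w i * (p i).2 k t x).
have t_in (t : R) : 0 < t -> [set` `]0%R, +oo[] t by rewrite /= in_itv/= andbT.
split.
- move=> w; split.
    apply: (@within_continuous_sum _ _ _ w (fun i q => (p i).1.1 q.1 q.2)) => i im.
    by have [[? _ _] _ _ _] := pM i im.
  move=> t x t0 Ox; apply: (@is_derive_weighted_sum _ _ w (fun i s => c i s x)) => i im.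
  by have [_ H _ _] := pM i im; have [? _ _] := H t x t0 Ox.
- move=> w k t t0; split.
    apply: (@within_continuous_sum _ _ _ w (fun i => (p i).1.2 k t)) => i im.
    have [[_ H _] _ _ _] := pM i im; exact: (cylinder_slice (H k) (t_in t t0)).
  apply: (@within_continuous_sum _ _ _ w (fun i => (p i).2 k t)) => i im.
  have [[_ _ H] _ _ _] := pM i im; exact: (cylinder_slice (H k) (t_in t t0)).
- move=> w k t x t0 Ox; split.
    apply: (@is_derive_weighted_sum _ _ w (fun i => c i t)) => i im.
    by have [_ H _ _] := pM i im; have [_ ? _] := H t x t0 Ox.
  apply: (@is_derive_weighted_sum _ _ w (fun i => (p i).1.2 k t)) => i im.
  by have [_ H _ _] := pM i im; have [_ _ ?] := H t x t0 Ox.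
- move=> w t x nu t0 bx nux.
  under eq_bigr do rewrite mulr_suml.
  rewrite exchange_big/= big_seq big1// => i im.
  have [_ _ _ H] := pM i im.
  by under eq_bigr do rewrite -mulrA; rewrite -mulr_sumr (H t x nu t0 bx nux) mulr0.
- move=> w t x t0 Ox; rewrite exchange_big/= -big_split/= big_seq [RHS]big_seq.
  apply: eq_bigr => i im; have [_ _ H _] := pM i im.
  rewrite -H// -mulr_sumr; ring.
Qed.

Lemma truncated_mass_ge (t : R) : 0 <= t ->
  \int[mu]_(x in Om) (\sum_(1 <= i < M.+1) i%:R * c0 i x) <=
  \int[mu]_(x in Om) (\sum_(1 <= i < M.+1) i%:R * c i t x).
Proof.
rewrite le_eqVlt => /predU1P[<-|t0].
  by rewrite -(I0 (fun i => i%:R)).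
have [Ut [G [H [UtP cGH dGH nG UtE]]]] := truncated_weighted_data.
(* [integral_increment] bounds from above; the negative weights turn this into the lower bound on
   the mass. *)
pose w i : R := - i%:R.
have Ut0 s : 0 < s -> \int[mu]_(x in Om) Ut w s x <= 0.
  move=> s0; rewrite le_eqVlt; apply/orP; left; apply/eqP.
  pose w' i := w i * d i.
  have zf : zero_flux_field Om (fun k => G w' k s) (fun k => H w' k s).
    split => //.
    - by move=> k; have [] := cGH w' k s s0.
    - by move=> k x Ox; have [] := dGH w' k s x s0 Ox.
    - by move=> k; have [] := cGH w' k s s0.
    - by move=> x nu; exact: nG.
  rewrite -[RHS](zero_flux_integral oO bO sO zf); apply: eq_Rintegral => x /set_mem Ox.
  rewrite UtE// -/w' -[RHS]addr0; congr (_ + _).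
  rewrite -[RHS]oppr0 -[in RHS](truncated_mass aP B1 beta_mass M (fun j => c j s x)) -sumrN.
  by apply: eq_bigr => i _; rewrite mulNr.
have UN s : 0 <= s -> \int[mu]_(x in Om) U w s x =
    - \int[mu]_(x in Om) U (fun i => i%:R) s x.
  move=> s0; rewrite -mulN1r -RintegralZl//; last exact/int/bU.
  apply: eq_Rintegral => x _; rewrite /U mulN1r -sumrN.
  by apply: eq_bigr => i _; rewrite mulNr.
have cUw s : 0 < s -> {within closure Om, continuous (U w s)}.
  by move=> s0; apply: (cylinder_slice (@cU w)); rewrite /= in_itv/= (ltW s0).
apply/ler_addgt0Pr => e e0; have e2 : 0 < e / 2 by rewrite divr_gt0.
have h1 := cylinder_integral_right0 e2 (@cU w).
have [tau [[ht tau0] taut]] : exists tau, (`|\int[mu]_(x in Om) U w tau x -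
    \int[mu]_(x in Om) U w 0 x| <= e / 2 /\ 0 < tau) /\ tau < t.
  apply: (@filter_ex _ (0 : R)^'+); apply: filterI; last exact: nbhs_right_lt.
  by apply: filterI => //; exact: nbhs_right_gt.
have [n Hn] := filter_ex (integral_increment oO bO tau0 taut e2 cUw
  (UtP w).1 (UtP w).2 (Y := fun=> 0) Ut0).
move: Hn ht; rewrite big1// mulr0 addr0 !UN ?(ltW t0) ?(ltW tau0)//.
rewrite (I0 (fun i => i%:R)) ler_norml => Hn /andP[_].
rewrite -/(U (fun i => i%:R) t) [X in _ <= X + _](_ : _ = \int[mu]_(x in Om) U (fun i => i%:R) t x)//.
lra.
Qed.

(** In the constant 2, one unit comes from replacing time 0 by [tau] in the moment and one from the
    Riemann error; the unit added to the integral of the squared data comes from replacing time 0 by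
    [tau] there. *)
Lemma truncated_moment_estimate (psi : nat -> R) (C T t : R) :
  0 <= C ->
  (forall i j, (1 <= i <= j)%N -> psi i <= psi j) ->
  (forall i j, (1 <= i)%N -> (1 <= j)%N ->
    a i j * ((i + j)%:R * psi (i + j)%N - i%:R * psi i - j%:R * psi j)
      <= C * (i%:R * j%:R)) ->
  0 <= t <= T ->
  \int[mu]_(x in Om) (\sum_(1 <= i < M.+1) i%:R * psi i * c i t x) <=
  \int[mu]_(x in Om) (\sum_(1 <= i < M.+1) i%:R * psi i * c0 i x) + 2 +
  C * (T * ((D / delta) ^+ 2 *
    (\int[mu]_(x in Om) (\sum_(1 <= i < M.+1) i%:R * c0 i x + 1) ^+ 2 + 1))).
Proof.
move=> C0 psi_le aC /andP[].
set w := fun i => i%:R * psi i; pose w1 i : R := i%:R.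
set J := \int[mu]_(x in Om) (_ + 1) ^+ 2.
have J0 : 0 <= J by apply: Rintegral_ge0 => x _; exact: sqr_ge0.
have K0 : 0 <= C * ((D / delta) ^+ 2 * (J + 1)).
  by rewrite mulr_ge0// mulr_ge0 ?sqr_ge0// addr_ge0.
rewrite le_eqVlt => /predU1P[<- T0|t0 tT].
  rewrite (I0 w) -[leLHS]addr0 -addrA lerD2l addr_ge0//.
  by rewrite mulrCA mulr_ge0.
have [Ut [G [H [UtP cGH dGH nG UtE]]]] := truncated_weighted_data.
pose wd i := w1 i * d i.
have c_ge0 i s x : (1 <= i <= M)%N -> 0 <= s -> Om x -> 0 <= c i s x.
  by move=> iM; exact: (trunc_ge0 cP iM).
have cUw v s : 0 < s -> {within closure Om, continuous (U v s)}.
  by move=> s0; apply: (cylinder_slice (@cU v)); rewrite /= in_itv/= (ltW s0).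
have rho0 s x : 0 < s -> Om x -> 0 <= U w1 s x.
  move=> s0 Ox; rewrite /U big_nat; apply: sumr_ge0 => i iM.
  by rewrite mulr_ge0// c_ge0// ltW.
have rhoP s x : 0 < s -> Om x -> delta * U w1 s x <= U wd s x <= D * U w1 s x.
  move=> s0 Ox; rewrite /U !mulr_sumr !big_nat; apply/andP; split; apply: ler_sum => i iM;
    have i1 : (1 <= i)%N by [case/andP: iM]; have /andP[d1 d2] := dP i1.
    rewrite mulrA ler_wpM2r ?c_ge0 ?(ltW s0)// /wd mulrC.
    by rewrite ler_wpM2l.
  rewrite [leRHS]mulrA ler_wpM2r ?c_ge0 ?(ltW s0)// /wd [leRHS]mulrC.
  by rewrite ler_wpM2l.
have Lwd s x : 0 < s -> Om x -> Ut w1 s x = \sum_k H wd k s x.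
  by move=> s0 Ox; rewrite UtE// (truncated_mass aP B1 beta_mass) addr0.
have Ut_le s : 0 < s -> \int[mu]_(x in Om) Ut w s x <= C * \int[mu]_(x in Om) (U w1 s x ^+ 2).
  move=> s0; pose w' i := w i * d i.
  have zf : zero_flux_field Om (fun k => G w' k s) (fun k => H w' k s).
    split => //.
    - by move=> k; have [] := cGH w' k s s0.
    - by move=> k x Ox; have [] := dGH w' k s x s0 Ox.
    - by move=> k; have [] := cGH w' k s s0.
    - by move=> x nu; exact: nG.
  have bF := flux_bounded_measurable oO bO zf.
  have b2 : bounded_measurable Om (fun x => C * U w1 s x ^+ 2).
    apply: bounded_measurableM; first exact: bounded_measurable_cst.
    by apply/bounded_measurableX/bU/ltW.
  rewrite -RintegralZl//; last by apply/int/bounded_measurableX/bU/ltW.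
  rewrite -[leRHS]add0r -(zero_flux_integral oO bO sO zf) -RintegralD//; [|exact: int|exact: int].
  apply: le_Rintegral => //.
  - apply: int; apply: within_closure_bounded_measurable => //.
    by apply: (cylinder_slice (UtP w).1); rewrite /= in_itv/= s0.
  - exact/int/bounded_measurableD.
  - move=> x Ox; rewrite UtE// -/w' lerD2l.
    apply: (truncated_moment_le aP B1 B_ge0 beta_mass) => // i iM.
    by apply: c_ge0 => //; exact: ltW.
have crho1 : continuous_on_cylinder Om `[0, +oo[ (fun s x => (U w1 s x + 1) ^+ 2).
  have c1 := within_continuousD (@cU w1) (@within_continuous_cst _ _ 1).
  exact: (within_continuousM c1 c1).
have h1 := cylinder_integral_right0 ltr01 (@cU w).
have h2 := cylinder_integral_right0 ltr01 crho1.
have [tau [[[ht1 ht2] tau0] taut]] : exists tau, ((`|\int[mu]_(x in Om) U w tau x -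
    \int[mu]_(x in Om) U w 0 x| <= 1 /\ `|\int[mu]_(x in Om) (U w1 tau x + 1) ^+ 2 -
    \int[mu]_(x in Om) (U w1 0 x + 1) ^+ 2| <= 1) /\ 0 < tau) /\ tau < t.
  apply: (@filter_ex _ (0 : R)^'+); apply: filterI; last exact: nbhs_right_lt.
  by apply: filterI; [exact: filterI|exact: nbhs_right_gt].
have EN := integral_increment oO bO tau0 taut ltr01 (cUw w) (UtP w).1 (UtP w).2 Ut_le.
have EE := energy_estimate oO bO sO (UtP w1).2 (UtP w1).1 (cUw w1) (cUw wd)
  (fun k s s0 => (cGH wd k s s0).1) (fun k s s0 => (cGH wd k s s0).2) Lwd
  (fun s x k s0 Ox => (dGH wd k s x s0 Ox).1) (fun s x k s0 Ox => (dGH wd k s x s0 Ox).2)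
  (nG wd) delta0 rho0 rhoP tau0 taut.
(* For a common [n] the Riemann sum of the squared density on the right of [EN] is, up to [C], the
   left-hand side of [EE]. *)
have [n [Hn1 Hn2]] := filter_ex (filterI EN EE).
have J1 : \int[mu]_(x in Om) (U w1 0 x + 1) ^+ 2 = J.
  by apply: eq_Rintegral => x /set_mem Ox; rewrite U0//; exact: subset_closure.
move: Hn1 ht1 ht2 Hn2; rewrite (I0 w) J1 -mulr_sumr mulrCA.
rewrite -[X in _ -> _ -> _ -> _ -> X <= _]/(\int[mu]_(x in Om) U w t x).
move: (\int[mu]_(x in Om) U w t x) (\int[mu]_(x in Om) U w tau x)
  (\int[mu]_(x in Om) (\sum_(1 <= i < M.+1) w i * c0 i x))
  (\int[mu]_(x in Om) (U w1 tau x + 1) ^+ 2)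
  (time_step tau t n * _) => X1 X2 X3 X4 X5.
rewrite !ler_norml => H1 /andP[_ H2] /andP[_ H3] H4.
have H5 : (t - tau) * ((D / delta) ^+ 2 * X4) <= T * ((D / delta) ^+ 2 * (J + 1)).
  have dd : 0 <= (D / delta) ^+ 2 by exact: sqr_ge0.
  apply: (@le_trans _ _ ((t - tau) * ((D / delta) ^+ 2 * (J + 1)))).
    by rewrite ler_wpM2l ?subr_ge0 ?(ltW taut)// ler_wpM2l//; lra.
  apply: ler_wpM2r; first by rewrite mulr_ge0// addr_ge0.
  by rewrite (le_trans _ tT)// gerBl ltW.
have := ler_wpM2l C0 (le_trans H4 H5); lra.
Qed.

End truncated.

(** * Superlinear weights *)

Section slow_function.
Variables (R : realType) (X : nat -> R).

(** The increments of at least 1 make the scale unbounded whatever [X] is; the starting value 1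
    yields [slow_fun x <= x]. *)
Fixpoint slow_scale (q : nat) : R :=
  if q is q'.+1 then Num.max (slow_scale q' + 1) (X q) else 1.

Local Notation L := slow_scale.

(* A concave, hence subadditive, function growing slower than the thresholds [X]. *)
Definition slow_fun (x : R) : R := inf [set p%:R + x / L p | p in [set: nat]].

Local Notation H := slow_fun.

Lemma slow_scale_ge q : q%:R + 1 <= L q.
Proof.
elim: q => [|q IH] /=; first by rewrite add0r.
by rewrite le_max -[q.+1%:R]natr1 lerD2r IH.
Qed.

Let L_gt0 q : 0 < L q.
Proof. by apply: lt_le_trans (slow_scale_ge q); rewrite ltr_wpDl. Qed.

Lemma slow_scale_homo p q : (p <= q)%N -> L p <= L q.
Proof.
move=> /subnK <-; elim: (q - p)%N => [|k IH]; first by rewrite add0n.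
by rewrite addSn /= le_max (le_trans IH)// lerDl.
Qed.

Lemma slow_scale_geX q : (1 <= q)%N -> X q <= L q.
Proof. by case: q => // q _ /=; rewrite le_max lexx orbT. Qed.

Let lbound0 x : 0 <= x -> lbound [set p%:R + x / L p | p in [set: nat]] 0.
Proof. by move=> x0 _ [p _ <-]; rewrite addr_ge0// divr_ge0// ltW. Qed.

Let nonempty x : [set p%:R + x / L p | p in [set: nat]] !=set0.
Proof. by exists (0%:R + x / L 0); exists 0%N. Qed.

Lemma slow_fun_le p x : 0 <= x -> H x <= p%:R + x / L p.
Proof.
move=> x0; apply: ge_inf; last by exists p.
by exists 0; exact: lbound0.
Qed.

Lemma slow_fun_glb x y : (forall p, y <= p%:R + x / L p) -> y <= H x.
Proof. by move=> yx; apply: lb_le_inf => // _ [p _ <-]. Qed.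

Lemma slow_fun_ge0 x : 0 <= x -> 0 <= H x.
Proof. by move=> x0; apply: slow_fun_glb => p; rewrite addr_ge0// divr_ge0// ltW. Qed.

Lemma slow_fun_le_id x : 0 <= x -> H x <= x.
Proof. by move=> x0; have := slow_fun_le 0 x0; rewrite /= add0r divr1. Qed.

Lemma slow_fun_homo x y : 0 <= x -> x <= y -> H x <= H y.
Proof.
move=> x0 xy; apply: slow_fun_glb => p; apply: le_trans (slow_fun_le p x0) _.
by rewrite lerD2l ler_pM2r ?invr_gt0.
Qed.

(** The affine functions of index [p] and [q] used at the two points are both replaced by that of
    index [maxn p q]: its slope is at most either slope and its constant term at most [p + q]. *)
Lemma slow_fun_subadd x y : 0 <= x -> 0 <= y -> H (x + y) <= H x + H y.
Proof.
move=> x0 y0; rewrite -lerBlDl; apply: slow_fun_glb => p.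
rewrite lerBlDl -lerBlDr; apply: slow_fun_glb => q; rewrite lerBlDr.
apply: le_trans (slow_fun_le (maxn p q) (addr_ge0 x0 y0)) _.
rewrite mulrDl addrC.
rewrite [leRHS](_ : _ = (x / L q + y / L p) + (q%:R + p%:R)); last by ring.
apply: lerD; first by apply: lerD; rewrite ler_wpM2l// lef_pV2 ?posrE// slow_scale_homo ?leq_maxl ?leq_maxr.
by rewrite -natrD ler_nat geq_max leq_addl leq_addr.
Qed.

(** Affine functions of index at least [K] have a large constant term, the others have slope at
    least the inverse of [L K]. *)
Lemma slow_fun_cvg (K : nat) x : K%:R * L K <= x -> K%:R <= H x.
Proof.
move=> Kx; have x0 : 0 <= x by rewrite (le_trans _ Kx)// mulr_ge0// ltW.
apply: slow_fun_glb => p; have [Kp|pK] := leqP K p.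
  by rewrite ler_wpDr ?ler_nat// divr_ge0// ltW.
rewrite ler_wpDl// ler_pdivlMr//; apply: le_trans Kx.
by rewrite ler_wpM2l// slow_scale_homo// ltnW.
Qed.

(** Take the least index [q.+1] with [x <= L q.+1]: its affine function gives [H x <= q.+1 + 1], and
    minimality gives [X q <= L q < x]. Thus [H] grows only after the threshold that allows it has
    been passed. *)
Lemma slow_fun_cases x : 0 <= x -> H x <= 2 \/
  exists q, [/\ (1 <= q)%N, X q < x & H x <= q%:R + 2].
Proof.
move=> x0; have ex : exists p, x <= L p.
  exists (Num.bound x); apply: le_trans (slow_scale_ge _).
  by rewrite ler_wpDr//; apply/ltW/archi_boundP.
case: (ex_minnP ex) => -[|q] xq qmin.
  by left; apply: le_trans (slow_fun_le_id x0) _; apply: le_trans xq _; rewrite /=; lra.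
have Lqx : L q < x by rewrite ltNge; apply/negP => /qmin; rewrite ltnn.
have Hx : H x <= q%:R + 2.
  apply: le_trans (slow_fun_le q.+1 x0) _.
  have : x / L q.+1 <= 1 by rewrite ler_pdivrMr// mul1r.
  rewrite -natr1; lra.
case: q => [|q] in xq qmin Lqx Hx *; first by left; rewrite add0r in Hx.
right; exists q.+1; split => //; apply: le_lt_trans Lqx; exact: slow_scale_geX.
Qed.

End slow_function.

Section superlinear_weight.
Variables (R : realType) (a : nat -> nat -> R) (theta : R -> R).
Hypothesis a_sym : forall i j, (1 <= i)%N -> (1 <= j)%N -> a i j = a j i /\ 0 <= a i j.
Hypothesis theta_gt0 : forall x, 0 <= x -> 0 < theta x.
Hypothesis theta_bounded : exists K, forall x, 0 <= x -> theta x <= K.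
Hypothesis theta_cvg : theta x @[x --> +oo] --> 0.
Hypothesis a_theta : forall i j, (1 <= i <= j)%N ->
  a i j <= (i + j)%:R * theta (j%:R / i%:R).

(** For [i <= j] and [r = j / i], subadditivity at [ln (i + j) = ln i + ln (1 + r)] bounds the part
    with factor [i] by [i * H (ln (1 + r))]. The part with factor [j] costs only
    [j * ln (1 + i / j) <= i], as [H] lies below the identity. *)
Lemma superlinear_weight (n_ : nat -> nat) :
  exists (psi : nat -> R) (C : R), 0 <= C /\
    [/\ forall i, (1 <= i)%N -> 0 < psi i,
        forall i j, (1 <= i < j)%N -> psi i < psi j,
        psi i @[i --> \oo] --> +oo,
        forall i j, (1 <= i)%N -> (1 <= j)%N ->
          a i j * ((i + j)%:R * psi (i + j)%N - i%:R * psi i - j%:R * psi j)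
            <= C * (i%:R * j%:R) &
        forall i, (1 <= i)%N -> psi i <= 3 \/
          exists q, [/\ (1 <= q)%N, (n_ q <= i)%N & psi i <= q%:R + 3]].
Proof.
have [K thetaK] := theta_bounded.
have K0 : 0 < K by apply: lt_le_trans (thetaK 0 _) => //; exact: theta_gt0.
(* The value [q.+2] is the bound of [slow_fun_cases] when the threshold [q] is the last one used, so
   the product of [theta] and [H] will be at most 1. *)
have /choice[A AP] : forall q : nat, exists A : R, 0 <= A /\
    forall r, A < r -> theta r <= q.+2%:R^-1.
  move=> q; have q0 : 0 < q.+2%:R^-1 :> R by rewrite invr_gt0.
  have /cvgr_le/(_ _ q0)[A [_ AP]] := theta_cvg.
  exists (Num.max A 0); split; first by rewrite le_max lexx orbT.
  by move=> r; rewrite gt_max => /andP[/AP].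
(* Both constraints at once: [n_ q] controls the moment of the initial data, [A q] the compensation
   by [theta]. *)
pose X q : R := Num.max (ln (n_ q)%:R) (ln (1 + A q)).
pose H := slow_fun X.
(* [e] is bounded and makes [psi] strictly increasing and positive. *)
pose e i : R := 1 - (i.+1%:R)^-1.
pose psi i := H (ln i%:R) + e i.
have lni i : (1 <= i)%N -> 0 <= ln i%:R :> R by move=> i1; rewrite ln_ge0// ler1n.
have e_ge0 i : (0 : R) <= e i by rewrite subr_ge0 invf_le1// ler1n.
have e_le1 i : e i <= 1 by rewrite gerBl.
have e_lt i j : (i < j)%N -> e i < e j.
  by move=> ij; rewrite ltrD2l ltrN2 ltf_pV2 ?posrE// ltr_nat ltnS.
(* The constant is [2 * (2 * K + 1) + 4 * K]: the first term bounds twice the product of [theta] and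
   [H], the second the remainders of size [2 * i]. *)
exists psi, (8 * K + 2); split; first by rewrite addr_ge0// mulr_ge0// ltW.
split.
- move=> i i1; rewrite ltr_wpDl ?slow_fun_ge0 ?lni//.
  by rewrite (le_lt_trans (e_ge0 0%N))// e_lt.
- move=> i j /andP[i1 ij]; apply: ler_ltD; last exact: e_lt.
  apply: slow_fun_homo; first exact: lni.
  by rewrite ler_ln ?posrE ?ltr0n ?ler_nat// ?(leq_trans i1)// ltnW.
- apply/cvgryPge => Z; set k := Num.bound Z.
  have Zk : Z <= k%:R.
    by have [Z0|Z0] := leP 0 Z; [exact/ltW/archi_boundP|rewrite ltW// (lt_le_trans Z0)].
  exists (Num.bound (expR (k%:R * slow_scale X k))) => //= i ki.
  apply: le_trans Zk _; rewrite /psi ler_wpDr//; apply: slow_fun_cvg.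
  rewrite -[leLHS]expRK ler_ln ?posrE ?expR_gt0//.
    apply: le_trans (ltW (archi_boundP _)) _; first exact: expR_ge0.
    by rewrite ler_nat.
  by rewrite (lt_le_trans (expR_gt0 (k%:R * slow_scale X k)))// (le_trans (ltW (archi_boundP _)))
    ?expR_ge0// ler_nat.
- have half i j : (1 <= i <= j)%N ->
      a i j * ((i + j)%:R * psi (i + j)%N - i%:R * psi i - j%:R * psi j)
        <= (8 * K + 2) * (i%:R * j%:R).
    move=> /andP[i1 ij]; have j1 : (1 <= j)%N by exact: leq_trans ij.
    have [_ a0] := a_sym i1 j1.
    have iR0 : 0 < i%:R :> R by rewrite ltr0n.
    have jR0 : 0 < j%:R :> R by rewrite ltr0n.
    have ijR : i%:R <= j%:R :> R by rewrite ler_nat.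
    pose r : R := j%:R / i%:R; have r0 : 0 < r by rewrite divr_gt0.
    have ln_split (p q : nat) : (1 <= p)%N -> ln (p + q)%:R = ln p%:R + ln (1 + q%:R / p%:R) :> R.
      move=> p1; have p0 : 0 < p%:R :> R by rewrite ltr0n.
      rewrite -lnM ?posrE// ?ltr_wpDr ?divr_ge0//; congr ln.
      by rewrite mulrDr mulr1 mulrCA divff ?gt_eqF// mulr1 natrD.
    have ln1_ge0 (x : R) : 0 <= x -> 0 <= ln (1 + x) by move=> x0; rewrite ln_ge0// lerDl.
    have h1 : H (ln (i + j)%:R) <= H (ln i%:R) + H (ln (1 + r)).
      by rewrite ln_split// slow_fun_subadd ?lni ?ln1_ge0 ?(ltW r0).
    have h2 : j%:R * H (ln (i + j)%:R) <= j%:R * H (ln j%:R) + i%:R.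
      have ij0 : 0 <= i%:R / j%:R :> R by rewrite divr_ge0.
      have : H (ln (i + j)%:R) <= H (ln j%:R) + i%:R / j%:R.
        rewrite addnC ln_split//.
        apply: le_trans (slow_fun_subadd X (lni _ j1) (ln1_ge0 _ ij0)) _.
        rewrite lerD2l; apply: le_trans (slow_fun_le_id X (ln1_ge0 _ ij0)) _.
        by apply: le_ln1Dx; rewrite (lt_le_trans _ ij0)// ltrN10.
      by move=> /(ler_wpM2l (ltW jR0)); rewrite mulrDr mulrCA divff ?gt_eqF// mulr1.

    have e2 : (i + j)%:R * e (i + j)%N - i%:R * e i - j%:R * e j <= i%:R.
      have eE (k : nat) : k%:R * e k = k%:R - 1 + k.+1%:R^-1.
        have kE : k%:R = k.+1%:R - 1 :> R by rewrite -natr1 addrK.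
        have s0 : k.+1%:R != 0 :> R by rewrite pnatr_eq0.
        by rewrite /e kE; move: s0; move: (k.+1%:R : R) => s s0; field.
      rewrite !eE natrD.
      have b1 : i.+1%:R^-1 >= 0 :> R by rewrite invr_ge0.
      have b2 : (i + j).+1%:R^-1 <= j.+1%:R^-1 :> R.
        by rewrite lef_pV2 ?posrE// ler_nat ltnS leq_addl.
      have : 1 <= i%:R :> R by rewrite ler1n.
      move: b1 b2; move: (i.+1%:R^-1 : R) ((i + j).+1%:R^-1 : R) (j.+1%:R^-1 : R).
      move=> u v w; lra.
    have Dle : (i + j)%:R * psi (i + j)%N - i%:R * psi i - j%:R * psi j
        <= i%:R * H (ln (1 + r)) + 2 * i%:R.
      have := ler_wpM2l (ltW iR0) h1; move: h2 e2; rewrite /psi !natrD.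
      lra.
    have H0 : 0 <= H (ln (1 + r)) by rewrite slow_fun_ge0 ?ln1_ge0 ?(ltW r0).
    have tr := theta_gt0 (ltW r0); have tK := thetaK _ (ltW r0).
    have tH : theta r * H (ln (1 + r)) <= 2 * K + 1.
      have [H2|[q [q1 Xq Hq]]] := slow_fun_cases X (ln1_ge0 _ (ltW r0)).
        rewrite ler_wpDr// mulrC ler_pM// ltW//.
      have qr : theta r <= q.+2%:R^-1.
        have [A0 Aq] := AP q; apply: Aq; move: Xq; rewrite gt_max => /andP[_].
        have p1 : 0 < 1 + A q by rewrite ltr_wpDr.
        have p2 : 0 < 1 + r by rewrite addr_gt0.
        by rewrite (@ltr_ln _ (1 + A q)) ?posrE// ltrD2l.
      have : theta r * H (ln (1 + r)) <= q.+2%:R^-1 * (q%:R + 2).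
        by rewrite ler_pM// ltW.
      rewrite -natrD addn2 mulVf ?pnatr_eq0// => h; rewrite (le_trans h)// lerDr.
      by rewrite mulr_ge0// ltW.
    apply: (@le_trans _ _ (a i j * (i%:R * H (ln (1 + r)) + 2 * i%:R))).
      by rewrite ler_wpM2l.
    apply: (@le_trans _ _ (2 * j%:R * theta r * (i%:R * H (ln (1 + r)) + 2 * i%:R))).
      rewrite ler_wpM2r ?addr_ge0 ?mulr_ge0 ?(ltW iR0)//.
      apply: le_trans (a_theta _) _; first by rewrite i1.
      by rewrite -/r ler_wpM2r ?(ltW tr)// natrD; lra.
    rewrite [leLHS](_ : _ =
      i%:R * j%:R * (2 * (theta r * H (ln (1 + r))) + 4 * theta r)); last by ring.
    rewrite [leRHS]mulrC ler_wpM2l ?mulr_ge0 ?(ltW iR0) ?(ltW jR0)//.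
    lra.
  move=> i j i1 j1; have [ij|ji] := leqP i j; first by apply: half; rewrite i1.
  have [-> _] := a_sym i1 j1; rewrite addnC addrAC [i%:R * j%:R]mulrC.
  by apply: half; rewrite j1 ltnW.
- move=> i i1; have [Hi|[q [q1 Xq Hq]]] := slow_fun_cases X (lni i i1).
    by left; have := lerD Hi (e_le1 i); rewrite /psi -/H; lra.
  right; exists q; split => //; last first.
    by have := lerD Hq (e_le1 i); rewrite /psi -/H; lra.
  move: Xq; rewrite gt_max => /andP[nq _].
  rewrite leqNgt; apply/negP => iq; move: nq; apply/negP; rewrite -leNgt.
  by rewrite ler_ln ?posrE ?ltr0n ?ler_nat// ?(leq_trans i1)// ltnW.
Qed.

End superlinear_weight.

Lemma sum_half_pow_le1 (R : realType) M : \sum_(1 <= q < M.+1) (2^-1 : R) ^+ q <= 1.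
Proof.
suff -> : \sum_(1 <= q < M.+1) (2^-1 : R) ^+ q = 1 - 2^-1 ^+ M.
  by rewrite gerBl exprn_ge0.
elim: M => [|M IH]; first by rewrite big_geq// expr0 subrr.
by rewrite big_nat_recr//= IH exprS; field.
Qed.

(** * Passage to the limit *)

Section tightness.
Variables (R : realType) (m : nat -> nat -> R) (m0 : nat -> R) (S0 : R).
Hypothesis m_ge0 : forall M i, (1 <= i <= M)%N -> 0 <= m M i.
Hypothesis m_cvg : forall i, (1 <= i)%N -> m M i @[M --> \oo] --> m0 i.
Hypothesis S_cvg : \sum_(1 <= i < M.+1) i%:R * m M i @[M --> \oo] --> S0.
Hypothesis S0E : \sum_(1 <= i < n) i%:R * m0 i @[n --> \oo] --> S0.

Lemma sum_cvg (w : nat -> R) n : \sum_(1 <= i < n) w i * m M i @[M --> \oo] -->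
  \sum_(1 <= i < n) w i * m0 i.
Proof.
elim: n => [|n IH].
  rewrite big_geq//; apply: cvg_near_cst; apply: filterE => M.
  by rewrite big_geq.
case: n IH => [|n] IH.
  rewrite big_geq//; apply: cvg_near_cst; apply: filterE => M.
  by rewrite big_geq.
rewrite big_nat_recr//=; under eq_cvg do rewrite big_nat_recr//=.
by apply: cvgD => //; apply: cvgM; [exact: cvg_cst|exact: m_cvg].
Qed.

(** No mass escapes to large sizes: a tail is the total minus a finite head, both of which converge,
    and the limits differ by a tail of a convergent series. *)
Lemma mass_tight (e : R) : 0 < e -> exists n, forall n' M, (n <= n')%N ->
  \sum_(1 <= i < M.+1 | (n' <= i)%N) i%:R * m M i <= e.
Proof.
move=> e0; have e2 : 0 < e / 2 by rewrite divr_gt0.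
have lt0 : S0 - e / 2 < S0 by rewrite gtrBl.
have [n0 [n0_gt1 n0e]] : exists n0, (1 <= n0)%N /\
    S0 - e / 2 <= \sum_(1 <= i < n0) i%:R * m0 i.
  apply: (@filter_ex _ \oo); apply: filterI; first by exists 1%N.
  exact: (cvgr_ge _ S0E _ lt0).
have c : \sum_(1 <= i < M.+1) i%:R * m M i - \sum_(1 <= i < n0) i%:R * m M i
    @[M --> \oo] --> S0 - \sum_(1 <= i < n0) i%:R * m0 i.
  by apply: cvgB => //; exact: sum_cvg.
have lte : S0 - \sum_(1 <= i < n0) i%:R * m0 i < e.
  have : e / 2 < e by rewrite ltr_pdivrMr// mulr_natr mulr2n ltrDl.
  by move: n0e; lra.
have [M1 _ M1P] := cvgr_le _ c _ lte.
(* For the finitely many [M] not covered by the limit, [n'] exceeds [M] and the sum is empty. *)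
exists (maxn n0 (maxn M1 n0).+1) => n' M; rewrite geq_max => /andP[n0n' M1n'].
have [MM1|M1M] := ltnP M (maxn M1 n0).
  rewrite big_nat_cond big1 ?(ltW e0)// => i /andP[/andP[_ iM] n'i].
  by have := leq_ltn_trans (leq_trans M1n' n'i) iM; lia.
have n0M : (n0 <= M.+1)%N by rewrite leqW// (leq_trans _ M1M)// leq_maxr.
have := M1P M; rewrite /= (leq_trans (leq_maxl _ _) M1M) => /(_ isT).
rewrite (@big_cat_nat _ _ _ n0 1 M.+1)//= addrAC subrr add0r => tail.
apply: le_trans tail; rewrite big_mkcond/= (@big_cat_nat _ _ _ n0 1 M.+1)//=.
rewrite [X in X + _]big_nat big1 ?add0r => [|i /andP[_ ii]]; last first.
  by rewrite leqNgt (leq_trans ii n0n').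
rewrite big_nat [leRHS]big_nat; apply: ler_sum => i /andP[n0i iM].
have i1 : (1 <= i)%N by exact: leq_trans n0i.
by case: ifP => // _; rewrite mulr_ge0// m_ge0// i1.
Qed.

(** The tails weighted by [q] become summable in [q], with sum at most 1; [q <= n_ q] ensures that
    only [q <= M] matter for sizes up to [M]. *)
Lemma tight_thresholds : exists n_ : nat -> nat, forall q, (q <= n_ q)%N /\
  forall M, (1 <= q)%N -> q%:R * \sum_(1 <= i < M.+1 | (n_ q <= i)%N) i%:R * m M i <= 2^-1 ^+ q.
Proof.
suff /(@choice nat nat)[n_ ?] : forall q, exists n, (q <= n)%N /\ forall M, (1 <= q)%N ->
    q%:R * \sum_(1 <= i < M.+1 | (n <= i)%N) i%:R * m M i <= 2^-1 ^+ q.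
  by exists n_.
case=> [|q]; first by exists 0%N.
have e0 : 0 < 2^-1 ^+ q.+1 / q.+1%:R :> R by rewrite divr_gt0// exprn_gt0.
have [n nP] := mass_tight e0; exists (maxn n q.+1); split; first exact: leq_maxr.
by move=> M _; rewrite -ler_pdivlMl// mulrC; apply: nP; exact: leq_maxl.
Qed.

(** [psi i] is at most 3 plus the sum of all [q] with [n_ q <= i]; exchanging the two sums leaves
    the weighted tails, as in the criterion of de la Vallee-Poussin. *)
Lemma superlinear_data_le (psi : nat -> R) (n_ : nat -> nat) M :
  (forall q, (q <= n_ q)%N /\ forall M, (1 <= q)%N ->
    q%:R * \sum_(1 <= i < M.+1 | (n_ q <= i)%N) i%:R * m M i <= 2^-1 ^+ q) ->
  (forall i, (1 <= i)%N -> psi i <= 3 \/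
     exists q, [/\ (1 <= q)%N, (n_ q <= i)%N & psi i <= q%:R + 3]) ->
  \sum_(1 <= i < M.+1) i%:R * psi i * m M i <=
    3 * (\sum_(1 <= i < M.+1) i%:R * m M i) + 1.
Proof.
move=> nP psiP.
have psi_le i : (1 <= i <= M)%N ->
    psi i <= 3 + \sum_(1 <= q < M.+1) (if (n_ q <= i)%N then q%:R else 0).
  move=> /andP[i1 iM]; have s0 (P : pred nat) :
      0 <= \sum_(1 <= q < M.+1 | P q) (if (n_ q <= i)%N then q%:R else 0) :> R.
    by apply: sumr_ge0 => q _; case: ifP.
  have [h|[q [q1 qi h]]] := psiP i i1.
    by rewrite (le_trans h)// lerDl s0.
  apply: le_trans h _; rewrite addrC lerD2l.
  have qM : (q <= M)%N by rewrite (leq_trans _ iM)// (leq_trans _ qi)//; case: (nP q).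
  rewrite (bigD1_seq q) ?iota_uniq ?mem_index_iota ?q1 ?ltnS//= qi.
  by rewrite lerDl s0.
apply: (@le_trans _ _ (\sum_(1 <= i < M.+1) (3 * (i%:R * m M i) +
    \sum_(1 <= q < M.+1) q%:R * (if (n_ q <= i)%N then i%:R * m M i else 0)))).
  rewrite big_nat [leRHS]big_nat; apply: ler_sum => i /andP[i1 iM].
  rewrite ltnS in iM; have im : (1 <= i <= M)%N by rewrite i1.
  rewrite -mulrA mulrCA.
  have := ler_wpM2r (mulr_ge0 (ler0n R i) (m_ge0 im)) (psi_le i im).
  move=> /le_trans; apply; rewrite mulrDl lerD2l mulr_suml.
  by apply: ler_sum => q _; case: ifP => _; rewrite ?mul0r ?mulr0.
rewrite big_split/= -mulr_sumr lerD2l exchange_big/=.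
apply: le_trans (sum_half_pow_le1 R M).
rewrite big_nat [leRHS]big_nat; apply: ler_sum => q /andP[q1 _].
by rewrite -mulr_sumr -big_mkcond/=; have [_] := nP q; apply.
Qed.

End tightness.

Section integral_lemmas.
Context d (T : measurableType d) (R : realType) (mu : {measure set T -> \bar R}).
Variables (A : set T) (mA : measurable A) (Afin : (mu A < +oo)%E).

Lemma Rintegral_cvg (F : nat -> T -> R) (f : T -> R) :
  (\forall n \near \oo, mu.-integrable A (EFin \o F n)) ->
  mu.-integrable A (EFin \o f) ->
  (\int[mu]_(x in A) (`|F n x - f x|%:E))%E @[n --> \oo] --> 0%E ->
  \int[mu]_(x in A) F n x @[n --> \oo] --> \int[mu]_(x in A) f x.
Proof.
move=> iF iff_ /fine_cvg /= cF; apply/cvgrPdist_le => e e0.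
have cFe := cvgr_le _ cF _ e0.
apply: (@filterS2 _ \oo _ _ _ _ _ iF (cFe _)) => n iFn Fe.
rewrite distrC -RintegralB//; apply: le_trans Fe.
exact: (le_normr_Rintegral mA (integrableB mA iFn iff_)).
Qed.

Lemma L2_Rintegral_cvg (F : nat -> T -> R) (f : T -> R) :
  (forall n, bounded_measurable A (F n)) ->
  mu.-integrable A (EFin \o f) ->
  mu.-integrable A (EFin \o (fun x => f x ^+ 2)) ->
  (\int[mu]_(x in A) (((F n x - f x) ^+ 2)%:E))%E @[n --> \oo] --> 0%E ->
  \int[mu]_(x in A) F n x @[n --> \oo] --> \int[mu]_(x in A) f x /\
  \forall n \near \oo, \int[mu]_(x in A) ((F n x + 1) ^+ 2) <=
     3 * (1 + \int[mu]_(x in A) (f x ^+ 2) + fine (mu A)).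
Proof.
move=> bF if1 if2 /fine_cvg /= cF.
have int g : bounded_measurable A g -> mu.-integrable A (EFin \o g).
  exact: bounded_measurable_integrable.
have mf : measurable_fun A f by apply/measurable_EFinP; exact: measurable_int if1.
have iFf n : mu.-integrable A (EFin \o (fun x => (F n x - f x) ^+ 2)).
  have b2 := int _ (bounded_measurableX 2 (bF n)).
  have i2 : mu.-integrable A (EFin \o (fun x => 2 * F n x ^+ 2 + 2 * f x ^+ 2)).
    exact: (integrableD mA (integrableZl mA 2 b2) (integrableZl mA 2 if2)).
  apply: le_integrable i2 => //.
    apply/measurable_EFinP/measurable_funX/measurable_funB => //.
    by have [] := bF n.
  move=> x _; rewrite /= lee_fin (ger0_norm (sqr_ge0 _)).
  apply: le_trans (ler_norm _); move: (F n x) (f x) => u v.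
  by have := sqr_ge0 (u + v); rewrite sqrrB sqrrD; lra.
have ic (r : R) : mu.-integrable A (EFin \o (fun=> r)).
  exact/int/bounded_measurable_cst.
set m := fine (mu A); have m0 : 0 <= m by exact: fine_ge0.
split.
  apply: Rintegral_cvg => //; first by apply: filterE => n; exact: int.
  have iabs n : mu.-integrable A (EFin \o (fun x => `|F n x - f x|)).
    exact: (integrable_norm (integrableB mA (int _ (bF n)) if1)).
  apply/fine_cvgP; split.
    by apply: filterE => n; exact: (integrable_fin_num mA (iabs n)).
  apply/cvgrPdist_le => e e0.
  have m1 : 0 < m + 1 by rewrite ltr_wpDl.
  (* The inequality [z <= h + z ^+ 2 / h] for [z >= 0] stands in for Cauchy-Schwarz; [h] is such
     that its integral is at most [e / 2]. *)
  pose h := e / 2 / (m + 1); have h0 : 0 < h by rewrite !divr_gt0.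
  have he : 0 < e / 2 * h by rewrite mulr_gt0// divr_gt0.
  have cFh := cvgr_le _ cF _ he; apply: filterS (cFh _) => n Fn.
  rewrite sub0r normrN ger0_norm; last by apply: Rintegral_ge0 => x _.
  apply: (@le_trans _ _ (\int[mu]_(x in A) (h + h^-1 * (F n x - f x) ^+ 2))).
    apply: le_Rintegral => //.
      exact: (integrableD mA (ic h) (integrableZl mA h^-1 (iFf n))).
    move=> x _; rewrite -[X in _ + _ * X]real_normK ?num_real//.
    have := normr_ge0 (F n x - f x); move: `|_| => z z0.
    have [zh|hz] := leP z h; first by rewrite ler_wpDr// mulr_ge0 ?sqr_ge0// invr_ge0 ltW.
    rewrite ler_wpDl ?(ltW h0)// mulrC ler_pdivlMr// expr2 ler_wpM2l// ltW//.
  rewrite RintegralD//; last exact: (integrableZl mA h^-1 (iFf n)).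
  rewrite Rintegral_cst// RintegralZl// -/m.
  have e1 : h * m <= e / 2.
    by rewrite /h mulrAC ler_pdivrMr// ler_pM2l ?divr_gt0// lerDl.
  have e2 : h^-1 * \int[mu]_(x in A) (F n x - f x) ^+ 2 <= e / 2.
    by rewrite mulrC ler_pdivrMr.
  by rewrite [leRHS]splitr lerD.
have cF1 := cvgr_le _ cF _ ltr01; apply: filterS (cF1 _) => n Fn.
apply: (@le_trans _ _ (\int[mu]_(x in A) (3 * ((F n x - f x) ^+ 2 + f x ^+ 2 + 1)))).
  have i3 : mu.-integrable A (EFin \o (fun x => (F n x - f x) ^+ 2 + f x ^+ 2 + 1)).
    exact: (integrableD mA (integrableD mA (iFf n) if2) (ic 1)).
  apply: le_Rintegral => //.
  - apply/int/bounded_measurableX/bounded_measurableD => //; exact: bounded_measurable_cst.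
  - exact: (integrableZl mA 3 i3).
  - move=> x _; move: (F n x) (f x) => u v.
    have := sqr_ge0 (u - v - v); have := sqr_ge0 (u - v - 1); have := sqr_ge0 (v - 1).
    nra.
have i2 := integrableD mA (iFf n) if2.
have i3 := integrableD mA i2 (ic 1).
rewrite RintegralZl// ler_pM2l// RintegralD// RintegralD// Rintegral_cst// mul1r -/m.
by rewrite -addrA -[leRHS]addrA lerD2r.
Qed.

End integral_lemmas.

Section series.
Variable R : realType.
Implicit Types (u : nat -> R) (v : nat -> \bar R).

Lemma eseries1_mkcond v : (\sum_(1 <= i <oo) v i =
  \sum_(0 <= i <oo) (if (1 <= i)%N then v i else 0))%E.
Proof.
congr (lim (_ @ \oo)); apply/funext => -[|n]; first by rewrite !big_geq.
by rewrite [RHS]big_ltn//= add0e big_nat [RHS]big_nat; apply: eq_bigr => -[].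
Qed.

Lemma eseries_le u (K : R) : (forall i, (1 <= i)%N -> 0 <= u i) ->
  (forall n, \sum_(1 <= i < n) u i <= K) ->
  (\sum_(1 <= i <oo) (u i)%:E <= K%:E)%E.
Proof.
move=> u0 uK; apply: lime_le.
  by apply: is_cvg_nneseries => i i1 _; rewrite lee_fin u0.
by apply: filterE => n; rewrite sumEFin lee_fin.
Qed.

Lemma eseries_ge u n : (forall i, (1 <= i)%N -> 0 <= u i) ->
  ((\sum_(1 <= i < n) u i)%:E <= \sum_(1 <= i <oo) (u i)%:E)%E.
Proof.
move=> u0; rewrite -sumEFin; apply: nneseries_lim_ge => i i1 _.
by rewrite lee_fin u0.
Qed.

Lemma eseries_cvg u (S : R) : (forall i, (1 <= i)%N -> 0 <= u i) ->
  (\sum_(1 <= i <oo) (u i)%:E = S%:E)%E ->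
  \sum_(1 <= i < n) u i @[n --> \oo] --> S.
Proof.
move=> u0 uS.
have : (\sum_(1 <= i < n) (u i)%:E)%E @[n --> \oo] --> S%:E.
  rewrite -uS; apply: is_cvg_nneseries => i i1 _.
  by rewrite lee_fin u0.
by move=> /fine_cvg; apply: cvg_trans; apply: near_eq_cvg; apply: filterE => n /=;
  rewrite sumEFin.
Qed.

End series.

Section integral_series.
Context d (T : measurableType d) (R : realType) (mu : {measure set T -> \bar R}).
Variables (A : set T) (mA : measurable A) (f : nat -> T -> R) (w : nat -> R).
Hypothesis mf : forall i, (1 <= i)%N -> measurable_fun A (f i).
Hypothesis f_ge0 : forall i x, (1 <= i)%N -> A x -> 0 <= f i x.
Hypothesis w_ge0 : forall i, (1 <= i)%N -> 0 <= w i.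

Let g i x : \bar R := (if (1 <= i)%N then (w i * f i x)%:E else 0)%E.

Let mg i : measurable_fun A (g i).
Proof.
case: i => [|i]; first exact: measurable_cst.
by apply/measurable_EFinP; apply: measurable_funM => //; exact: mf.
Qed.

Let g0 i x : A x -> (0 <= g i x)%E.
Proof. by move=> Ax; case: i => // i; rewrite lee_fin mulr_ge0 ?w_ge0 ?f_ge0. Qed.

Lemma measurable_eseries :
  measurable_fun A (fun x => (\sum_(1 <= i <oo) (w i * f i x)%:E)%E).
Proof.
under eq_fun do rewrite eseries1_mkcond.
rewrite (_ : (fun _ => _) = fun x => (\sum_(0 <= i <oo | i \in xpredT) g i x)%E).
  by apply: ge0_emeasurable_sum => // i x Ax _; exact: g0.
by apply/funext => x; apply: congr_lim.
Qed.

Lemma integral_eseries : (forall i, (1 <= i)%N -> mu.-integrable A (EFin \o f i)) ->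
  (\int[mu]_(x in A) (\sum_(1 <= i <oo) (w i * f i x)%:E) =
   \sum_(1 <= i <oo) (w i * \int[mu]_(x in A) f i x)%:E)%E.
Proof.
move=> intf; rewrite [RHS]eseries1_mkcond.
under eq_integral do rewrite eseries1_mkcond.
rewrite (@integral_nneseries _ _ _ _ _ _ g)//.
apply: eq_eseriesr => -[_|i _]; first exact: integral0.
rewrite -RintegralZl//; last exact: intf.
by rewrite fineK//; apply: integrable_fin_num => //; exact: (integrableZl mA _ (intf i.+1 _)).
Qed.

End integral_series.

Section fine_square.
Context d (T : measurableType d) (R : realType) (mu : {measure set T -> \bar R}).
Variables (A : set T) (mA : measurable A) (Afin : (mu A < +oo)%E).
Variable rho : T -> \bar R.
Hypotheses (mrho : measurable_fun A rho) (rho_ge0 : forall x, A x -> (0 <= rho x)%E).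
Hypothesis rho2 : (\int[mu]_(x in A) (rho x ^+ 2) < +oo)%E.

Let mrho2 : measurable_fun A (fun x => (rho x ^+ 2)%E).
Proof. exact: (emeasurable_funM mrho mrho). Qed.

Let rho2_ge0 x : A x -> (0 <= rho x ^+ 2)%E.
Proof. by move=> /rho_ge0; exact: expe_ge0. Qed.

(** By [rho <= 1 + rho ^+ 2] on a set of finite measure. Hence the extended-valued [rho] is infinite
    only on a null set and may be replaced by its real part [fine (rho x)], which is 0 there. *)
Lemma integrable_of_square : mu.-integrable A rho.
Proof.
apply/integrableP; split => //.
apply: (@le_lt_trans _ _ (\int[mu]_(x in A) (1 + rho x ^+ 2))%E).
  apply: ge0_le_integral => //.
  - exact: measurableT_comp.
  - by apply: emeasurable_funD.
  - move=> x Ax; have := rho_ge0 Ax; case: (rho x) => [r|_|//].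
      move=> r0; rewrite lee_fin in r0; rewrite abse_EFin expe2 -EFinM -EFinD lee_fin ger0_norm//.
      by have := sqr_ge0 (r - 1); nra.
    by rewrite expe2 mulyy addey ?leey.
rewrite ge0_integralD// integral_cst// mul1e; exact: lte_add_pinfty.
Qed.

Let r x := fine (rho x).

Let mr : measurable_fun A r.
Proof. exact: measurableT_comp. Qed.

Let r_le x : A x -> 0 <= r x /\ ((r x)%:E <= rho x)%E.
Proof. by move=> /rho_ge0; rewrite /r; case: (rho x) => [y|_|//]; rewrite ?leey. Qed.

Lemma integrable_fine : mu.-integrable A (EFin \o r).
Proof.
apply: le_integrable integrable_of_square => //; first exact/measurable_EFinP.
by move=> x Ax; have [r0 rle] := r_le Ax; rewrite /= ger0_norm// gee0_abs// rho_ge0.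
Qed.

Lemma integrable_fine_square : mu.-integrable A (EFin \o (fun x => r x ^+ 2)).
Proof.
have : mu.-integrable A (fun x => (rho x ^+ 2)%E).
  apply/integrableP; split => //; rewrite (eq_integral (fun x => (rho x ^+ 2)%E))// => x.
  by move=> /set_mem Ax; rewrite gee0_abs// rho2_ge0.
apply: le_integrable => //; first exact/measurable_EFinP/measurable_funX.
move=> x Ax; rewrite /= ger0_norm ?sqr_ge0// gee0_abs ?rho2_ge0//.
by have := rho_ge0 Ax; rewrite /r; case: (rho x) => [y|_|//]; rewrite ?leey.
Qed.

Let ae_fine : {ae mu, forall x, A x -> (r x)%:E = rho x}.
Proof.
have := integrable_ae mA integrable_of_square; apply: filterS => x h Ax.
by rewrite /r fineK// h.
Qed.

Lemma integral_fine : (\int[mu]_(x in A) rho x = (\int[mu]_(x in A) r x)%:E)%E.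
Proof.
rewrite fineK; last exact: integrable_fin_num integrable_fine.
apply: ae_eq_integral => //; first exact/measurable_EFinP.
by apply: filterS ae_fine => x h Ax; rewrite h.
Qed.

Lemma integral_sub_fine (F : T -> R) : measurable_fun A F ->
  (\int[mu]_(x in A) ((F x - r x) ^+ 2)%:E =
   \int[mu]_(x in A) (`|(F x)%:E - rho x| ^+ 2))%E.
Proof.
move=> mF; have mrF : measurable_fun A (fun x => (`|(F x)%:E - rho x|)%E).
  by apply: measurableT_comp => //; apply: emeasurable_funB => //; exact/measurable_EFinP.
apply: ae_eq_integral => //.
- exact/measurable_EFinP/measurable_funX/measurable_funB.
- exact: (emeasurable_funM mrF mrF).
- apply: filterS ae_fine => x h Ax; rewrite -h// -EFinB abse_EFin expe2 -EFinM.
  by rewrite -expr2 real_normK ?num_real.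
Qed.

End fine_square.

Section moment_limit.
Variables (R : realType) (n : nat -> nat -> R) (n0 : nat -> R) (p : nat -> nat).
Variables (psi : nat -> R) (K S0 : R) (S : nat -> R).
Hypothesis p_ge : forall k, (k <= p k)%N.
Hypothesis n_ge0 : forall k i, (1 <= i <= p k)%N -> 0 <= n k i.
Hypothesis n_cvg : forall i, (1 <= i)%N -> n k i @[k --> \oo] --> n0 i.
Hypothesis psi_gt0 : forall i, (1 <= i)%N -> 0 < psi i.
Hypothesis psi_le : forall i j, (1 <= i <= j)%N -> psi i <= psi j.
Hypothesis psi_cvg : psi i @[i --> \oo] --> +oo.
Hypothesis psiK : \forall k \near \oo,
  \sum_(1 <= i < (p k).+1) i%:R * psi i * n k i <= K.
Hypothesis S_le : \forall k \near \oo, S k <= \sum_(1 <= i < (p k).+1) i%:R * n k i.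
Hypothesis S_cvg : S k @[k --> \oo] --> S0.

Let limit_sum w m : \sum_(1 <= i < m) w i * n k i @[k --> \oo] -->
  \sum_(1 <= i < m) w i * n0 i.
Proof. exact: (sum_cvg n_cvg). Qed.

(** A fixed partial sum is dominated by the full truncated moment once [p k] is large, and only
    finitely many terms pass to the limit. *)
Lemma limit_moment_le m : \sum_(1 <= i < m) i%:R * psi i * n0 i <= K.
Proof.
suff H q : \sum_(1 <= i < q.+1) i%:R * psi i * n0 i <= K.
  by case: m => [|m]; [have := H 0; rewrite !big_geq|exact: H].
apply: (ler_cvg_to (@limit_sum (fun i => i%:R * psi i) q.+1) (@cvg_cst _ K _ \oo _)).
have qk : \forall k \near \oo, (q <= k)%N by exists q.
apply: filterS2 qk psiK => k qk; apply: le_trans.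
rewrite (@big_cat_nat _ _ _ q.+1 1 (p k).+1)//=; last by rewrite ltnS (leq_trans qk).
rewrite lerDl big_nat; apply: sumr_ge0 => i /andP[qi ip].
have i1 : (1 <= i)%N by exact: leq_trans qi.
by rewrite !mulr_ge0 ?n_ge0 ?i1// ltW// psi_gt0.
Qed.

(** Since [psi] is nondecreasing, the mass carried by sizes at least [q] is at most [K / psi q]
    uniformly in [k]; this is below [e] for large [q], and the finite remaining sum converges. *)
Lemma limit_mass_ge : (S0%:E <= \sum_(1 <= i <oo) (i%:R * n0 i)%:E)%E.
Proof.
have K0 : 0 <= K by have := limit_moment_le 0; rewrite big_geq.
have n0_ge0 i : (1 <= i)%N -> 0 <= n0 i.
  move=> i1; apply: (ler_cvg_to (@cvg_cst _ 0 _ \oo _) (n_cvg i1)).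
  by exists i => // k ik; rewrite n_ge0// i1 (leq_trans ik)// p_ge.
apply/lee_addgt0Pr => e e0.
have [q [q1 qK]] : exists q, (1 <= q)%N /\ K / e <= psi q.
  apply: (@filter_ex _ \oo); apply: filterI; first by exists 1%N.
  by have /cvgryPge/(_ (K / e)) := psi_cvg.
have psiq := psi_gt0 q1.
apply: (@le_trans _ _ (\sum_(1 <= i < q) i%:R * n0 i + e)%:E); last first.
  rewrite EFinD leeD2r//; apply: eseries_ge => i i1.
  by rewrite mulr_ge0 ?n0_ge0.
rewrite lee_fin; apply: (ler_cvg_to S_cvg).
  by apply: cvgD; [exact: (@limit_sum (fun i => i%:R))|exact: cvg_cst].
have qk : \forall k \near \oo, (q <= k)%N by exists q.
apply: filterS3 qk psiK S_le => k qk Kk /le_trans; apply.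
have qp : (q <= (p k).+1)%N by exact: leqW (leq_trans qk (p_ge k)).
rewrite (@big_cat_nat _ _ _ q 1 (p k).+1)//= lerD2l.
rewrite -(ler_pM2l psiq); apply: le_trans (_ : K <= _); last first.
  by move: qK; rewrite ler_pdivrMr.
apply: le_trans Kk; rewrite (@big_cat_nat _ _ _ q 1 (p k).+1)//=.
rewrite ler_wpDl//.
  rewrite big_nat; apply: sumr_ge0 => i /andP[i1 iq].
  rewrite !mulr_ge0 ?n_ge0 ?i1 ?(leq_trans (ltnW iq)) ?(leq_trans qk)//.
  by rewrite ltW// psi_gt0.
rewrite mulr_sumr [leLHS]big_nat [leRHS]big_nat; apply: ler_sum => i /andP[qi ip].
have i1 : (1 <= i)%N by exact: leq_trans qi.
by rewrite mulrA ler_wpM2r ?n_ge0 ?i1// mulrC ler_wpM2l// psi_le ?q1.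
Qed.

End moment_limit.

(** * Uniform bounds along the approximating sequence *)

Section constructed.
Variables (R : realType) (N : nat) (Om : set 'rV[R]_N).
Local Notation E := 'rV[R]_N.
Local Notation mu := (lebesgue_rV R N).
Hypotheses (oO : open Om) (bO : bounded_set Om) (sO : smooth_boundary Om).
Variables (a beta : nat -> nat -> R) (B d : nat -> R) (theta : R -> R).
Hypothesis aP : forall i j, (1 <= i)%N -> (1 <= j)%N ->
  [/\ a i j = a j i, 0 <= a i j & 0 <= beta i j].
Hypothesis B1 : B 1%N = 0.
Hypothesis B_ge0 : forall i, (1 <= i)%N -> 0 <= B i.
Hypothesis beta_mass : forall i, (2 <= i)%N ->
  i%:R = \sum_(1 <= j < i) j%:R * beta i j.
Hypothesis d_inf :
  (0 < ereal_inf [set (d i)%:E | i in [set i | (1 <= i)%N]])%E.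
Hypothesis d_sup :
  (ereal_sup [set (d i)%:E | i in [set i | (1 <= i)%N]] < +oo)%E.
Hypothesis theta_gt0 : forall x, 0 <= x -> 0 < theta x.
Hypothesis theta_bounded : exists K, forall x, 0 <= x -> theta x <= K.
Hypothesis theta_cvg : theta x @[x --> +oo] --> 0.
Hypothesis a_theta : forall i j, (1 <= i <= j)%N ->
  a i j <= (i + j)%:R * theta (j%:R / i%:R).
Variable c0 : nat -> E -> R.
Hypothesis c0P : forall i, (1 <= i)%N ->
  measurable_fun Om (c0 i) /\ (forall x, Om x -> 0 <= c0 i x).
Hypothesis rho0 : (\int[mu]_(x in Om) (mass (fun i => c0 i x) ^+ 2) < +oo)%E.

Let mO : measurable Om.
Proof. exact: open_measurable_rV. Qed.

Let Ofin : (mu Om < +oo)%E.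
Proof. exact: open_bounded_lty. Qed.

Let int f : bounded_measurable Om f -> mu.-integrable Om (EFin \o f).
Proof. exact: bounded_measurable_integrable. Qed.

Lemma diffusion_bounds : exists delta D : R,
  0 < delta /\ forall i, (1 <= i)%N -> delta <= d i <= D.
Proof.
have lo i : (1 <= i)%N ->
    (ereal_inf [set (d i)%:E | i in [set i | (1 <= i)%N]] <= (d i)%:E)%E.
  by move=> i1; apply: ereal_inf_lbound; exists i.
have hi i : (1 <= i)%N ->
    ((d i)%:E <= ereal_sup [set (d i)%:E | i in [set i | (1 <= i)%N]])%E.
  by move=> i1; apply: ereal_sup_ubound; exists i.
move: lo hi d_inf d_sup.
case: (ereal_inf _) => [delta|lo|_ _ //]; last by have := lo _ (leqnn 1).
case: (ereal_sup _) => [D|//|_ hi]; last by have := hi _ (leqnn 1).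
move=> lo hi delta0 _; exists delta, D; split=> [|i i1]; first by rewrite -lte_fin.
by rewrite -!lee_fin lo// hi.
Qed.

Lemma Rintegral_weighted_sum (s : seq nat) (w : nat -> R) (F : nat -> E -> R) :
  {in s, forall i, bounded_measurable Om (F i)} ->
  \int[mu]_(x in Om) (\sum_(i <- s) w i * F i x) =
  \sum_(i <- s) w i * \int[mu]_(x in Om) F i x.
Proof.
move=> bF; rewrite Rintegral_sum//.
  by apply: eq_big_seq => i si; rewrite RintegralZl//; exact/int/bF.
by move=> i si; apply: int; apply: bounded_measurableM (bF i si);
  exact: bounded_measurable_cst.
Qed.

Section truncated_solution.
Variables (M : nat) (c0M : nat -> E -> R) (cM : nat -> R -> E -> R).
Hypothesis cMP : truncated_solution Om a beta B d M c0M cM.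

Lemma truncated_bounded_measurable i (t : R) : (1 <= i <= M)%N -> 0 <= t ->
  bounded_measurable Om (cM i t).
Proof.
move=> iM t0; have [ut [g [h [[cc _ _ _] _ _ _]]]] := trunc_eq cMP iM.
apply: within_closure_bounded_measurable => //.
by apply: (cylinder_slice cc); rewrite /= in_itv/= t0.
Qed.

Lemma truncated_data_bounded_measurable i : (1 <= i <= M)%N ->
  bounded_measurable Om (c0M i).
Proof.
move=> iM; apply: eq_bounded_measurable (truncated_bounded_measurable iM (lexx 0)).
by move=> x Ox; have [_ _ ->] := trunc_data cMP iM => //; exact: subset_closure.
Qed.

End truncated_solution.

Let rho x := mass (fun i => c0 i x).

Let mrho : measurable_fun Om rho.
Proof.
by apply: (@measurable_eseries _ _ _ _ _ (fun i => i%:R)) => // i; [case/c0P|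
  move=> x i1 Ox; have [_ ->] := c0P i1].
Qed.

Let rho_ge0 x : Om x -> (0 <= rho x)%E.
Proof.
move=> Ox; apply: nneseries_ge0 => i i1 _.
by rewrite lee_fin mulr_ge0//; have [_ ->] := c0P i1.
Qed.

Let int_c0 i : (1 <= i)%N -> mu.-integrable Om (EFin \o c0 i).
Proof.
move=> i1; have [mc _] := c0P i1.
apply: le_integrable (integrable_of_square mO Ofin mrho rho_ge0 rho0) => //.
  exact/measurable_EFinP.
move=> x Ox; rewrite [leRHS]gee0_abs ?rho_ge0//=.
have c_ge0 j : (1 <= j)%N -> 0 <= j%:R * c0 j x.
  by move=> j1; rewrite mulr_ge0//; have [_ ->] := c0P j1.
apply: le_trans (eseries_ge i.+1 c_ge0); rewrite big_nat_recr//= lee_fin.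
have ci : 0 <= c0 i x by have [_ ->] := c0P i1.
rewrite ger0_norm// ler_wpDl//; last by rewrite ler_peMl// ler1n.
by rewrite big_nat; apply: sumr_ge0 => j /andP[j1 _]; exact: c_ge0.
Qed.

Variables (c0M : nat -> nat -> E -> R) (cM : nat -> nat -> R -> E -> R).
Hypothesis cMP : forall M, truncated_solution Om a beta B d M (c0M M) (cM M).
Hypothesis c0M_cvg : forall i, (1 <= i)%N -> L1_cvg Om (fun M => c0M M i) (c0 i).
Hypothesis rhoM_cvg : (\int[mu]_(x in Om)
  (`| (\sum_(1 <= i < M.+1) i%:R * c0M M i x)%:E - mass (fun i => c0 i x) | ^+ 2))%E
    @[M --> \oo] --> 0%E.

(** The weight is fixed from the initial data and [theta] before any evolution, hence is the same
    for all [M] and all times. [S M] is the initial mass of the truncated problem. *)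
Lemma uniform_truncated_moment : exists (psi : nat -> R) (K0 K1 S0 : R) (S : nat -> R),
  [/\ [/\ forall i, (1 <= i)%N -> 0 < psi i,
          forall i j, (1 <= i < j)%N -> psi i < psi j & psi i @[i --> \oo] --> +oo],
      0 <= K0 /\ 0 <= K1,
      (\int[mu]_(x in Om) mass (fun i => c0 i x) = S0%:E)%E,
      S M @[M --> \oo] --> S0 &
      \forall M \near \oo, forall t : R, 0 <= t ->
        \sum_(1 <= i < M.+1) i%:R * psi i * \int[mu]_(x in Om) cM M i t x
          <= K0 + K1 * t /\
        S M <= \sum_(1 <= i < M.+1) i%:R * \int[mu]_(x in Om) cM M i t x].
Proof.
have [delta [D [delta0 dP]]] := diffusion_bounds.
pose r := fine \o rho; pose S0 := \int[mu]_(x in Om) r x.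
pose F M x := \sum_(1 <= i < M.+1) i%:R * c0M M i x.
pose m M i := \int[mu]_(x in Om) c0M M i x.
have inM M i : i \in index_iota 1 M.+1 -> (1 <= i <= M)%N.
  by rewrite mem_index_iota ltnS.
have bc0 M i : (1 <= i <= M)%N -> bounded_measurable Om (c0M M i).
  exact: truncated_data_bounded_measurable.
have bF M : bounded_measurable Om (F M).
  apply: bounded_measurable_sum => i /inM iM.
  by apply: bounded_measurableM (bc0 M i iM); exact: bounded_measurable_cst.
have rhoM : (\int[mu]_(x in Om) (((F M x - r x) ^+ 2)%:E))%E @[M --> \oo] --> 0%E.
  apply: cvg_trans rhoM_cvg; apply: near_eq_cvg; apply: filterE => M.
  by rewrite (integral_sub_fine mO Ofin mrho rho_ge0 rho0)//; have [] := bF M.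
have [] := L2_Rintegral_cvg mO Ofin bF
  (integrable_fine mO Ofin mrho rho_ge0 rho0)
  (integrable_fine_square mO mrho rho_ge0 rho0) rhoM.
set J := 3 * _; rewrite -/S0 => FS0 FJ.
have intF M w : \int[mu]_(x in Om) (\sum_(1 <= i < M.+1) w i * c0M M i x) =
    \sum_(1 <= i < M.+1) w i * m M i.
  by apply: Rintegral_weighted_sum => i /inM; exact: bc0.
have S_cvg : \sum_(1 <= i < M.+1) i%:R * m M i @[M --> \oo] --> S0.
  apply: cvg_trans FS0; apply: near_eq_cvg; apply: filterE => M.
  by rewrite (intF M (fun i => i%:R)).
have m_ge0 M i : (1 <= i <= M)%N -> 0 <= m M i.
  move=> iM; apply: Rintegral_ge0 => x Ox.
  by have [_ ->] := trunc_data (cMP M) iM.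
have m_cvg i : (1 <= i)%N -> m M i @[M --> \oo] --> \int[mu]_(x in Om) c0 i x.
  move=> i1; apply: Rintegral_cvg => //; last exact: c0M_cvg.
    by exists i => // M iM; apply: int; apply: bc0; rewrite i1.
  exact: int_c0.
have S0E : \sum_(1 <= i < n) i%:R * \int[mu]_(x in Om) c0 i x @[n --> \oo] --> S0.
  apply: eseries_cvg => [i i1|].
    by rewrite mulr_ge0// Rintegral_ge0// => x Ox; have [_ ->] := c0P i1.
  rewrite -(@integral_eseries _ _ _ mu _ mO c0 (fun i => i%:R))//.
  - exact: integral_fine.
  - by move=> i /c0P[].
  - by move=> i x i1 Ox; have [_ ->] := c0P i1.
have [n_ nP] := tight_thresholds m_ge0 m_cvg S_cvg S0E.
have a_sym i j : (1 <= i)%N -> (1 <= j)%N -> a i j = a j i /\ 0 <= a i j.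
  by move=> i1 j1; have [] := aP i1 j1.
have [psi [C [C0 [psi0 psi_lt psi_cvg psiC psi_n]]]] :=
  superlinear_weight a_sym theta_gt0 theta_bounded theta_cvg a_theta n_.
have psi_le i j : (1 <= i <= j)%N -> psi i <= psi j.
  move=> /andP[i1]; rewrite leq_eqVlt => /predU1P[->//|ij].
  by apply/ltW/psi_lt; rewrite i1.
have S0_ge0 : 0 <= S0.
  by apply: Rintegral_ge0 => x Ox; rewrite fine_ge0// rho_ge0.
have J0 : 0 <= J.
  apply: mulr_ge0 => //; apply: addr_ge0; last exact: fine_ge0.
  by apply: addr_ge0 => //; apply: Rintegral_ge0 => x _; exact: sqr_ge0.
(* [S0 + 1] bounds the initial masses for large [M], [3 * _ + 1] comes from [superlinear_data_le]
   and 2 from [truncated_moment_estimate]; [J] bounds the integral of the squared data. *)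
exists psi, (3 * (S0 + 1) + 1 + 2), (C * ((D / delta) ^+ 2 * (J + 1))), S0,
  (fun M => \sum_(1 <= i < M.+1) i%:R * m M i); split => //.
- split; first by move: S0_ge0; lra.
  by apply: mulr_ge0 => //; apply: mulr_ge0; [exact: sqr_ge0|exact: addr_ge0].
- exact: integral_fine.
have lt1 : S0 < S0 + 1 by rewrite ltrDl.
have S1 := cvgr_le _ S_cvg _ lt1.
apply: filterS2 (S1 _) FJ => M SM JM t t0.
have intc w : \sum_(1 <= i < M.+1) w i * \int[mu]_(x in Om) cM M i t x =
    \int[mu]_(x in Om) (\sum_(1 <= i < M.+1) w i * cM M i t x).
  rewrite Rintegral_weighted_sum// => i /inM iM.
  exact: (truncated_bounded_measurable (cMP M) iM t0).
split; last first.
  rewrite (intc (fun i => i%:R)) -(intF M (fun i => i%:R)).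
  exact: (truncated_mass_ge oO bO sO aP B1 beta_mass (cMP M) t0).
rewrite (intc (fun i => i%:R * psi i)).
have tt : 0 <= t <= t by rewrite t0 lexx.
apply: le_trans (truncated_moment_estimate oO bO sO aP B1 B_ge0 beta_mass
  delta0 dP (cMP M) C0 psi_le psiC tt) _.
rewrite (intF M (fun i => i%:R * psi i)) -addrA addrA.
apply: lerD; last first.
  rewrite -mulrA ler_wpM2l// mulrC ler_wpM2r// ler_wpM2l ?sqr_ge0// lerD2r.
  exact: JM.
rewrite lerD2r; apply: le_trans (superlinear_data_le m_ge0 M nP psi_n) _.
by rewrite lerD2r ler_pM2l.
Qed.

End constructed.

Theorem theorem1p9 (R : realType) (N : nat) (Om : set 'rV[R]_N)
    (a beta : nat -> nat -> R) (B d : nat -> R)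
    (c0 : nat -> 'rV[R]_N -> R) (theta : R -> R)
    (c : nat -> R -> 'rV[R]_N -> R) :
  (0 < N)%N ->
  open Om -> bounded_set Om -> smooth_boundary Om ->
  (forall i j, (1 <= i)%N -> (1 <= j)%N ->
     [/\ a i j = a j i, 0 <= a i j & 0 <= beta i j]) ->
  B 1%N = 0 -> (forall i, (1 <= i)%N -> 0 <= B i) ->
  (forall i, (2 <= i)%N -> i%:R = \sum_(1 <= j < i) j%:R * beta i j) ->
  (forall i, (1 <= i)%N -> a i j / j%:R @[j --> \oo] --> 0) ->
  (forall i, (1 <= i)%N ->
     B (i + j)%N * beta (i + j)%N i / (i + j)%:R @[j --> \oo] --> 0) ->
  (0 < ereal_inf [set (d i)%:E | i in [set i | (1 <= i)%N]])%E ->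
  (ereal_sup [set (d i)%:E | i in [set i | (1 <= i)%N]] < +oo)%E ->
  (forall i, (1 <= i)%N ->
     measurable_fun Om (c0 i) /\ (forall x, Om x -> 0 <= c0 i x)) ->
  (\int[lebesgue_rV R N]_(x in Om) (mass (fun i => c0 i x) ^+ 2) < +oo)%E ->
  (forall x, 0 <= x -> 0 < theta x) ->
  (exists K, forall x, 0 <= x -> theta x <= K) ->
  theta x @[x --> +oo] --> 0 ->
  (forall i j, (1 <= i <= j)%N -> a i j <= (i + j)%:R * theta (j%:R / i%:R)) ->
  constructed_weak_solution Om a beta B d c0 c ->
  (exists (C : R -> R) (psi : nat -> R),
     [/\ (forall T, 0 < T -> 0 < C T) /\
         (forall S T, 0 < S -> S < T -> C S < C T),
         (forall i, (1 <= i)%N -> 0 < psi i) /\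
         (forall i j, (1 <= i < j)%N -> psi i < psi j),
         psi i @[i --> \oo] --> +oo &
         forall T, 0 < T -> forall t, t \in `[0, T] ->
           (\int[lebesgue_rV R N]_(x in Om)
              \sum_(1 <= i <oo) ((i%:R * psi i * c i t x)%:E) <= (C T)%:E)%E])
  /\
  (forall t, 0 <= t ->
     (\int[lebesgue_rV R N]_(x in Om) mass (fun i => c0 i x) =
      \int[lebesgue_rV R N]_(x in Om) mass (fun i => c i t x))%E).
Proof.
move=> N0 oO bO sO aP B1 B_ge0 beta_mass _ _ d_inf d_sup c0P rho0 theta_gt0
  theta_bounded theta_cvg a_theta [cP [cM [c0M [sigma [cMP c0M_cvg rhoM_cvg
  sigma_lt sigma_cvg]]]]].
have mO : measurable Om by exact: open_measurable_rV.
have [psi [K0 [K1 [S0 [S [[psi0 psi_lt psi_cvg] [K0_ge0 K1_ge0] S0E S_cvg nearM]]]]]] :=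
  uniform_truncated_moment oO bO sO aP B1 B_ge0 beta_mass d_inf d_sup theta_gt0
    theta_bounded theta_cvg a_theta c0P rho0 cMP c0M_cvg rhoM_cvg.
have psi_le i j : (1 <= i <= j)%N -> psi i <= psi j.
  move=> /andP[i1]; rewrite leq_eqVlt => /predU1P[->//|ij].
  by apply/ltW/psi_lt; rewrite i1.
have sigma_ge k : (k <= sigma k)%N.
  by elim: k => // k IH; rewrite (leq_ltn_trans IH)// sigma_lt.
have near_sigma (P : nat -> Prop) : (\forall M \near \oo, P M) ->
    \forall k \near \oo, P (sigma k).
  by move=> [M0 _ PM]; exists M0 => // k kM; apply: PM; exact: leq_trans (sigma_ge k).
(* The final time must be positive; [t + 1] also covers [t = 0]. *)
have int_c (t : R) i : 0 <= t -> (1 <= i)%N -> inL1 Om (c i t).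
  move=> t0 i1; have [+ _] := @weak_continuous _ _ _ _ _ _ _ _ _ cP i (t + 1) i1
    (ltr_wpDl t0 ltr01); apply.
  by rewrite in_itv/= t0 lerDl ler01.
have c_ge0 (t : R) i x : 0 <= t -> (1 <= i)%N -> Om x -> 0 <= c i t x.
  by move=> t0 i1; exact: (weak_ge0 cP i1 t0).
have n_ge0 (t : R) k i : 0 <= t -> (1 <= i <= sigma k)%N ->
    0 <= \int[lebesgue_rV R N]_(x in Om) cM (sigma k) i t x.
  move=> t0 ik; apply: Rintegral_ge0 => x Ox.
  exact: (trunc_ge0 (cMP (sigma k)) ik t0 Ox).
have n0_ge0 (t : R) i : 0 <= t -> (1 <= i)%N ->
    0 <= \int[lebesgue_rV R N]_(x in Om) c i t x.
  by move=> t0 i1; apply: Rintegral_ge0 => x Ox; exact: c_ge0.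
have n_cvg (t : R) i : 0 <= t -> (1 <= i)%N ->
    \int[lebesgue_rV R N]_(x in Om) cM (sigma k) i t x @[k --> \oo] -->
    \int[lebesgue_rV R N]_(x in Om) c i t x.
  move=> t0 i1; apply: Rintegral_cvg => //; last 2 first.
  - exact: int_c.
  - have t1 : 0 < t + 1 by rewrite ltr_wpDl.
    apply: squeeze_cvge (cvg_cst _) (sigma_cvg i (t + 1) i1 t1).
    apply: filterE => k; rewrite integral_ge0//=.
    by apply: ereal_sup_ubound; exists t => //=; rewrite in_itv/= t0 lerDl ler01.
  exists i => // k ik; apply: bounded_measurable_integrable => //.
    exact: open_bounded_lty.
  apply: (truncated_bounded_measurable oO bO (cMP (sigma k))) => //.
  by rewrite i1 (leq_trans _ (sigma_ge k)).
have momE (w : nat -> R) (t : R) : 0 <= t -> (forall i, (1 <= i)%N -> 0 <= w i) ->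
    (\int[lebesgue_rV R N]_(x in Om) (\sum_(1 <= i <oo) (w i * c i t x)%:E) =
     \sum_(1 <= i <oo) (w i * \int[lebesgue_rV R N]_(x in Om) c i t x)%:E)%E.
  move=> t0 w0; apply: (@integral_eseries _ _ _ _ _ mO (fun i => c i t)) => //.
  - by move=> i i1; apply/measurable_EFinP; exact: measurable_int (int_c t i t0 i1).
  - by move=> i x i1; exact: c_ge0.
  - by move=> i i1; exact: int_c.
have momK (t : R) : 0 <= t -> \forall k \near \oo,
    \sum_(1 <= i < (sigma k).+1)
      i%:R * psi i * \int[lebesgue_rV R N]_(x in Om) cM (sigma k) i t x <= K0 + K1 * t.
  by move=> t0; apply: filterS (near_sigma _ nearM) => k /(_ t t0)[].
split.
  (* The extra [T] makes the bound positive and strictly increasing even if [K0] and [K1] vanish. *)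
  exists (fun T => K0 + K1 * T + T), psi; split => //.
    split=> [T T0|s T s0 sT]; first by rewrite ltr_wpDl// addr_ge0// mulr_ge0// ltW.
    by rewrite ler_ltD// lerD2l ler_wpM2l// ltW.
  move=> T T0 t; rewrite in_itv/= => /andP[t0 tT].
  rewrite (momE (fun i => i%:R * psi i))//; last first.
    by move=> i i1; rewrite mulr_ge0// ltW// psi0.
  apply: eseries_le => [i i1|m].
    by rewrite mulr_ge0 ?n0_ge0// mulr_ge0// ltW// psi0.
  apply: le_trans (_ : K0 + K1 * t <= _); last first.
    by rewrite -[leLHS]addr0 lerD ?(ltW T0)// lerD2l ler_wpM2l.
  apply: (limit_moment_le sigma_ge _ _ psi0 (momK t t0)) => [k i ik|i i1].
    exact: n_ge0.
  exact: n_cvg.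
(* One inequality belongs to the notion of weak solution; the superlinear moment gives the other. *)
move=> t t0; apply/eqP; rewrite eq_le (weak_mass_le cP t0) andbT.
rewrite S0E [leRHS](momE (fun i => i%:R))//.
apply: (@limit_mass_ge _ _ _ _ _ _ _ (S \o sigma) sigma_ge _ _ psi0 psi_le psi_cvg
  (momK t t0)).
- by move=> k i ik; exact: n_ge0.
- by move=> i i1; exact: n_cvg.
- by apply: filterS (near_sigma _ nearM) => k /(_ t t0)[].
- by move=> P /S_cvg; exact: near_sigma.
Qed.
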